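(* For $H\in(1/2,1)$ let $\sigma_H=(2-2^{2-2H})^{-1/2}$ and let $B_H$ be the random continuous function on $[0,1]$ defined as the almost sure uniform limit of $(B_n)_{n\ge1}$ for the parameter $H$. The family of continuous processes $\{B_H/\sigma_H\}_{H\in(1/2,1)}$ converges in law, as $H$ tends to $1/2$, to the restriction to $[0,1]$ of the standard Brownian motion.
   Context: $T=\bigcup_{n\ge 0}\{0,1\}^n$ is the set of finite binary words. Fix $H\in(1/2,1)$. Let $\epsilon$ be a random variable with values in $\{-1,1\}$, equal to $1$ with probability $(1+2^{H-1})/2$ and to $-1$ with probability $(1-2^{H-1})/2$. Let $(\epsilon(w))_{w\in T}$ be independent copies of $\epsilon$. For $n\ge 1$ and $t\in[0,1]$ define $$B_n(t)=2^{-nH}\int_0^t 2^n\,\epsilon(u_1)\epsilon(u_1u_2)\cdots\epsilon(u_1\cdots u_n)\,du,$$ where $(u_k)_{k\ge1}$ is the sequence of binary digits of $u$ (the ambiguity at dyadic points is irrelevant). For $H\in(1/2,1)$, the sequence $(B_n)_{n\ge1}$ converges almost surely uniformly on $[0,1]$ to a random continuous function, denoted $B_H$; moreover $\sigma_H=\sqrt{\mathbb{E}(B_H(1)^2)}$. Convergence in law is weak convergence of probability measures on $\mathcal{C}([0,1])$, the space of real-valued continuous functions on $[0,1]$ with the uniform norm. *)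

(* Defs.v *)
From HB Require Import structures.
From mathcomp Require Import all_boot all_order all_algebra finmap.
From mathcomp Require Import all_classical all_reals all_analysis.

Set Implicit Arguments.
Unset Strict Implicit.
Unset Printing Implicit Defensive.

Import Order.TTheory GRing.Theory Num.Theory.
Import numFieldNormedType.Exports.

Local Open Scope classical_set_scope.
Local Open Scope ring_scope.

Notation I01 R := (set_type (`[0%R, 1%R]%classic : set (Real.sort R))).

Definition C01 (R : realType) : Type := continuousType (I01 R) R.

Definition C01_fun (R : realType) (f : C01 R) : I01 R -> R :=
  Continuous.sort f.
Coercion C01_fun : C01 >-> Funclass.

Definition mkC01 (R : realType) (f : I01 R -> R) (cf : continuous f) : C01 R :=
  (mkcts cf : continuousType (I01 R) R).

HB.instance Definition _ (R : realType) := Choice.copy (C01 R)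
  (continuousType (I01 R) R).

Lemma cst0_I01_continuous (R : realType) :
  continuous ((fun=> 0) : I01 R -> R).
Proof. by move=> t; exact: cst_continuous. Qed.

HB.instance Definition _ (R : realType) :=
  isPointed.Build (C01 R) (mkC01 (@cst0_I01_continuous R)).

(** The metric of [arrow_uniform_type] is that of uniform convergence; as [0,1]
    is compact, it induces on [C01 R] the topology of the uniform norm. *)
HB.instance Definition _ (R : realType) := PseudoMetric.copy (C01 R)
  (initial_topology (@C01_fun R : C01 R -> arrow_uniform_type (I01 R) R)).

Lemma C01_ballE (R : realType) (f g : C01 R) (e : R) :
  ball f e g = (forall t : I01 R, `|f t - g t| < e).
Proof. by []. Qed.

HB.instance Definition _ (R : realType) := Measurable.copy (C01 R)
  (g_sigma_algebraType (@open (C01 R))).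

Lemma scaleC01_subproof (R : realType) (a : R) (f : C01 R) :
  continuous ((fun t => a * f t) : I01 R -> R).
Proof.
move=> t.
have ca : continuous ((fun=> a) : I01 R -> R).
  by move=> u; exact: cst_continuous.
exact: (cvgM (ca t) (@cts_fun _ _ (f : continuousType (I01 R) R) t)).
Qed.

Definition scaleC01 (R : realType) (a : R) (f : C01 R) : C01 R :=
  mkC01 (@scaleC01_subproof R a f).

Lemma scaleC01_continuous (R : realType) (a : R) :
  continuous (@scaleC01 R a).
Proof.
move=> f.
have FF : Filter (nbhs f) := nbhs_filter f.
apply: (proj2 (@cvg_ballP R (C01 R) (C01 R) (nbhs f) FF _ _)) => e e0.
have a1 : 0 < `|a| + 1 by rewrite ltr_wpDl.
have : nbhs f (ball f (e / (`|a| + 1))) by apply: nbhsx_ballx; exact: divr_gt0.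
apply: filterS => g; rewrite !C01_ballE => fg t.
rewrite [X in `|X|](_ : _ = a * (f t - g t)); last by rewrite mulrBr.
rewrite normrM; apply: (@le_lt_trans _ _ ((`|a| + 1) * `|f t - g t|)).
  by rewrite ler_wpM2r// lerDl.
by rewrite mulrC -ltr_pdivlMr //; exact: fg.
Qed.

Lemma measurable_scaleC01 (R : realType) (a : R) :
  measurable_fun setT (@scaleC01 R a).
Proof.
apply: (@measurability _ _ _ _ _ _ (@open (C01 R))) => //.
move=> _ [U oU <-]; rewrite setTI; apply: sub_sigma_algebra.
by apply: open_comp => // f _; exact: scaleC01_continuous.
Qed.

HB.instance Definition _ (R : realType) (a : R) :=
  isMeasurableFun.Build _ _ (C01 R) (C01 R) (@scaleC01 R a)
    (@measurable_scaleC01 R a).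

Definition weak_cvg (R : realType) (I : Type) (F : set_system I)
    (mu : I -> probability (C01 R) R) (nu : probability (C01 R) R) : Prop :=
  forall Phi : C01 R -> R, continuous Phi -> bounded_fun Phi ->
    \int[mu i]_f Phi f @[i --> F] --> \int[nu]_f Phi f.

Definition mutually_independent (R : realType) (d : measure_display)
    (T : measurableType d) (P : probability T R) (I : choiceType)
    (X : I -> T -> R) : Prop :=
  forall (J : {fset I}) (A : I -> set R),
    (forall i, i \in J -> measurable (A i)) ->
    P (\bigcap_(i in [set` J]) X i @^-1` A i) =
      (\prod_(i <- J) P (X i @^-1` A i))%E.

(** [k]-th binary digit (k >= 1) of u in [0,1[ : the parity of the floor of
    2^k u. *)
Definition bdigit (R : realType) (u : R) (k : nat) : bool :=
  odd (Num.truncn (2 ^+ k * u)).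

Definition bword (R : realType) (u : R) (k : nat) : seq bool :=
  [seq bdigit u j | j <- iota 1 k].

(** Finite binary words are encoded as [seq bool] ([true] is the digit 1). *)
Definition is_weight_family (R : realType) (H : R) (d : measure_display)
    (T : measurableType d) (P : probability T R)
    (eps : seq bool -> {RV P >-> R}) : Prop :=
  [/\ forall w om, eps w om = 1 \/ eps w om = -1,
      forall w, P (eps w @^-1` [set 1]) = ((1 + 2 `^ (H - 1)) / 2)%:E,
      forall w, P (eps w @^-1` [set -1]) = ((1 - 2 `^ (H - 1)) / 2)%:E &
      mutually_independent P (fun w => eps w : T -> R)].

Definition Bn (R : realType) (H : R) (Om : Type) (eps : seq bool -> Om -> R)
    (n : nat) (om : Om) (t : R) : R :=
  2 `^ (- (n%:R * H)) *
  \int[lebesgue_measure]_(u in `[0, t])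
    (2 ^+ n * \prod_(1 <= k < n.+1) eps (bword u k) om).

Definition sigmaH (R : realType) (H : R) : R :=
  (2 - 2 `^ (2 - 2 * H)) `^ (- 2^-1).

(** Brownian motion on [0,+oo[; the values of [W] at negative times are
    unconstrained. [normal_prob] takes the standard deviation. *)
Definition is_brownian_motion (R : realType) (d : measure_display)
    (T : measurableType d) (Q : probability T R) (W : R -> {RV Q >-> R}) :
    Prop :=
  [/\ {ae Q, forall om, W 0 om = 0},
      forall (n : nat) (t : nat -> R), 0 <= t 0%N ->
        (forall k, t k <= t k.+1) ->
        mutually_independent Q
          (fun (k : 'I_n) om => W (t k.+1) om - W (t k) om),
      forall s t : R, 0 <= s -> s < t -> forall A : set R, measurable A ->
        Q ((fun om => W t om - W s om) @^-1` A) =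
          normal_prob 0 (Num.sqrt (t - s)) A &
      {ae Q, forall om, {within `[0, +oo[, continuous (fun t => W t om)}}].

(* Main.v *)
Require Import Defs.
From mathcomp Require Import all_boot all_order all_algebra finmap.
From mathcomp Require Import all_classical all_reals all_analysis.
From mathcomp Require Import measurable_realfun.
From mathcomp Require Import ring lra.

Set Implicit Arguments.
Unset Strict Implicit.
Unset Printing Implicit Defensive.

Import Order.TTheory GRing.Theory Num.Theory.
Import numFieldNormedType.Exports.

Local Open Scope classical_set_scope.
Local Open Scope ring_scope.

(** Write [th = 2^(-H)], let [p = 2^(H-1)] be the mean of a weight, and let
    [ka = 1 / sigma_H]. Then [th * p = 1/2] and [ka^2 = 2 - 4 * th^2], which tends to 0
    as [H] decreases to 1/2.

    The value [Y] of [B_n] at 1 satisfies the recursion [Y = th * (a * Y' + b * Y'')],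
    where [a] and [b] are two weights and [Y'] and [Y''] are independent copies of the
    value for [n - 1]. Hence [ka * Y] has mean [ka], which vanishes in the limit, its
    second moment tends to 1 as [n] grows ([second_moment]), and its fourth moment
    stays below 9 ([fourth_moment]). The weights themselves do not become centred, but
    the standard normal law is invariant under [(x, y) |-> r * (a * x + b * y)], for all
    signs [a] and [b], where [r = 2^(-1/2)] is the limit of [th]. So the two halves of
    the recursion can be replaced by normal variables one after the other. For a test
    function with a third-order Taylor estimate, the error is of the third order, up to
    the vanishing differences of the first two moments, and each level of the recursion
    multiplies it by at most [2 * th^3 <= r < 1]. This is a central limit theorem,
    without characteristic functions; smoothing extends it to Lipschitz functions, and
    since each increment of [ka * B_N] over a dyadic interval of level [n] is a sign
    times [th^n] times an independent copy of the endpoint value, it extends to the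
    [2^n] increments together: they converge in law to the increments of a Brownian
    motion ([lev_clt]).

    The approximation [B_N] is a broken line ([Bn_path]), and when the level goes from
    [j] to [j + 1] it moves by at most the largest new increment. The fourth powers of
    the increments of level [j] sum up to at most [9 * 2^(-j)] on average
    ([ET_lev_pow4]), so that the total displacement beyond level [n] is at most a
    constant times [2^(-n/4)], for all [H] ([ip_gap], [ET_gap]).

    Convergence in law can be tested on bounded Lipschitz functionals ([weak_cvg_lipC]).
    For these, uniformly in [H], little is lost when [B_H / sigma_H] is replaced by its
    broken line of a large level [n] ([path_tail]); as [H] tends to 1/2 the law of this
    broken line tends to that of the broken line inscribed in the Brownian motion, which
    is close to the Brownian motion itself ([brownian_path_cvg]). *)

(** * Expectations over finite trees of independent signs *)

(** The weights attached to the words of length 1, ..., [n] that extend a given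
    word: below each of the two one-letter extensions sits its sign ([true]
    stands for [1]) and the tree of the signs further down. *)
Fixpoint tree (n : nat) : finType :=
  if n is m.+1 then ((bool * tree m) * (bool * tree m))%type else unit.

Section Tree.
Variable R : realType.
Implicit Types (p th ka : R) (n : nat) (b : bool).

Definition sg b : R := if b then 1 else -1.

(** Law of one sign of mean [p]. *)
Definition pr p b : R := (1 + sg b * p) / 2.

Fixpoint wt p n : tree n -> R :=
  if n is m.+1 then
    fun t => pr p t.1.1 * pr p t.2.1 * (wt p t.1.2 * wt p t.2.2)
  else fun=> 1.

Definition ET p n (F : tree n -> R) : R := \sum_t wt p t * F t.

Lemma sg_sqr b : sg b * sg b = 1.
Proof. by case: b; rewrite /sg ?mulrNN mulr1. Qed.

Lemma norm_bsign b : `|sg b| = 1.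
Proof. by case: b; rewrite /sg ?normrN normr1. Qed.

Section law.
Variables (p : R) (p01 : -1 <= p <= 1).

Lemma pr_ge0 b : 0 <= pr p b.
Proof. by case/andP: p01; rewrite /pr /sg; case: b; lra. Qed.

Lemma wt_ge0 n (t : tree n) : 0 <= wt p t.
Proof.
elim: n t => [|n IH] t /=; first exact: ler01.
by apply: mulr_ge0; apply: mulr_ge0 => //; exact: pr_ge0.
Qed.

Lemma ETS n (F : tree n.+1 -> R) :
  ET p F = \sum_a \sum_b pr p a * pr p b *
    ET p (fun t0 => ET p (fun t1 => F ((a, t0), (b, t1)))).
Proof.
have sum_pairE (I J : finType) (f : I * J -> R) :
    \sum_u f u = \sum_i \sum_j f (i, j).
  by rewrite pair_bigA; apply: eq_bigr => -[].
rewrite /ET; etransitivity; first exact: sum_pairE.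
etransitivity; first exact: sum_pairE.
apply: eq_bigr => a _; under eq_bigr do rewrite sum_pairE.
rewrite exchange_big; apply: eq_bigr => b _; rewrite mulr_sumr.
apply: eq_bigr => t0 _; rewrite !mulr_sumr; apply: eq_bigr => t1 _ /=.
by rewrite !mulrA; congr (_ * _); rewrite mulrAC.
Qed.

Lemma ETD n (F G : tree n -> R) : ET p (fun t => F t + G t) = ET p F + ET p G.
Proof. by rewrite /ET -big_split; apply: eq_bigr => t _; rewrite mulrDr. Qed.

Lemma ETZ n c (F : tree n -> R) : ET p (fun t => c * F t) = c * ET p F.
Proof. by rewrite /ET mulr_sumr; apply: eq_bigr => t _; rewrite mulrCA. Qed.

Lemma ETB n (F G : tree n -> R) : ET p (fun t => F t - G t) = ET p F - ET p G.
Proof. by rewrite /ET -sumrB; apply: eq_bigr => t _; rewrite mulrBr. Qed.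

Lemma eq_ET n (F G : tree n -> R) : F =1 G -> ET p F = ET p G.
Proof. by move=> FG; apply: eq_bigr => t _; rewrite FG. Qed.

Lemma ET_le n (F G : tree n -> R) : (forall t, F t <= G t) -> ET p F <= ET p G.
Proof. by move=> FG; apply: ler_sum => t _; rewrite ler_wpM2l ?wt_ge0. Qed.

Lemma sum_pr2 (A B C D : R) :
  \sum_a \sum_b pr p a * pr p b *
    (A + sg a * B + sg b * C + sg a * sg b * D) = A + p * B + p * C + p ^+ 2 * D.
Proof. by rewrite !big_bool /pr /sg /=; field. Qed.

Lemma ET_cst n c : ET p (fun _ : tree n => c) = c.
Proof.
elim: n c => [|n IH] c; first by rewrite /ET (big_pred1 tt) => [|[]] //=; rewrite mul1r.
rewrite ETS; under eq_bigr do under eq_bigr do rewrite !IH.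
by have := sum_pr2 c 0 0 0; rewrite !mulr0 !addr0 => {2}<-;
  apply: eq_bigr => a _; apply: eq_bigr => b _; rewrite !mulr0 !addr0.
Qed.

Lemma ler_norm_ET n (F : tree n -> R) : `|ET p F| <= ET p (fun t => `|F t|).
Proof.
apply: le_trans (ler_norm_sum _ _ _) _; apply: ler_sum => t _.
by rewrite normrM (ger0_norm (wt_ge0 _)).
Qed.

Lemma ET_dist n (F G : tree n -> R) e :
  (forall t, `|F t - G t| <= e) -> `|ET p F - ET p G| <= e.
Proof.
move=> FG; rewrite -ETB; apply: le_trans (ler_norm_ET _) _.
by rewrite -[leRHS](ET_cst n); exact: ET_le.
Qed.

(** The average over the first two signs of quantities that are all close to
    [c] is close to [c]. *)
Lemma sum_pr_dist (F : bool -> bool -> R) c e :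
  (forall a b, `|F a b - c| <= e) ->
  `|\sum_a \sum_b pr p a * pr p b * F a b - c| <= e.
Proof.
move=> Fc; have cE (x : R) : \sum_a \sum_b pr p a * pr p b * x = x.
  by have := sum_pr2 x 0 0 0; rewrite !mulr0 !addr0 => {2}<-;
  apply: eq_bigr => a _; apply: eq_bigr => b _; rewrite !mulr0 !addr0.
rewrite -{1}[c]cE -sumrB -[leRHS]cE.
apply: le_trans (ler_norm_sum _ _ _) _; apply: ler_sum => a _.
rewrite -sumrB; apply: le_trans (ler_norm_sum _ _ _) _; apply: ler_sum => b _.
have h : 0 <= pr p a * pr p b by apply: mulr_ge0; exact: pr_ge0.
by rewrite -mulrBr normrM ger0_norm // ler_wpM2l.
Qed.

End law.

(** * Moments of the endpoint value *)

(** [Y th t] is the value at time 1 of the level-[n] approximation [B_n], when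
    [th] is [2^(-H)]. *)
Fixpoint Y th n : tree n -> R :=
  if n is m.+1 then fun t => th * (sg t.1.1 * Y th t.1.2 + sg t.2.1 * Y th t.2.2)
  else fun=> 1.

(** The increments over the [2^n] dyadic intervals of level [n], in order, of
    [ka] times the approximation [B_N]. *)
Fixpoint lev ka th (n N : nat) {struct n} : tree N -> seq R :=
  match n, N return tree N -> seq R with
  | n'.+1, N'.+1 => fun t =>
      map ( *%R (th * sg t.1.1)) (@lev ka th n' N' t.1.2) ++
      map ( *%R (th * sg t.2.1)) (@lev ka th n' N' t.2.2)
  | _.+1, 0 => fun=> [::]
  | 0, _ => fun t => [:: ka * Y th t]
  end.

Section moments.
Variables (th p ka : R).
Hypotheses (th_ge : 2^-1 <= th) (th2 : th ^+ 2 <= 2^-1) (pth : th * p = 2^-1).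
Hypotheses (ka_ge0 : 0 <= ka) (ka2 : ka ^+ 2 = 2 - 4 * th ^+ 2).

Let mom n k : R := ET p (fun t : tree n => (Y th t) ^+ k).

Let th_gt0 : 0 < th.
Proof. by apply: lt_le_trans th_ge; rewrite invr_gt0. Qed.

Lemma p_range : -1 <= p <= 1.
Proof.
have p_gt0 : 0 < p by rewrite -(pmulr_rgt0 _ th_gt0) pth invr_gt0.
have : 2^-1 * p <= 2^-1 by rewrite -[leRHS]pth ler_wpM2r // ltW.
by move=> h; apply/andP; split; lra.
Qed.

Let ET2D n (A B : tree n -> R) : 
  ET p (fun t0 => ET p (fun t1 => A t0 * B t1)) = ET p A * ET p B.
Proof.
by rewrite [RHS]mulrC -ETZ; apply: eq_ET => t; rewrite ETZ mulrC.
Qed.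

(** The binomial formula: given the first two signs, the two halves of the
    recursion defining [Y] are independent. *)
Let momS n k : mom n.+1 k = \sum_a \sum_b pr p a * pr p b *
  (th ^+ k * \sum_(i < k.+1) 'C(k, i)%:R * (sg a ^+ (k - i) * sg b ^+ i)
     * (mom n (k - i) * mom n i)).
Proof.
rewrite /mom ETS; apply: eq_bigr => a _; apply: eq_bigr => b _; congr (_ * _).
transitivity (ET p (fun t0 : tree n => ET p (fun t1 : tree n =>
   \sum_(i < k.+1) (th ^+ k * ('C(k, i)%:R * (sg a ^+ (k - i) * sg b ^+ i))) *
     (Y th t0 ^+ (k - i) * Y th t1 ^+ i)))).
  apply: eq_ET => t0; apply: eq_ET => t1 /=.
  rewrite exprMn exprDn mulr_sumr; apply: eq_bigr => i _.
  by rewrite !exprMn -mulr_natl; ring.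
have ETsum m (I : finType) (F : I -> tree m -> R) :
    ET p (fun t => \sum_i F i t) = \sum_i ET p (F i).
  rewrite /ET exchange_big; apply: eq_bigr => t _; by rewrite mulr_sumr.
under eq_ET do rewrite ETsum.
rewrite ETsum mulr_sumr; apply: eq_bigr => i _.
under eq_ET do rewrite ETZ.
by rewrite ETZ ET2D !mulrA.
Qed.

Let mom0 n : mom n 0 = 1.
Proof. by rewrite /mom; under eq_ET do rewrite expr0; rewrite ET_cst. Qed.

Let mom00 k : mom 0 k = 1.
Proof.
rewrite /mom -[RHS](ET_cst p 0); apply: eq_ET => t; exact: expr1n.
Qed.

Let odd3 b : sg b ^+ 3 = sg b.
Proof. by rewrite exprS expr2 sg_sqr mulr1. Qed.

Let ev2 b : sg b ^+ 2 = 1.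
Proof. by rewrite expr2 sg_sqr. Qed.

Let ev4 b : sg b ^+ 4 = 1.
Proof. by rewrite (exprM _ 2 2) ev2 expr1n. Qed.

Let mom_rec n : [/\ mom n.+1 1 = mom n 1,
  mom n.+1 2 = 2 * th ^+ 2 * mom n 2 + (mom n 1) ^+ 2 / 2,
  mom n.+1 3 = th ^+ 2 * mom n 3 + 3 * th ^+ 2 * mom n 2 * mom n 1 &
  mom n.+1 4 = 2 * th ^+ 4 * mom n 4 + 2 * th ^+ 2 * mom n 3 * mom n 1
               + 6 * th ^+ 4 * (mom n 2) ^+ 2].
Proof.
have pE : p = (2 * th)^-1.
  by rewrite invfM -pth mulrAC mulfV ?mul1r // gt_eqF.
have th0 : th != 0 by rewrite gt_eqF.
have b32 : 'C(3, 2) = 3%N by [].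
have b42 : 'C(4, 2) = 6%N by [].
have b43 : 'C(4, 3) = 4%N by [].
split; rewrite momS; under eq_bigr do under eq_bigr do
  rewrite !big_ord_recr big_ord0 /= !(subnn, subn0) ?mom0 ?expr0 ?expr1;
rewrite ?(bin0, bin1, binn) /= ?mom0.
- rewrite [LHS](_ : _ = \sum_a \sum_b pr p a * pr p b * 
   (0 + sg a * (th * mom n 1) + sg b * (th * mom n 1) + sg a * sg b * 0)).
    by rewrite sum_pr2 pE; field.
  by apply: eq_bigr => a _; apply: eq_bigr => b _; ring.
- rewrite [LHS](_ : _ = \sum_a \sum_b pr p a * pr p b * 
   (2 * th ^+ 2 * mom n 2 + sg a * 0 + sg b * 0 
     + sg a * sg b * (2 * th ^+ 2 * (mom n 1) ^+ 2))).
    by rewrite sum_pr2 pE; field.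
  apply: eq_bigr => a _; apply: eq_bigr => b _.
  by rewrite !ev2 (_ : (2 - 1)%N = 1%N) // ?expr1; ring.
- rewrite [LHS](_ : _ = \sum_a \sum_b pr p a * pr p b * 
   (0 + sg a * (th ^+ 3 * mom n 3 + 3 * th ^+ 3 * mom n 1 * mom n 2)
      + sg b * (th ^+ 3 * mom n 3 + 3 * th ^+ 3 * mom n 2 * mom n 1)
     + sg a * sg b * 0)).
    by rewrite sum_pr2 pE; field.
  apply: eq_bigr => a _; apply: eq_bigr => b _.
  rewrite !odd3 (_ : (3 - 1)%N = 2%N) // (_ : (3 - 2)%N = 1%N) // !ev2 ?expr1.
  by rewrite b32; ring.
- rewrite [LHS](_ : _ = \sum_a \sum_b pr p a * pr p b * 
   ((2 * th ^+ 4 * mom n 4 + 6 * th ^+ 4 * (mom n 2) ^+ 2) + sg a * 0 + sg b * 0 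
     + sg a * sg b * (8 * th ^+ 4 * mom n 3 * mom n 1))).
    by rewrite sum_pr2 pE; field.
  apply: eq_bigr => a _; apply: eq_bigr => b _.
  rewrite (_ : (4 - 1)%N = 3%N) // (_ : (4 - 2)%N = 2%N) // (_ : (4 - 3)%N = 1%N) //.
  rewrite !odd3 !ev2 !ev4 ?expr1.
  by rewrite b42 b43; ring.
Qed.

Lemma mean_Y n : ET p (fun t : tree n => Y th t) = 1.
Proof.
have -> : ET p (fun t : tree n => Y th t) = mom n 1 by [].
by elim: n => [|n IH]; [exact: mom00|have [->] := mom_rec n].
Qed.

Let mom1 n : mom n 1 = 1. Proof. exact: mean_Y. Qed.

Let ka_le1 : ka <= 1.
Proof.
rewrite -(@ler_pXn2r _ 2) ?nnegrE // expr1n ka2.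
have : 2^-1 ^+ 2 <= th ^+ 2 by rewrite ler_pXn2r ?nnegrE // ?invr_ge0 // ltW.
by rewrite exprVn; lra.
Qed.

(** The second moment obeys an affine recursion of slope [2 * th ^+ 2], and the
    value of [ka] makes 1 its fixed point. *)
Lemma second_moment n :
  ET p (fun t : tree n => (ka * Y th t) ^+ 2) - 1
  = - ((2 * th ^+ 2) ^+ n * (1 - ka ^+ 2)).
Proof.
under eq_ET do rewrite exprMn; rewrite ETZ -/(mom n 2).
elim: n => [|n IH]; first by rewrite mom00; ring.
have [_ -> _ _] := mom_rec n.
have -> : mom n 1 = 1 by exact: mean_Y.
move: IH; rewrite (exprS (2 * th ^+ 2) n); set u := (2 * th ^+ 2) ^+ n => IH.
rewrite [RHS](_ : _ = 2 * th ^+ 2 * - (u * (1 - ka ^+ 2))); last by ring.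
rewrite -IH; apply/eqP; rewrite -subr_eq0; apply/eqP.
by transitivity (ka ^+ 2 / 2 - 1 + 2 * th ^+ 2); [field|rewrite ka2; field].
Qed.

(** In the recursions for the moments of orders 3 and 4 the previous moment is
    multiplied by at most 1/2, so that the bounds 3 and 9 reproduce themselves:
    [3 / 2 + 3 / 2 = 3] and [9 / 2 + 3 + 3 / 2 = 9]. *)
Lemma fourth_moment n : ET p (fun t : tree n => (ka * Y th t) ^+ 4) <= 9.
Proof.
under eq_ET do rewrite exprMn; rewrite ETZ -/(mom n 4).
have ka0 := ka_ge0; have ka1 := ka_le1; have tp := th2.
have t2 : 0 <= th ^+ 2 by exact: sqr_ge0.
have m2 k : 0 <= ka ^+ 2 * mom k 2 <= 1.
  rewrite mulr_ge0 ?sqr_ge0 //=; last first.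
    by rewrite -(ET_cst p k 0); apply: (ET_le p_range) => t; rewrite sqr_ge0.
  have := second_moment k; under eq_ET do rewrite exprMn.
  rewrite ETZ -/(mom k 2) => /eqP; rewrite subr_eq => /eqP ->.
  rewrite addrC gerBl mulr_ge0 ?exprn_ge0 ?subr_ge0 ?expr_le1 //.
  by rewrite mulr_ge0.
have m3 k : 0 <= ka ^+ 3 * mom k 3 <= 3.
  elim: k => [|k /andP[h1 h2]].
    rewrite mom00 mulr1 exprn_ge0 //=.
    by apply: (@le_trans _ _ 1); rewrite ?exprn_ile1 // ler1n.
  have [_ _ -> _] := mom_rec k; rewrite mom1.
  have /andP[h3 h4] := m2 k.
  rewrite (_ : _ * _ = th ^+ 2 * (ka ^+ 3 * mom k 3) +
     3 * th ^+ 2 * (ka * (ka ^+ 2 * mom k 2))); last by ring.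
  set u := ka ^+ 3 * _ in h1 h2 *; set v := ka ^+ 2 * _ in h3 h4 *.
  have kv : 0 <= ka * v <= 1 by apply/andP; split; [exact: mulr_ge0|exact: mulr_ile1].
  set w := ka * v in kv *; case/andP: kv => w0 w1.
  have tu : 0 <= th ^+ 2 * u by exact: mulr_ge0.
  have tw : 0 <= th ^+ 2 * w by exact: mulr_ge0.
  apply/andP; split; first by rewrite -(mulrA 3); lra.
  have : th ^+ 2 * u <= 2^-1 * 3 by rewrite ler_pM.
  have : th ^+ 2 * w <= 2^-1 * 1 by rewrite ler_pM.
  by rewrite -(mulrA 3); lra.
elim: n => [|n IH].
  rewrite mom00 mulr1.
  by apply: (@le_trans _ _ 1); rewrite ?exprn_ile1 // ler1n.
have [_ _ _ ->] := mom_rec n; rewrite mom1 mulr1.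
have /andP[h1 h2] := m3 n; have /andP[h3 h4] := m2 n.
rewrite (_ : _ * _ = 2 * (th ^+ 2) ^+ 2 * (ka ^+ 4 * mom n 4)
   + 2 * th ^+ 2 * (ka * (ka ^+ 3 * mom n 3))
   + 6 * (th ^+ 2) ^+ 2 * (ka ^+ 2 * mom n 2) ^+ 2); last by ring.
have m40 : 0 <= ka ^+ 4 * mom n 4.
  rewrite mulr_ge0 ?exprn_ge0 //.
  rewrite -(ET_cst p n 0); apply: (ET_le p_range) => t.
  by rewrite (exprM _ 2 2) sqr_ge0.
set x := ka ^+ 4 * _ in m40 IH *; set y := ka ^+ 3 * _ in h1 h2 *.
set z := ka ^+ 2 * _ in h3 h4 *; set s := th ^+ 2 in t2 tp *.
have s2 : s ^+ 2 <= 4^-1.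
  rewrite [leRHS](_ : _ = 2^-1 ^+ 2); last by field.
  by rewrite ler_pXn2r ?nnegrE // invr_ge0.
have e1 : s ^+ 2 * x <= 4^-1 * 9 by rewrite ler_pM // sqr_ge0.
have ky : ka * y <= 1 * 3 by rewrite ler_pM.
have e2 : s * (ka * y) <= 2^-1 * (1 * 3) by rewrite ler_pM // mulr_ge0.
have z1 : z ^+ 2 <= 1 by rewrite expr_le1.
have e3 : s ^+ 2 * z ^+ 2 <= 4^-1 * 1 by rewrite ler_pM ?sqr_ge0.
by lra.
Qed.

(** Halving the intervals multiplies the expected sum of the fourth powers of the
    increments by [2 * th ^+ 4 <= 2^-1]. *)
Lemma ET_lev_pow4 n N : (n <= N)%N ->
  ET p (fun t : tree N => \sum_(x <- lev ka th n t) x ^+ 4) <= 9 * 2^-1 ^+ n.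
Proof.
elim: n N => [|n IH] N.
  move=> _; rewrite expr0 mulr1; apply: le_trans (fourth_moment N).
  by rewrite le_eqVlt; apply/orP; left; apply/eqP/eq_ET => t; case: N t => [|N] t; rewrite big_seq1.
case: N => [|N] //= nN.
set S := fun t : tree N => \sum_(x <- lev ka th n t) x ^+ 4.
have ES : ET p (fun t : tree N.+1 => \sum_(x <- lev ka th n.+1 t) x ^+ 4) =
    2 * th ^+ 4 * ET p S.
  rewrite ETS; transitivity (\sum_a \sum_b pr p a * pr p b *
    (2 * th ^+ 4 * ET p S + sg a * 0 + sg b * 0 + sg a * sg b * 0)); last first.
    by rewrite sum_pr2 !mulr0 !addr0.
  apply: eq_bigr => a _; apply: eq_bigr => b _; congr (_ * _).
  rewrite !mulr0 !addr0.
  transitivity (ET p (fun t0 : tree N => ET p (fun t1 : tree N =>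
     th ^+ 4 * S t0 + th ^+ 4 * S t1))); last first.
    under eq_ET do rewrite ETD ET_cst; rewrite ETD ET_cst !ETZ.
    by ring.
  apply: eq_ET => t0; apply: eq_ET => t1 /=.
  rewrite big_cat /= !big_map /S !mulr_sumr; congr (_ + _);
    by apply: eq_bigr => x _; rewrite !exprMn ev4 mulr1.
have S0 : 0 <= ET p S.
  rewrite -(ET_cst p N 0); apply: (ET_le p_range) => t.
  by apply: sumr_ge0 => x _; rewrite (exprM _ 2 2) sqr_ge0.
have th4 : th ^+ 4 <= 4^-1.
  have -> : th ^+ 4 = (th ^+ 2) ^+ 2 by rewrite -exprM.
  rewrite [leRHS](_ : _ = 2^-1 ^+ 2); last by field.
  by rewrite ler_pXn2r ?nnegrE ?sqr_ge0 // invr_ge0.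
have {}IH := IH N nN; rewrite ES (exprS 2^-1).
apply: (@le_trans _ _ (2^-1 * ET p S)).
  by rewrite ler_wpM2r //; lra.
by rewrite mulrCA ler_wpM2l // invr_ge0.
Qed.

End moments.
End Tree.

(** * Expectations of bounded functions under a probability *)

Lemma Rintegral_big_sum (R : realType) (d : measure_display) (T : measurableType d)
    (mu : {measure set T -> \bar R}) (D : set T) (I : Type) (s : seq I)
    (F : I -> T -> R) : measurable D ->
  (forall i, mu.-integrable D (EFin \o F i)) ->
  mu.-integrable D (EFin \o (fun x => \sum_(i <- s) F i x)) /\
  \int[mu]_(x in D) (\sum_(i <- s) F i x) = \sum_(i <- s) \int[mu]_(x in D) F i x.
Proof.
move=> mD iF; elim: s => [|i s [IH1 IH2]].
  split; last first.
    rewrite big_nil; under eq_Rintegral do rewrite big_nil.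
    by rewrite Rintegral_cst // mul0r.
  have := @integrable0 _ _ _ mu D; apply: eq_integrable => // x _ /=.
  by rewrite big_nil.
split.
  have := integrableD mD (iF i) IH1; apply: eq_integrable => // x _ /=.
  by rewrite big_cons.
by under eq_Rintegral do rewrite big_cons; rewrite RintegralD // IH2 big_cons.
Qed.

Section BoundedIntegrals.
Context (R : realType) (d : measure_display) (T : measurableType d).
Variable P : probability T R.
Implicit Types (f g : T -> R) (M e : R).

Lemma bounded_integrable f M : measurable_fun setT f ->
  (forall x, `|f x| <= M) -> P.-integrable setT (EFin \o f).
Proof.
move=> mf fM; apply: measurable_bounded_integrable => //.
  by have := fin_num_measure P setT measurableT; rewrite ge0_fin_numE.
by exists M; split; [exact: num_real|move=> x Mx y _; exact: le_trans (ltW Mx)].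
Qed.

Lemma RintegrableC (c : R) : P.-integrable setT (EFin \o cst c).
Proof. exact: finite_measure_integrable_cst. Qed.

Lemma RintegrableZ (c : R) f : P.-integrable setT (EFin \o f) ->
  P.-integrable setT (EFin \o (fun x => c * f x)).
Proof.
by move=> i_f; have := integrableZl measurableT c i_f; apply: eq_integrable.
Qed.

Lemma RintegrableD f g : P.-integrable setT (EFin \o f) ->
  P.-integrable setT (EFin \o g) ->
  P.-integrable setT (EFin \o (fun x => f x + g x)).
Proof.
by move=> i_f i_g; have := integrableD measurableT i_f i_g; apply: eq_integrable.
Qed.

Lemma Rintegral_cstT (c : R) : \int[P]_x c = c.
Proof.
transitivity (c * fine (P setT)); first exact: Rintegral_cst.
by rewrite [P _]probability_setT mulr1.
Qed.

Lemma Rintegral_dist f g h :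
  P.-integrable setT (EFin \o f) -> P.-integrable setT (EFin \o g) ->
  P.-integrable setT (EFin \o h) ->
  (forall x, `|f x - g x| <= h x) ->
  `|\int[P]_x f x - \int[P]_x g x| <= \int[P]_x h x.
Proof.
move=> i_f i_g ih fgh; rewrite -RintegralB //.
have iB : P.-integrable setT (EFin \o (fun x => f x - g x)).
  by have := integrableB measurableT i_f i_g; apply: eq_integrable.
apply: le_trans (le_normr_Rintegral measurableT iB) _.
apply: le_Rintegral => //.
by have := integrable_norm iB; apply: eq_integrable.
Qed.

Lemma Rintegral_dist_cst f g M M' e :
  measurable_fun setT f -> (forall x, `|f x| <= M) ->
  measurable_fun setT g -> (forall x, `|g x| <= M') ->
  (forall x, `|f x - g x| <= e) -> `|\int[P]_x f x - \int[P]_x g x| <= e.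
Proof.
move=> mf fM mg gM fge; rewrite -[leRHS]Rintegral_cstT.
apply: Rintegral_dist => //; [exact: bounded_integrable fM|
  exact: bounded_integrable gM|exact: finite_measure_integrable_cst].
Qed.

Lemma Rintegral_bound f M : measurable_fun setT f -> (forall x, `|f x| <= M) ->
  `|\int[P]_x f x| <= M.
Proof.
move=> mf fM; have := @Rintegral_dist_cst f (cst 0) M 0 M mf fM (measurable_cst _).
rewrite Rintegral_cstT subr0; apply => x; first by rewrite normr0.
by rewrite subr0.
Qed.

(** Bounded convergence, for a limit that holds almost everywhere. *)
Lemma bounded_cvg (f_ : nat -> T -> R) f M :
  (forall n, measurable_fun setT (f_ n)) -> measurable_fun setT f ->
  (forall n x, `|f_ n x| <= M) ->
  {ae P, forall x, f_ ^~ x @ \oo --> f x} ->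
  \int[P]_x f_ n x @[n --> \oo] --> \int[P]_x f x.
Proof.
move=> mf_ mf f_M f_f.
have mE (g : T -> R) (mg : measurable_fun setT g) :=
  proj2 (measurable_EFinP setT g) mg.
have f_fE : {ae P, forall x, setT x ->
    (fun n => (f_ n x)%:E) @ \oo --> (f x)%:E}.
  by apply: filterS f_f => x h _; apply: cvg_EFin => //; exact: nearW.
have [i_f _ h] := @dominated_convergence _ _ _ P setT measurableT
  (fun n => EFin \o f_ n) (EFin \o f) (EFin \o cst M)
  (fun n => mE _ (mf_ n)) (mE _ mf)
  f_fE
  (finite_measure_integrable_cst P M measurableT)
  (aeW P (fun x n _ => f_M n x)).
apply: fine_cvg; rewrite /Rintegral fineK; first exact: h.
exact: integrable_fin_num.
Qed.

Section finite_valued.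
Variables (I : finType) (X : T -> I).
Hypothesis mX : forall i, measurable (X @^-1` [set i]).

Lemma fin_indicE (F : I -> R) :
  F \o X = fun x => \sum_i F i * \1_(X @^-1` [set i]) x.
Proof.
apply/funext => x /=; rewrite (bigD1 (X x)) //= big1 ?addr0.
  by rewrite indicE mem_set // mulr1.
by move=> i iX; rewrite indicE memNset ?mulr0 // => /esym/eqP; rewrite (negbTE iX).
Qed.

Lemma fin_measurable (F : I -> R) : measurable_fun setT (F \o X).
Proof.
rewrite fin_indicE; apply: measurable_sum => i.
by apply: measurable_funM => //; exact: measurable_indic.
Qed.

Lemma fin_expect (F : I -> R) :
  \int[P]_x F (X x) = \sum_i F i * fine (P (X @^-1` [set i])).
Proof.
transitivity (\int[P]_x (\sum_i F i * \1_(X @^-1` [set i]) x)).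
  by apply: eq_Rintegral => x _; rewrite -[LHS]/((F \o X) x) fin_indicE.
have i1 i : P.-integrable setT (EFin \o (\1_(X @^-1` [set i]) : T -> R)).
  exact: integrable_indic.
rewrite (Rintegral_big_sum _ measurableT _).2.
  by apply: eq_bigr => i _; rewrite RintegralZl // /Rintegral integral_indic // setIT.
move=> i; have := integrableZl measurableT (F i) (i1 i).
by apply: eq_integrable.
Qed.

End finite_valued.
End BoundedIntegrals.

(** * Iterated integrals of Lipschitz functions and independence *)

Section Lipschitz.
Variable R : realType.
Implicit Types (M L e : R).

(** Bounded Lipschitz functions of one variable. *)
Definition bl M L (f : R -> R) :=
  (forall x, `|f x| <= M) /\ (forall x y, `|f x - f y| <= L * `|x - y|).

(** Bounded functions of finitely many variables that are Lipschitz in each of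
    them. *)
Definition sbl M L (psi : seq R -> R) := (forall s, `|psi s| <= M) /\
  (forall s1 s2 x y, `|psi (s1 ++ x :: s2) - psi (s1 ++ y :: s2)| <= L * `|x - y|).

Lemma bl_measurable M L f : bl M L f -> measurable_fun setT f.
Proof.
move=> [_ fL]; apply: continuous_measurable_fun => x.
have L0 : 0 <= L.
  have := fL 1 0; rewrite subr0 normr1 mulr1; exact: le_trans.
apply/cvgrPdist_le => e e0; near=> y.
apply: le_trans (fL _ _) _; apply: (@le_trans _ _ ((L + 1) * `|x - y|)).
  by rewrite ler_wpM2r // lerDl.
rewrite mulrC -ler_pdivlMr ?ltr_wpDl //; near: y.
by apply: cvgr_dist_le; rewrite // divr_gt0 // ltr_wpDl.
Unshelve. all: by end_near. Qed.

Lemma bl_integrable (mu : probability (measurableTypeR R) R) M L f :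
  bl M L f -> mu.-integrable setT (EFin \o f).
Proof.
move=> fb; have mf := bl_measurable fb.
by apply: (@bounded_integrable _ _ _ mu f M); [exact: mf|exact: fb.1].
Qed.

Lemma bl_comp_affine M L f a b : bl M L f -> bl M (L * `|b|) (fun x => f (a + b * x)).
Proof.
move=> [fM fL]; split=> [x|x y] //; apply: le_trans (fL _ _) _.
by rewrite opprD addrACA subrr add0r -mulrBr normrM mulrA.
Qed.

Lemma sbl_cons M L psi x : sbl M L psi -> sbl M L (fun s => psi (x :: s)).
Proof. by move=> [pM pL]; split=> // s1 s2 y z; exact: (pL (x :: s1)). Qed.

Lemma sbl_cat M L psi s0 : sbl M L psi -> sbl M L (fun s => psi (s0 ++ s)).
Proof. by move=> [pM pL]; split=> // s1 s2 y z; rewrite !catA; exact: pL. Qed.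

Lemma sbl_map M L psi c : sbl M L psi -> sbl M (L * `|c|) (fun s => psi (map ( *%R c) s)).
Proof.
move=> [pM pL]; split=> // s1 s2 y z; rewrite !map_cat /=.
by apply: le_trans (pL _ _ _ _) _; rewrite -mulrBr normrM mulrA.
Qed.

Lemma sbl_sum M L psi N (a b : nat -> R) : sbl M L psi ->
  `|psi (mkseq a N) - psi (mkseq b N)| <= L * \sum_(i < N) `|a i - b i|.
Proof.
elim: N M psi a b => [|N IH] M psi a b psiL.
  by rewrite big_ord0 mulr0 subrr normr0.
have mkS (c : nat -> R) : mkseq c N.+1 = c 0%N :: mkseq (fun i => c i.+1) N.
  by rewrite /mkseq /= (iotaDl 1 0) -map_comp.
rewrite !mkS big_ord_recl mulrDr.
apply: le_trans (ler_distD (psi (b 0%N :: mkseq (fun i => a i.+1) N)) _ _) _.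
apply: lerD; first by case: psiL => _ h; exact: (h [::]).
exact: (IH _ _ (fun i => a i.+1) (fun i => b i.+1) (sbl_cons (b 0%N) psiL)).
Qed.

End Lipschitz.

Section Iterated.
Variable R : realType.
Implicit Types (M L e : R).

(** The expectation of [psi] at [n] independent variables of law [mu]. *)
Fixpoint IT (mu : probability (measurableTypeR R) R) n (psi : seq R -> R) : R :=
  if n is m.+1 then \int[mu]_x IT mu m (fun s => psi (x :: s)) else psi [::].

Section basics.
Variable mu : probability (measurableTypeR R) R.

Lemma IT_props n : (forall M L psi, sbl M L psi -> `|IT mu n psi| <= M) /\
  (forall M L M' L' e psi psi', sbl M L psi -> sbl M' L' psi' ->
   (forall s, `|psi s - psi' s| <= e) -> `|IT mu n psi - IT mu n psi'| <= e).
Proof.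
elim: n => [|n [IHb IHd]] /=.
  by split=> [M L psi [+ _]|M L M' L' e psi psi' _ _]; apply.
have blI M L psi : sbl M L psi -> bl M L (fun x => IT mu n (fun s => psi (x :: s))).
  move=> psiL; split=> [x|x y]; first by apply: IHb; exact: sbl_cons psiL.
  apply: IHd; [exact: sbl_cons psiL|exact: sbl_cons psiL|move=> s].
  by case: psiL => _ h; exact: (h [::]).
split=> [M L psi psiL|M L M' L' e psi psi' psiL psiL' pp].
  by have h := blI _ _ _ psiL; apply: Rintegral_bound; [exact: bl_measurable h|exact: h.1].
have h := blI _ _ _ psiL; have h' := blI _ _ _ psiL'.
apply: Rintegral_dist_cst; [exact: bl_measurable h|exact: h.1|
  exact: bl_measurable h'|exact: h'.1|move=> x].
by apply: IHd; [exact: sbl_cons psiL|exact: sbl_cons psiL'|move=> s; exact: pp].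
Qed.

Lemma IT_bound n M L psi : sbl M L psi -> `|IT mu n psi| <= M.
Proof. by case: (IT_props n) => h _; exact: h. Qed.

Lemma IT_dist n M L M' L' e psi psi' : sbl M L psi -> sbl M' L' psi' ->
  (forall s, `|psi s - psi' s| <= e) -> `|IT mu n psi - IT mu n psi'| <= e.
Proof. by case: (IT_props n) => _ h; exact: h. Qed.

Lemma bl_IT n M L (phi : R -> seq R -> R) :
  (forall x, sbl M L (phi x)) ->
  (forall s x y, `|phi x s - phi y s| <= L * `|x - y|) ->
  bl M L (fun x => IT mu n (phi x)).
Proof.
move=> ph1 ph2; split=> [x|x y]; first exact: IT_bound (ph1 x).
exact: IT_dist (ph1 x) (ph1 y) _.
Qed.

Lemma bl_IT_cons n M L psi : sbl M L psi ->
  bl M L (fun x => IT mu n (fun s => psi (x :: s))).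
Proof.
move=> psiL; apply: bl_IT => [x|s x y]; first exact: sbl_cons psiL.
by case: psiL => _ h; exact: (h [::]).
Qed.

Lemma eq_IT n psi psi' : (forall s, size s = n -> psi s = psi' s) ->
  IT mu n psi = IT mu n psi'.
Proof.
elim: n psi psi' => [|n IH] psi psi' pp /=; first exact: pp.
by apply: eq_Rintegral => x _; apply: IH => s sn; apply: pp; rewrite /= sn.
Qed.

Lemma IT_add m n psi :
  IT mu (m + n) psi = IT mu m (fun s => IT mu n (fun t => psi (s ++ t))).
Proof. by elim: m psi => [|m IH] psi //=; apply: eq_Rintegral => x _; exact: IH. Qed.

End basics.
End Iterated.

Section Discretization.
Variable R : realType.

(** Rounding to the grid of mesh [1 / (j + 1)] on the interval
    [[- (j + 1), j + 1]]. *)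
Definition grid_idx (j : nat) (x : R) : 'I_(2 * j.+1 ^ 2).+1 :=
  inord (Num.truncn ((x + j.+1%:R) * j.+1%:R)).

Definition grid_pt (j i : nat) : R := i%:R / j.+1%:R - j.+1%:R.

Definition rnd j x : R := grid_pt j (grid_idx j x).

Lemma measurable_grid_idx j i : measurable (grid_idx j @^-1` [set i]).
Proof.
pose g (x : R) := (x + j.+1%:R) * j.+1%:R.
have mg : measurable_fun setT g.
  by apply: measurable_funM => //; exact: measurable_funD.
have -> : grid_idx j @^-1` [set i] =
    \bigcup_(k in [set k | inord k = i]) (g @^-1` [set y | Num.truncn y = k]).
  apply/seteqP; split=> x /=; first by exists (Num.truncn (g x)).
  by move=> [k /= ki gk]; rewrite /grid_idx -/(g x) gk.
apply: bigcup_measurable => k _; rewrite -[X in measurable X]setTI.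
apply: mg => //.
case: k => [|k].
  have -> : [set y : R | Num.truncn y = 0%N] = `]-oo, 1[%classic.
    apply/seteqP; split=> y /=; rewrite in_itv /=.
      by move=> y0; rewrite -(@real_truncn_le_nat R y 0) ?num_real // y0.
    by move=> y1; apply/eqP; rewrite -leqn0 real_truncn_le_nat ?num_real.
  exact: measurable_itv.
have -> : [set y : R | Num.truncn y = k.+1] = `[k.+1%:R, k.+2%:R[%classic.
  apply/seteqP; split=> y /=; rewrite in_itv /=.
    by move=> yk; rewrite -truncn_gt_nat -real_truncn_le_nat ?num_real // yk leqnn.
  rewrite -truncn_gt_nat -real_truncn_le_nat ?num_real // => /andP[h1 h2].
  by apply/eqP; rewrite eqn_leq h1 h2.
exact: measurable_itv.
Qed.

Lemma measurable_rnd j : measurable_fun setT (rnd j).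
Proof.
exact (fin_measurable (@measurable_grid_idx j) (fun i => grid_pt j i)).
Qed.

Lemma rnd_dist j x : `|x| <= j.+1%:R -> `|rnd j x - x| <= j.+1%:R^-1.
Proof.
move=> xj; have j0 : 0 < j.+1%:R :> R by rewrite ltr0n.
have /andP[x1 x2] : - j.+1%:R <= x <= j.+1%:R by rewrite -ler_norml.
set y := (x + j.+1%:R) * j.+1%:R.
have y0 : 0 <= y by rewrite mulr_ge0 ?ler0n // -lerBlDr sub0r.
have iE : (grid_idx j x : nat) = Num.truncn y.
  rewrite /grid_idx inordK // ltnS real_truncn_le_nat ?num_real //.
  apply: (@le_lt_trans _ _ (2 * j.+1 ^ 2)%:R); last by rewrite ltr_nat.
  rewrite natrM natrX expr2 mulrA ler_wpM2r //.
  by rewrite mulr_natl mulr2n lerD2r.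
rewrite /rnd /grid_pt iE.
have /andP[t1 t2] := truncn_itv y0.
have -> : (Num.truncn y)%:R / j.+1%:R - j.+1%:R - x =
   ((Num.truncn y)%:R - y) / j.+1%:R.
  by rewrite /y; field; rewrite gt_eqF.
rewrite normrM [X in _ * X]ger0_norm ?invr_ge0 ?ler0n //.
rewrite ler_piMl ?invr_ge0 ?ler0n //.
by rewrite ler_norml; move: t1 t2; rewrite -natr1; lra.
Qed.

Lemma rnd_cvg x : rnd ^~ x @ \oo --> x.
Proof.
apply/cvgrPdist_le => e e0; near=> j.
rewrite distrC; apply: le_trans (rnd_dist _) _.
  have : (Num.truncn `|x| <= j)%N by near: j; exact: nbhs_infty_ge.
  by rewrite real_truncn_le_nat ?num_real // => /ltW.
rewrite -[leRHS]invrK lef_pV2 ?posrE ?invr_gt0 ?ltr0n //.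
have : (Num.truncn e^-1 <= j)%N by near: j; exact: nbhs_infty_ge.
by rewrite real_truncn_le_nat ?num_real // => /ltW.
Unshelve. all: by end_near. Qed.

Lemma rnd_cvg0 x : `|rnd j x - x| @[j --> \oo] --> (0 : R).
Proof.
have h : rnd j x - x @[j --> \oo] --> x - x.
  by apply: cvgB; [exact: rnd_cvg|exact: cvg_cst].
by have := cvg_norm h; rewrite subrr normr0; apply.
Qed.

End Discretization.

Section Independence.
Context (R : realType) (d : measure_display) (T : measurableType d).
Variables (P : probability T R) (mu : probability (measurableTypeR R) R).

Section finite_sums.
Variables (m : nat) (q : R -> 'I_m.+1).
Hypothesis mq : forall i, measurable (q @^-1` [set i]).

Let w i : R := fine (mu (q @^-1` [set i])).

Lemma IT_finite n (psi : seq 'I_m.+1 -> R) :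
  IT mu n (fun s => psi (map q s)) =
  \sum_(c : n.-tuple 'I_m.+1) psi c * \prod_(i <- c) w i.
Proof.
elim: n psi => [|n IH] psi /=.
  rewrite (big_pred1 [tuple]) ?big_nil ?mulr1 // => c.
  by rewrite /= [c]tuple0.
under eq_Rintegral => x _ do rewrite (IH (fun s => psi (q x :: s))).
rewrite (fin_expect mu mq (fun i => \sum_(c : n.-tuple 'I_m.+1)
   psi (i :: c) * \prod_(k <- c) w k)).
transitivity (\sum_i \sum_(c : n.-tuple 'I_m.+1)
    psi (i :: c) * \prod_(k <- c) w k * w i).
  by apply: eq_bigr => i _; rewrite mulr_suml.
rewrite pair_bigA /=.
rewrite (reindex (fun u : 'I_m.+1 * n.-tuple 'I_m.+1 => [tuple of u.1 :: u.2])) /=.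
  by apply: eq_bigr => -[i c] _ /=; rewrite big_cons -/(w i) -mulrA [w i * _]mulrC.
exists (fun c : n.+1.-tuple _ => (thead c, [tuple of behead c])).
  by move=> [i c] _; rewrite theadE; congr pair; apply: val_inj.
by move=> c _; rewrite [RHS]tuple_eta.
Qed.

End finite_sums.

Variables (n : nat) (X : nat -> T -> R).
Hypothesis mX : forall i, measurable_fun setT (X i).
Hypothesis indX : forall A : nat -> set R, (forall i, measurable (A i)) ->
  P (\bigcap_(i in [set k | (k < n)%N]) X i @^-1` A i) = (\prod_(i < n) mu (A i))%E.

Let indep_finite m (q : R -> 'I_m.+1) (mq : forall i, measurable (q @^-1` [set i]))
    (psi : seq 'I_m.+1 -> R) :
  measurable_fun setT (fun om => psi (mkseq (fun i => q (X i om)) n)) /\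
  \int[P]_om psi (mkseq (fun i => q (X i om)) n) = IT mu n (fun s => psi (map q s)).
Proof.
pose Z om : n.-tuple 'I_m.+1 := [tuple q (X i om) | i < n].
have ZE om : mkseq (fun i => q (X i om)) n = Z om.
  by rewrite /mkseq -val_enum_ord -map_comp.
have fiber c : Z @^-1` [set c] =
   \bigcap_(i in [set k | (k < n)%N]) X i @^-1` (q @^-1` [set nth ord0 c i]).
  apply/seteqP; split=> om /=.
    by move=> <- i /= ni; rewrite -ZE nth_mkseq.
  move=> h; apply/val_inj/(@eq_from_nth _ ord0); first by rewrite !size_tuple.
  move=> i; rewrite size_tuple => ni.
  by have := congr1 (nth ord0 ^~ i) (ZE om); rewrite nth_mkseq // => <-; exact: h.
have mZ c : measurable (Z @^-1` [set c]).
  rewrite fiber; apply: bigcap_measurableType => i _.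
  by rewrite -[X in measurable X]setTI; exact: mX.
under eq_Rintegral do rewrite ZE.
split.
  have := fin_measurable mZ (fun c : n.-tuple _ => psi c).
  by congr measurable_fun; apply/funext => om /=; rewrite ZE.
rewrite (fin_expect P mZ (fun c : n.-tuple _ => psi c)) IT_finite //.
apply: eq_bigr => c _; congr (_ * _); rewrite fiber indX => [|i]; last exact: mq.
rewrite (eq_bigr (fun i : 'I_n => (fine (mu (q @^-1` [set nth ord0 c i])))%:E)).
  by rewrite prodEFin /= (big_nth ord0) size_tuple big_mkord.
by move=> i _; rewrite fineK //; apply: fin_num_measure; exact: mq.
Qed.

(** Both sides are limits of the same finite sums, obtained by rounding every
    variable to a finite grid: there the product rule for events is all that
    independence has to provide. *)
Lemma indep_expect M L psi : sbl M L psi ->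
  measurable_fun setT (fun om => psi (mkseq (X ^~ om) n)) /\
  \int[P]_om psi (mkseq (X ^~ om) n) = IT mu n psi.
Proof.
move=> psiL; have [psiM _] := psiL.
have L0 : 0 <= L.
  case: psiL => _ /(_ [::] [::] 1 0); rewrite subr0 normr1 mulr1; exact: le_trans.
have M0 : 0 <= M by apply: le_trans (psiM [::]).
pose psi_ j s := psi (map (@grid_pt R j) (map val (s : seq 'I_(2 * j.+1 ^ 2).+1))).
have fj j om : psi_ j (mkseq (fun i => grid_idx j (X i om)) n) =
   psi (mkseq (fun i => rnd j (X i om)) n).
  by rewrite /psi_ /mkseq -!map_comp.
have f_cvg om : psi (mkseq (fun i => rnd j (X i om)) n) @[j --> \oo] -->
   psi (mkseq (X ^~ om) n).
  have S0 k : \sum_(i < k) `|rnd j (X i om) - X i om| @[j --> \oo] --> (0 : R).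
    elim: k => [|k IH]; first by under eq_fun do rewrite big_ord0; exact: cvg_cst.
    under eq_fun do rewrite big_ord_recr /=.
    by have := cvgD IH (rnd_cvg0 (X k om)); rewrite addr0; apply.
  have LS : L * \sum_(i < n) `|rnd j (X i om) - X i om| @[j --> \oo] --> L * 0.
    by apply: cvgMr; exact: S0.
  apply/cvgrPdist_le => e e0; near=> j; rewrite distrC.
  apply: le_trans (sbl_sum _ _ _ psiL) _.
  have : `|L * 0 - L * \sum_(i < n) `|rnd j (X i om) - X i om| | <= e.
    by near: j; exact: cvgr_dist_le LS _ _.
  by rewrite mulr0 sub0r normrN => /(le_trans (ler_norm _)).
have mf : measurable_fun setT (fun om => psi (mkseq (X ^~ om) n)).
  apply: (measurable_fun_cvg (h :=
    fun j om => psi_ j (mkseq (fun i => grid_idx j (X i om)) n))) => [j|om _].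
    by have [] := indep_finite (@measurable_grid_idx R j) (psi_ j).
  by under eq_fun do rewrite fj; exact: f_cvg.
split=> //.
pose D j := \int[mu]_x Num.min `|rnd j x - x| 1.
have mD j : measurable_fun setT (fun x : R => Num.min `|rnd j x - x| 1).
  have mB : measurable_fun setT (fun x : R => rnd j x - x).
    by apply: measurable_funB => //; exact: measurable_rnd.
  by apply: measurable_minr => //; exact: measurableT_comp.
have D1 j (x : R) : `|Num.min `|rnd j x - x| 1| <= 1.
  by rewrite ger0_norm ?ge_min ?lexx ?orbT // le_min normr_ge0 ler01.
have D_cvg : D j @[j --> \oo] --> (0 : R).
  rewrite -(Rintegral_cstT mu 0).
  apply: (@bounded_cvg _ _ _ mu _ _ 1) => //.
  apply: aeW => x; apply: (@squeeze_cvgr _ _ _ _ (cst 0) _ _ _ _ _ (rnd_cvg0 x));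
    last exact: cvg_cst.
  by apply: nearW => j; rewrite le_min normr_ge0 ler01 ge_min lexx.
(* Changing one variable by [y] changes the value by at most [L * y], and never
   by more than [2 * M]. *)
pose K := L + 2 * M.
have K0 : 0 <= K by rewrite addr_ge0 ?mulr_ge0.
have IT_D j k phi : sbl M L phi ->
    `|IT mu k (fun s => phi (map (rnd j) s)) - IT mu k phi| <= k%:R * (K * D j).
  elim: k phi => [|k IH] phi phiL /=; first by rewrite subrr normr0 mul0r.
  have h x : `|IT mu k (fun s => phi (rnd j x :: map (rnd j) s)) -
      IT mu k (fun s => phi (x :: s))| <=
      k%:R * (K * D j) + K * Num.min `|rnd j x - x| 1.
    apply: le_trans (ler_distD (IT mu k (fun s => phi (rnd j x :: s))) _ _) _.
    apply: lerD; first exact: IH (sbl_cons _ phiL).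
    apply: IT_dist (sbl_cons _ phiL) (sbl_cons _ phiL) _ => s.
    rewrite minEle; case: ifP => _.
      case: phiL => _ /(_ [::] s (rnd j x) x) /= /le_trans; apply.
      by rewrite ler_wpM2r // lerDl mulr_ge0.
    case: phiL => hM _; rewrite mulr1.
    apply: le_trans (ler_normB _ _) _.
    by rewrite -[leLHS]add0r lerD // mulr_natl mulr2n lerD.
  have ->: k.+1%:R * (K * D j) = \int[mu]_x (k%:R * (K * D j) + K * Num.min `|rnd j x - x| 1).
    have iD := bounded_integrable mu (mD j) (D1 j).
    rewrite RintegralD //; last 2 first.
    - exact: finite_measure_integrable_cst.
    - by have := integrableZl measurableT K iD; apply: eq_integrable.
    by rewrite Rintegral_cstT RintegralZl // -/(D j) -natr1 mulrDl mul1r.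
  have [hb hl] := bl_IT_cons mu k phiL.
  have mA : measurable_fun setT
      (fun x => IT mu k (fun s => phi (rnd j x :: map (rnd j) s))).
    exact (fin_measurable (@measurable_grid_idx R j)
      (fun i => IT mu k (fun s => phi (grid_pt R j i :: map (rnd j) s)))).
  have mh : measurable_fun setT (fun x => k%:R * (K * D j) + K * Num.min `|rnd j x - x| 1).
    by apply: measurable_funD => //; exact: measurable_funM.
  have h1 x : `|k%:R * (K * D j) + K * Num.min `|rnd j x - x| 1| <= `|k%:R * (K * D j)| + K.
    apply: le_trans (ler_normD _ _) _; rewrite lerD2l normrM (ger0_norm K0).
    by rewrite ler_piMr.
  apply: Rintegral_dist; last exact: h.
  - apply: (bounded_integrable mu (M := `|k%:R * (K * D j)| + K + M) mA) => x.
    rewrite -[X in `|X|](subrK (IT mu k (fun s => phi (x :: s)))).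
    apply: le_trans (ler_normD _ _) _; rewrite lerD //.
    exact: le_trans (h x) (le_trans (ler_norm _) (h1 x)).
  - exact: bl_integrable (bl_IT_cons mu k phiL).
  - by apply: (@bounded_integrable _ _ _ mu _ (`|k%:R * (K * D j)| + K)); [exact: mh|exact: h1].
have l1 : IT mu n (fun s => psi (map (rnd j) s)) @[j --> \oo] --> IT mu n psi.
  have nD : n%:R * (K * D j) @[j --> \oo] --> n%:R * (K * 0).
    by do 2 apply: cvgMr.
  apply/cvgrPdist_le => e e0; near=> j; rewrite distrC.
  apply: le_trans (IT_D _ _ _ psiL) _.
  have : `|n%:R * (K * 0) - n%:R * (K * D j)| <= e.
    by near: j; exact: cvgr_dist_le nD _ _.
  by rewrite !mulr0 sub0r normrN => /(le_trans (ler_norm _)).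
have l2 : \int[P]_om psi (mkseq (fun i => rnd j (X i om)) n) @[j --> \oo] -->
    \int[P]_om psi (mkseq (X ^~ om) n).
  apply: (bounded_cvg (M := M)) => // [j|].
    have [+ _] := indep_finite (@measurable_grid_idx R j) (psi_ j).
    by congr measurable_fun; apply/funext => om; rewrite fj.
  by apply: aeW => om; exact: f_cvg.
have E : (fun j => \int[P]_om psi (mkseq (fun i => rnd j (X i om)) n)) =
    (fun j => IT mu n (fun s => psi (map (@rnd R j) s))).
  apply/funext => j; have [_] := indep_finite (@measurable_grid_idx R j) (psi_ j).
  under eq_Rintegral do rewrite fj; move=> ->.
  by apply: eq_IT => s _; rewrite /psi_ -!map_comp.
by rewrite E in l2; exact: (cvg_unique _ l2 l1).
Unshelve. all: by end_near. Qed.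
End Independence.

(** * The centred normal laws *)

Section Gaussian.
Variable R : realType.
Implicit Types (s M L : R) (f : R -> R).
Local Notation mu := (@lebesgue_measure R).
Local Notation phi := (@normal_pdf R 0 1).

Lemma normal_density_ge0 s f : measurable_fun setT f -> (forall x, 0 <= f x) ->
  (\int[normal_prob 0 s]_x (f x)%:E = \int[mu]_x (f x * normal_pdf 0 s x)%:E)%E.
Proof.
move=> mf f0; have dom := normal_prob_dominates (0 : R) s.
have mfE := proj2 (measurable_EFinP setT f) mf.
rewrite -(@Radon_Nikodym_SigmaFinite.change_of_variables _ _ _ _ mu dom) //.
under [RHS]eq_integral do rewrite EFinM.
have mpdf : measurable_fun setT (EFin \o normal_pdf 0 s).
  by apply/measurable_EFinP; exact: measurable_normal_pdf.
have iRN := Radon_Nikodym_SigmaFinite.f_integrable dom.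
apply: ae_eq_integral => //.
- by apply: emeasurable_funM => //; exact: (measurable_int mu iRN).
- exact: emeasurable_funM.
- apply: ae_eqe_mul2l; apply: integral_ae_eq => //.
  by move=> A _ mA; rewrite -Radon_Nikodym_SigmaFinite.f_integral.
Qed.

Lemma normal_density s f : measurable_fun setT f ->
  mu.-integrable setT (EFin \o (fun x => f x * normal_pdf 0 s x)) ->
  (normal_prob 0 s).-integrable setT (EFin \o f) /\
  \int[normal_prob 0 s]_x f x = \int[mu]_x (f x * normal_pdf 0 s x).
Proof.
move=> mf i_f; have pdf0 := @normal_pdf_ge0 R 0 s.
split.
  apply/integrableP; split; first exact/measurable_EFinP.
  rewrite normal_density_ge0 //; last exact: measurableT_comp.
  case/integrableP : i_f => _; congr (_ < _)%E; apply: eq_integral => x _ /=.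
  by rewrite normrM (ger0_norm (pdf0 x)).
congr fine; rewrite [LHS]integralE [RHS]integralE; congr (_ - _)%E.
- transitivity (\int[normal_prob 0 s]_x (Num.max (f x) 0)%:E)%E.
    by apply: eq_integral => x _; rewrite funeposE /= EFin_max.
  rewrite normal_density_ge0 => [|//|x]; last by rewrite le_max lexx orbT.
    apply: eq_integral => x _; rewrite funeposE /= -EFin_max maxr_pMl //.
    by rewrite mul0r.
  exact: measurable_maxr.
- transitivity (\int[normal_prob 0 s]_x (Num.max (- f x) 0)%:E)%E.
    by apply: eq_integral => x _; rewrite funenegE /= EFin_max.
  rewrite normal_density_ge0 => [|//|x]; last by rewrite le_max lexx orbT.
    apply: eq_integral => x _; rewrite funenegE /= -EFin_max maxr_pMl //.
    by rewrite mul0r mulNr.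
  by apply: measurable_maxr => //; exact: measurableT_comp.
Qed.

Lemma bl_bounds M L f x : bl M L f -> 0 <= f x + M.
Proof. by case=> + _ => /(_ x); rewrite ler_norml => /andP[+ _]; lra. Qed.

Lemma bl_continuous M L f : bl M L f -> continuous f.
Proof.
move=> [_ fL] x.
have L0 : 0 <= L.
  have := fL 1 0; rewrite subr0 normr1 mulr1; exact: le_trans.
apply/cvgrPdist_le => e e0; near=> y.
apply: le_trans (fL _ _) _; apply: (@le_trans _ _ ((L + 1) * `|x - y|)).
  by rewrite ler_wpM2r // lerDl.
rewrite mulrC -ler_pdivlMr ?ltr_wpDl //; near: y.
by apply: cvgr_dist_le; rewrite // divr_gt0 // ltr_wpDl.
Unshelve. all: by end_near. Qed.

(** Two normal integrals of bounded Lipschitz functions agree when the integrals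
    against the densities of the functions, shifted to be nonnegative, do. *)
Lemma normal_eq s s' f g M L L' : bl M L f -> bl M L' g ->
  (\int[mu]_x ((f x + M) * normal_pdf 0 s x)%:E =
   \int[mu]_x ((g x + M) * normal_pdf 0 s' x)%:E)%E ->
  \int[normal_prob 0 s]_x f x = \int[normal_prob 0 s']_x g x.
Proof.
move=> fL gL.
have H r h K : bl M K h -> (\int[mu]_x ((h x + M) * normal_pdf 0 r x)%:E =
   (\int[normal_prob 0 r]_x h x + M)%:E)%E.
  move=> hK; have mh := bl_measurable hK.
  have ih := bounded_integrable (normal_prob 0 r) mh hK.1.
  rewrite -normal_density_ge0 => [||x]; last exact: bl_bounds hK.
    under eq_integral do rewrite EFinD.
    rewrite integralD //; last exact: finite_measure_integrable_cst.
    rewrite EFinD /Rintegral fineK; last exact: integrable_fin_num.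
    by rewrite integral_cst //= [X in (_ * X)%E]probability_setT mule1.
  exact: measurable_funD.
move=> E; apply: (addIr M); apply: EFin_inj.
exact: (etrans (esym (H s f L fL)) (etrans E (H s' g L' gL))).
Qed.

Lemma normal_scale s f M L : 0 < s -> bl M L f ->
  \int[normal_prob 0 s]_x f x = \int[normal_prob 0 1]_x f (s * x).
Proof.
move=> s0 fL.
have gL : bl M (L * `|s|) (fun x => f (s * x)).
  have := bl_comp_affine 0 s fL; congr bl; apply/funext => x.
  by rewrite add0r.
apply: (normal_eq fL gL).
have sn0 : s != 0 by rewrite gt_eqF.
pose F : R^o -> R^o := *%R s.
have dF : F^`()%classic = cst s.
  by apply/funext => x; rewrite derive1E /F derive_val; exact: mulr1.
rewrite (@increasing_ge0_integration_by_substitutionT _ F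
  (fun x => (f x + M) * normal_pdf 0 s x)).
- apply: eq_integral => x _; congr EFin; rewrite !fctE /=.
  rewrite -mulrA; congr (_ * _).
  rewrite dF /F /=.
  rewrite !normal_pdfE ?oner_eq0 // mulrAC /normal_fun !subr0.
  congr (_ * expR _).
    rewrite /normal_peak -mulrnAr sqrtrM ?sqr_ge0 // sqrtr_sqr gtr0_norm //.
    by rewrite invfM mulrAC mulVf // mul1r expr1n mul1r.
  rewrite expr1n !mulNr exprMn; congr (- _).
  by field.
- by move=> x y; rewrite ltr_pM2l.
- rewrite dF; exact: cst_continuous.
- rewrite dF; exact: is_cvg_cst.
- rewrite dF; exact: is_cvg_cst.
- by move=> x; exact: ex_derive.
- by apply: gt0_cvgMrNy => //; exact: cvg_id.
- by apply: gt0_cvgMry => //; exact: cvg_id.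
- move=> x; apply: cvgM; last exact: continuous_normal_pdf.
  by apply: cvgD; [exact: bl_continuous fL _|exact: cvg_cst].
- by move=> x; rewrite mulr_ge0 ?normal_pdf_ge0 ?(bl_bounds _ fL).
Qed.

(** The substitution [x |-> - x] for integrals over the whole line. *)
Lemma ge0_integral_split f : continuous f -> (forall x, 0 <= f x) ->
  (\int[mu]_x (f x)%:E = \int[mu]_(x in `[0%R, +oo[) (f x)%:E +
     \int[mu]_(x in `[0%R, +oo[) (f (- x))%:E)%E.
Proof.
move=> cf f0; have mf : measurable_fun [set: R] f by exact: continuous_measurable_fun.
have mposnums : measurable [set x : R | 0 <= x] by rewrite -set_itvcy.
rewrite -(setUv [set x : R | 0 <= x]) ge0_integral_setU//= ; last 4 first.
- exact: measurableC.
- by apply/measurable_EFinP; rewrite setUv.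
- by move=> x _; rewrite lee_fin.
- exact/disj_setPCl.
rewrite -set_itvcy// setCitvr; congr (_ + _)%E.
rewrite integral_itv_bndo_bndc; last exact/measurable_EFinP/measurable_funTS.
rewrite -{1}oppr0 ge0_integration_by_substitutionNy//.
exact: continuous_subspaceT.
Qed.

Lemma normal_sym f M L : bl M L f ->
  \int[normal_prob 0 1]_x f (- x) = \int[normal_prob 0 1]_x f x.
Proof.
move=> fL.
have gL : bl M L (fun x => f (- x)).
  case: fL => fM fL; split=> [x|x y] //.
  by apply: le_trans (fL _ _) _; rewrite -opprD normrN.
apply: (normal_eq gL fL).
have pN x : normal_pdf 0 1 (- x) = normal_pdf 0 1 x :> R.
  by rewrite !normal_pdfE ?oner_eq0 // /normal_fun !subr0 sqrrN.
rewrite !ge0_integral_split.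
- apply: etrans (addeC _ _); congr (_ + _)%E; apply: eq_integral => x _.
    by rewrite pN.
  by rewrite opprK pN.
- move=> x; apply: cvgM; last by apply: continuous_normal_pdf; exact: oner_neq0.
  by apply: cvgD; [exact: bl_continuous fL _|exact: cvg_cst].
- by move=> x; rewrite mulr_ge0 ?normal_pdf_ge0 ?(bl_bounds _ fL).
- move=> x; apply: cvgM; last by apply: continuous_normal_pdf; exact: oner_neq0.
  by apply: cvgD; [exact: bl_continuous gL _|exact: cvg_cst].
- by move=> x; rewrite mulr_ge0 ?normal_pdf_ge0 ?(bl_bounds _ gL).
Qed.

End Gaussian.

Definition stdnormal (R : realType) : probability (measurableTypeR R) R :=
  normal_prob (0 : R) 1.

Section Moments.
Variable R : realType.
Local Notation mu := (@lebesgue_measure R).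
Local Notation phi := (@normal_pdf R 0 1).

(** The fundamental theorem of calculus on [[- n, n]], as [n] grows. *)
Lemma FTC_line (h F : R -> R) (c : R) : continuous h ->
  (forall x : R, is_derive x 1 F (h x)) -> mu.-integrable setT (EFin \o h) ->
  (F n.+1%:R - F (- n.+1%:R)) @[n --> \oo] --> c ->
  \int[mu]_x h x = c.
Proof.
move=> ch dF ih Fc; pose I (n : nat) : set R := `[- n.+1%:R, n.+1%:R]%classic.
have key n : (\int[mu]_x (h x * \1_(I n) x)%:E = (F n.+1%:R - F (- n.+1%:R))%:E)%E.
  rewrite EFinB -(@continuous_FTC2 _ h F).
  - rewrite [RHS]integral_mkcond; apply: eq_integral => x _.
    by rewrite patchE indicE /I; case: ifP => _; rewrite ?mulr1 ?mulr0.
  - by rewrite gtrN // ltr0n.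
  - exact: continuous_subspaceT.
  - have cF x : {for x, continuous F}.
      by apply/differentiable_continuous/derivable1_diffP; exact: ex_derive.
    split => [x _||]; first exact: ex_derive.
    + exact/cvg_at_right_filter/cF.
    + exact/cvg_at_left_filter/cF.
  - by move=> x _; rewrite derive1E derive_val.
have mh : measurable_fun setT h by exact: continuous_measurable_fun.
have mI n : measurable (I n) by exact: measurable_itv.
have [] := @dominated_convergence _ _ _ mu setT measurableT
  (fun n x => (h x * \1_(I n) x)%:E) (EFin \o h) (fun x => `|(EFin \o h) x|%E).
  - move=> n; apply/measurable_EFinP; apply: measurable_funM => //.
    by apply: measurable_indic; exact: mI.
  - exact/measurable_EFinP.
  - apply: aeW => x _; apply: cvg_EFin; first exact: nearW.
    apply/cvgrPdist_le => e e0; near=> n.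
    have xI : I n x; last by rewrite /= indicE mem_set // mulr1 subrr normr0 ltW.
    rewrite /I /= in_itv /= -ler_norml.
    have : (Num.truncn `|x| <= n)%N by near: n; exact: nbhs_infty_ge.
    by rewrite real_truncn_le_nat ?num_real // => /ltW.
  - exact: integrable_abse.
  - apply: aeW => x n _ /=; rewrite lee_fin normrM indicE.
    by case: (_ \in _); rewrite ?normr1 ?mulr1 ?normr0 ?mulr0.
move=> _ _ dc.
have E n : F n.+1%:R - F (- n.+1%:R) = fine (\int[mu]_x (h x * \1_(I n) x)%:E)%E.
  by rewrite key.
have : (F n.+1%:R - F (- n.+1%:R)) @[n --> \oo] --> \int[mu]_x h x.
  under eq_fun do rewrite E.
  apply: fine_cvg; rewrite /Rintegral fineK; first exact: dc.
  exact: integrable_fin_num.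
by move=> h2; exact: (cvg_unique _ h2 Fc).
Unshelve. all: by end_near. Qed.

Let c0 : R := normal_peak 1.

Let phiE x : phi x = c0 * expR (- (x ^+ 2) / 2).
Proof. by rewrite normal_pdfE ?oner_neq0 // /normal_fun subr0 expr1n. Qed.

Lemma normal_pdf_ode (x : R) : is_derive x 1 phi (- x * phi x).
Proof.
have -> : phi = fun x => c0 * (expR \o (fun y => - (y ^+ 2) / 2)) x.
  by apply/funext => y; rewrite phiE.
have d1 : is_derive x 1 (fun y : R => - (y ^+ 2) / 2) (- x).
  apply: is_derive_eq; rewrite /GRing.scale /=; by field.
apply: is_derive_eq.
by rewrite /GRing.scale /=; ring.
Qed.

(** A quartic polynomial times [exp (- x^2 / 2)] is at most a constant times
    [exp (- x^2 / 4)]. *)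
Lemma poly4_integrable (f : R -> R) : measurable_fun setT f ->
  (forall x, `|f x| <= 1 + x ^+ 4) ->
  mu.-integrable setT (EFin \o (fun x => f x * phi x)).
Proof.
move=> mf f4; pose s : R := Num.sqrt 2.
have s0 : s != 0 by rewrite gt_eqF // sqrtr_gt0.
have c00 : 0 <= c0 by exact: normal_peak_ge0.
pose C := 64 * c0 / normal_peak s.
have mphi : measurable_fun setT phi by exact: measurable_normal_pdf.
have B (x : R) : `|f x * phi x| <= phi x + C * normal_pdf 0 s x.
  have e0 y : 0 <= expR y :> R by exact: expR_ge0.
  have pp := normal_pdf_ge0 (0 : R) 1 x.
  have ps := normal_pdf_ge0 (0 : R) s x.
  have ps0 : 0 < normal_peak s by exact: normal_peak_gt0.
  rewrite normrM (ger0_norm pp).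
  apply: le_trans (ler_wpM2r pp (f4 x)) _; rewrite mulrDl mul1r lerD2l.
  have -> : normal_pdf 0 s x = normal_peak s * normal_fun 0 s x.
    by rewrite normal_pdfE.
  rewrite /C mulrA divfK ?gt_eqF //.
  have qE : exists q, q = x ^+ 4 by exists (x ^+ 4).
  case: qE => q qE; rewrite -qE.
  rewrite phiE mulrCA [64 * c0]mulrC -(mulrA c0 64) ler_wpM2l //.
  rewrite /normal_fun subr0 sqr_sqrtr ?ler0n //.
  set y := x ^+ 2 / 4; have y0 : 0 <= y by rewrite /y divr_ge0 // sqr_ge0.
  have -> : - x ^+ 2 / 2 = - y + - y by rewrite /y; field.
  have -> : - x ^+ 2 / (2 *+ 2) = - y by rewrite /y -mulr_natr; field.
  rewrite expRD mulrA ler_wpM2r //.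
  rewrite expRN ler_pdivrMr ?expR_gt0 //.
  have h : y ^+ 2 / 4 <= expR y.
    have -> : expR y = expR (y / 2) ^+ 2 by rewrite expr2 -expRD -splitr.
    have -> : y ^+ 2 / 4 = (y / 2) ^+ 2 by field.
    rewrite ler_pXn2r ?nnegrE ?divr_ge0 ?sqr_ge0 //.
    by apply: le_trans (expR_ge1Dx _); rewrite lerDr.
  have -> : q = 64 * (y ^+ 2 / 4) by rewrite qE /y; field.
  by rewrite ler_wpM2l.
apply: (@le_integrable _ _ _ mu _ measurableT _
   (EFin \o (fun x => phi x + C * normal_pdf 0 s x))).
- by apply/measurable_EFinP; exact: measurable_funM.
- by move=> x _; rewrite lee_fin; exact: le_trans (B x) (ler_norm _).
- have := integrableD measurableT (integrable_normal_pdf 0 1)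
    (integrableZl measurableT C (integrable_normal_pdf 0 s)).
  by apply: eq_integrable.
Qed.

Local Notation N := (stdnormal R).

Lemma normal_integrable (f : R -> R) : measurable_fun setT f ->
  (forall x, `|f x| <= 1 + x ^+ 4) -> N.-integrable setT (EFin \o f).
Proof. by move=> mf f4; have [] := normal_density mf (poly4_integrable mf f4). Qed.

Let x1 (x : R) : `|x| <= 1 + x ^+ 4.
Proof.
have : 0 <= (x ^+ 2 - 2^-1) ^+ 2 by exact: sqr_ge0.
have -> : x ^+ 4 = (x ^+ 2) ^+ 2 by rewrite -exprM.
have : 0 <= (`|x| - 2^-1) ^+ 2 by exact: sqr_ge0.
rewrite !sqrrB real_normK ?num_real // -[_ * 2^-1 *+ 2]mulr_natr mulfVK ?pnatr_eq0 //.
rewrite -[_ * 2^-1 *+ 2]mulr_natr mulfVK ?pnatr_eq0 // exprVn.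
by set a := x ^+ 2; set b := `|x|; set c := a ^+ 2; lra.
Qed.

Let x2 (x : R) : `|x ^+ 2| <= 1 + x ^+ 4.
Proof.
rewrite ger0_norm ?sqr_ge0 //.
have : 0 <= (x ^+ 2 - 1) ^+ 2 by exact: sqr_ge0.
have -> : x ^+ 4 = (x ^+ 2) ^+ 2 by rewrite -exprM.
have := sqr_ge0 x.
by set a := x ^+ 2; rewrite sqrrB1 -mulr_natr; set c := a ^+ 2; lra.
Qed.

Lemma cube_le (x : R) : `|x| ^+ 3 <= 1 + x ^+ 4.
Proof.
have [h|h] := leP `|x| 1.
  apply: (@le_trans _ _ 1); first by rewrite exprn_ile1.
  by rewrite lerDl (exprM _ 2 2) sqr_ge0.
have -> : x ^+ 4 = `|x| ^+ 4 by rewrite -normrX ger0_norm // (exprM _ 2 2) sqr_ge0.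
by apply: (@le_trans _ _ (`|x| ^+ 4)); rewrite ?lerDr // ler_weXn2l // ltW.
Qed.

Lemma normal_mean : N.-integrable setT (EFin \o id) /\ \int[N]_x x = 0.
Proof.
split; first exact: normal_integrable.
have [_ ->] := normal_density (@measurable_id _ _ _) (poly4_integrable (@measurable_id _ _ _) x1).
(* By the equation [phi' x = - x * phi x], an antiderivative of [x * phi x]. *)
apply: (@FTC_line _ (fun x => - phi x)).
- by move=> x; apply: cvgM; [exact: cvg_id|exact: continuous_normal_pdf (oner_neq0 _) _].
- by move=> x; have := normal_pdf_ode x => d; apply: is_derive_eq; rewrite mulNr opprK.
- exact: poly4_integrable.
- rewrite [X in X @ _](_ : _ = cst 0); first exact: cvg_cst.
  by apply/funext => n /=; rewrite !phiE sqrrN subrr.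
Qed.

Lemma normal_second : N.-integrable setT (EFin \o (fun x => x ^+ 2)) /\
  \int[N]_x x ^+ 2 = 1.
Proof.
have m2 : measurable_fun setT (fun x : R => x ^+ 2) by exact: measurable_funX.
have i2 := normal_integrable m2 x2.
split=> //.
have i1 : N.-integrable setT (EFin \o cst (1 : R)).
  exact: finite_measure_integrable_cst.
apply/eqP; rewrite -subr_eq0; apply/eqP.
rewrite -[X in _ - X](Rintegral_cstT N) -RintegralB //.
have m21 : measurable_fun setT (fun x : R => x ^+ 2 - 1).
  by apply: measurable_funB.
have b21 x : `|x ^+ 2 - 1| <= 1 + x ^+ 4 :> R.
  rewrite ler_norml; have -> : x ^+ 4 = (x ^+ 2) ^+ 2 by rewrite -exprM.
  have := x2 x; rewrite ger0_norm ?sqr_ge0 // (exprM _ 2 2).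
  have := sqr_ge0 x; have := sqr_ge0 (x ^+ 2).
  by set a := x ^+ 2; set b := a ^+ 2; move=> *; apply/andP; split; lra.
have [_ ->] := normal_density m21 (poly4_integrable m21 b21).
(* By the same equation, an antiderivative of [(x ^+ 2 - 1) * phi x]. *)
apply: (@FTC_line _ (fun x => - x * phi x)).
- move=> x; apply: cvgM; last exact: continuous_normal_pdf (oner_neq0 _) _.
  by apply: cvgB; [exact: sqr_continuous|exact: cvg_cst].
- move=> x; have := normal_pdf_ode x => d; apply: is_derive_eq.
  by rewrite /GRing.scale /=; ring.
- exact: poly4_integrable.
- have c00 : 0 < c0 by apply: normal_peak_gt0; exact: oner_neq0.
  apply/cvgrPdist_le => e e0; near=> n; rewrite sub0r normrN.
  rewrite !phiE opprK sqrrN -mulrBl -opprD mulNr normrN.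
  set x : R := n.+1%:R; have x0 : 0 < x by rewrite ltr0n.
  have ep := expR_gt0 (- x ^+ 2 / 2).
  rewrite ger0_norm; last by rewrite !mulr_ge0 ?addr_ge0 // ltW.
  have h : expR (- x ^+ 2 / 2) <= 2 / x ^+ 2.
    rewrite mulNr expRN -[leRHS]invrK lef_pV2 ?posrE ?expR_gt0 ?invr_gt0 ?divr_gt0 ?exprn_gt0 //.
    rewrite invf_div; apply: le_trans (expR_ge1Dx _); by rewrite lerDr.
    apply: (@le_trans _ _ (4 * c0 / x)).
    apply: (@le_trans _ _ ((x + x) * (c0 * (2 / x ^+ 2)))).
      by rewrite ler_wpM2l ?addr_ge0 ?(ltW x0) // ler_wpM2l // ltW.
    by rewrite le_eqVlt; apply/orP; left; apply/eqP; field; rewrite gt_eqF.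
  rewrite ler_pdivrMr // -ler_pdivrMl // mulrC.
  have : (Num.truncn (4 * c0 / e) <= n)%N by near: n; exact: nbhs_infty_ge.
  by rewrite real_truncn_le_nat ?num_real // => /ltW.
Unshelve. all: by end_near. Qed.

Lemma normal_abs : N.-integrable setT (EFin \o (fun x => `|x|)).
Proof.
apply: normal_integrable => [|x]; first exact: normr_measurable.
by rewrite normr_id.
Qed.

Lemma normal_cube : N.-integrable setT (EFin \o (fun x => `|x| ^+ 3)).
Proof.
apply: normal_integrable.
  by apply: measurable_funX; exact: normr_measurable.
by move=> x; rewrite ger0_norm ?exprn_ge0 //; exact: cube_le.
Qed.

End Moments.

(** * Smoothing Lipschitz functions *)

Section Smoothing.
Variable R : realType.
Implicit Types (M L K : R) (f F G : R -> R).
Local Notation mu := (@lebesgue_measure R).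

Lemma mean_value F f : (forall x : R, is_derive x 1 F (f x)) ->
  forall x h, exists2 t, `|t| <= `|h| & F (x + h) - F x = f (x + t) * h.
Proof.
move=> dF x h.
have cF : continuous F.
  by move=> y; apply/differentiable_continuous/derivable1_diffP; exact: ex_derive.
have [h0|h0] := leP 0 h.
  have [|c cx ->] := @MVT_segment _ F f x (x + h) _ (fun y _ => dF y) (continuous_subspaceT cF).
    by rewrite lerDl.
  move: cx; rewrite in_itv /= => /andP[c1 c2].
  exists (c - x); last by rewrite subrKC [x + h]addrC addrK.
  by rewrite !ger0_norm ?subr_ge0 // lerBlDl.
have [|c cx E] := @MVT_segment _ F f (x + h) x _ (fun y _ => dF y) (continuous_subspaceT cF).
  by rewrite gerDl ltW.
move: cx; rewrite in_itv /= => /andP[c1 c2].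
exists (c - x); last by rewrite -opprB E opprD addrA subrr sub0r mulrN opprK subrKC.
by rewrite !ler0_norm ?subr_le0 ?(ltW h0) // lerN2 lerBrDl.
Qed.

Lemma primitive f : continuous f -> exists F, forall x : R, is_derive x 1 F (f x).
Proof.
move=> cf; pose I (n : nat) (x : R) := \int[mu]_(t in `[- n%:R, x]) f t.
have i_f a b : mu.-integrable `[a, b] (EFin \o f).
  apply: continuous_compact_integrable; first exact: segment_compact.
  exact: continuous_subspaceT.
have IE m n x : (m <= n)%N -> - m%:R <= x -> I n x = I n (- m%:R) + I m x.
  move=> mn mx; apply/eqP; rewrite addrC -subr_eq; apply/eqP.
  rewrite /I Rintegral_itvB ?bnd_simp ?lerN2 ?ler_nat //.
  by rewrite Rintegral_itv_obnd_cbnd //; apply: integrableS (i_f (- m%:R) x) => //;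
    exact: subset_itv_oc_cc.
pose N (x : R) := (Num.truncn `|x|).+1.
pose F x := I (N x) x - I (N x) 0.
have Nx x : `|x| < (N x)%:R by exact: real_truncnS_gt.
have FE n x : - n%:R < x -> F x = I n x - I n 0.
  move=> nx; pose k := maxn n (N x).
  have Fk m : (m <= k)%N -> - m%:R <= x -> I m x - I m 0 = I k x - I k 0.
    move=> mk mx; rewrite (IE m k x) // (IE m k 0) // ?oppr_le0 ?ler0n //.
    by rewrite opprD addrACA subrr add0r.
  rewrite /F (Fk (N x)) ?leq_maxr // ?(Fk n) ?leq_maxl ?ltW //.
  by have := Nx x; rewrite ltr_norml => /andP[+ _].
exists F => x.
pose n := (N x).+1.
have xn : - n%:R < x.
  have := Nx x; rewrite ltr_norml => /andP[+ _]; apply: le_lt_trans.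
  by rewrite lerN2 ler_nat.
have FTC : derivable (I n) x 1 /\ (I n)^`()%classic x = f x.
  apply: (@continuous_FTC1 _ f (BLeft (- n%:R)) x (x + 1)) => //.
    by rewrite ltrDl.
  exact: cf.
have dI : is_derive x 1 (I n) (f x) 
  by case: FTC => d1 d2; apply: DeriveDef => //; rewrite -derive1E.
have dI0 : is_derive x 1 (fun y => I n y - I n 0) (f x).
  by apply: is_derive_eq; rewrite subr0.
apply: near_eq_is_derive dI0.
near=> y; rewrite (FE n) //; near: y.
exact: lt_nbhsr.
Unshelve. all: by end_near. Qed.

(** Second-order Taylor expansion of a function whose second derivative is only
    Lipschitz. *)
Lemma taylor2 f F G L : (forall x y, `|f x - f y| <= L * `|x - y|) ->
  (forall x : R, is_derive x 1 F (f x)) -> (forall x : R, is_derive x 1 G (F x)) ->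
  forall x h, `|F (x + h) - (F x + h * f x)| <= L * `|h| ^+ 2 /\
    `|G (x + h) - (G x + h * F x + h ^+ 2 / 2 * f x)| <= L * `|h| ^+ 3.
Proof.
move=> fL dF dG x.
have L0 : 0 <= L.
  have := fL 1 0; rewrite subr0 normr1 mulr1; exact: le_trans.
have F2 h : `|F (x + h) - (F x + h * f x)| <= L * `|h| ^+ 2.
  have [t th E] := mean_value dF x h.
  rewrite opprD addrA E mulrC -mulrBr normrM expr2 mulrCA ler_wpM2l //.
  apply: le_trans (fL _ _) _; rewrite addrAC subrr add0r.
  by rewrite ler_wpM2l.
move=> h; split=> //.
pose u t := G (x + t) - (G x + t * F x + t ^+ 2 / 2 * f x).
have du (t : R) : is_derive t 1 u (F (x + t) - (F x + t * f x)).
  have d1 : is_derive t 1 (fun t => x + t) 1.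
    by apply: is_derive_eq; rewrite add0r mulr1.
  have d2 : is_derive t 1 (fun t => G (x + t)) (F (x + t) * 1).
    exact: (@is_derive1_comp _ G (fun t => x + t)).
  apply: is_derive_eq; rewrite /GRing.scale /=; by field.
have [t th E] := mean_value du 0 h.
have u0 : u 0 = 0 by rewrite /u addr0 mul0r expr0n /= !mul0r !addr0 subrr.
move: E; rewrite !add0r u0 subr0 -/(u h) => ->.
rewrite normrM exprSr mulrA ler_wpM2r //.
apply: le_trans (F2 t) _; rewrite ler_wpM2l //.
by rewrite ler_pXn2r ?nnegrE.
Qed.

(** Test functions with bounded derivatives up to order 2 and a third-order
    Taylor estimate; [f1] and [f2] are the first two derivatives. *)
Definition smooth3 M L K K2 f := bl M K f /\ exists f1 f2 : R -> R,
  [/\ forall x, `|f1 x| <= K, forall x, `|f2 x| <= K2 &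
   forall x h, `|f (x + h) - (f x + h * f1 x + h ^+ 2 / 2 * f2 x)| <= L * `|h| ^+ 3].

Lemma smooth3_comp_affine M L K K2 f c t : smooth3 M L K K2 f ->
  smooth3 M (L * `|t| ^+ 3) (K * `|t|) (K2 * t ^+ 2) (fun x => f (c + t * x)).
Proof.
case=> fb [f1 [f2 [h1 h2 h3]]]; split; first exact: bl_comp_affine.
exists (fun x => t * f1 (c + t * x)), (fun x => t ^+ 2 * f2 (c + t * x)); split=> [x|x|x h].
- by rewrite normrM mulrC ler_wpM2r.
- by rewrite normrM (ger0_norm (sqr_ge0 t)) mulrC ler_wpM2r ?sqr_ge0.
- rewrite [X in `|X|](_ : _ = f (c + t * x + t * h) -
     (f (c + t * x) + t * h * f1 (c + t * x) + (t * h) ^+ 2 / 2 * f2 (c + t * x))).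
    by rewrite -(mulrA L) -exprMn -normrM; exact: h3.
  by rewrite mulrDr addrA; ring.
Qed.

(** The second difference of a second primitive of [f], that is, the average of
    [f] over the sums of two independent uniform variables on [[x, x + dl]]. *)
Lemma smoothing M L dl f : bl M L f -> 0 < dl ->
  exists2 g, smooth3 (M + 10 * dl * L) (4 * L / dl ^+ 2) (6 * L) (2 * L / dl) g &
    forall x, `|f x - g x| <= 10 * dl * L.
Proof.
move=> fb dl0; have [fM fL] := fb.
have L0 : 0 <= L.
  have := fL 1 0; rewrite subr0 normr1 mulr1; exact: le_trans.
have [F dF] := primitive (bl_continuous fb).
have cF : continuous F.
  by move=> y; apply/differentiable_continuous/derivable1_diffP; exact: ex_derive.
have [G dG] := primitive cF.
have T := taylor2 fL dF dG.
pose D (u : R -> R) x := (u (x + 2 * dl) - 2 * u (x + dl) + u x) / dl ^+ 2.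
have dl20 : 0 < 2 * dl by rewrite mulr_gt0.
have dl2 : 0 < dl ^+ 2 by rewrite exprn_gt0.
(* The first two derivatives of the approximation [D G] are [D F] and [D f]; the
   factor [dl ^+ 2] costs nothing in [D F], as the first-order terms cancel. *)
have D1 x : `|D F x| <= 6 * L.
  have [] := T x (2 * dl); have [] := T x dl.
  rewrite (gtr0_norm dl20) (gtr0_norm dl0) => t1 _ t2 _.
  rewrite /D normrM [X in _ * X]gtr0_norm ?invr_gt0 // ler_pdivrMr //.
  move: t1 t2; rewrite !ler_norml => /andP[a1 a2] /andP[b1 b2].
  by apply/andP; split; move: a1 a2 b1 b2; rewrite exprMn; lra.
have D2 x : `|D f x| <= 2 * L / dl.
  have := fL (x + 2 * dl) (x + dl); have := fL (x + dl) x.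
  rewrite addrAC subrr add0r (gtr0_norm dl0).
  rewrite [x + 2 * dl - _](_ : _ = dl); last by ring.
  rewrite (gtr0_norm dl0) => a1 a2.
  rewrite /D normrM [X in _ * X]gtr0_norm ?invr_gt0 // ler_pdivrMr //.
  rewrite [leRHS](_ : _ = 2 * (L * dl)); last by field; rewrite gt_eqF.
  move: a1 a2; rewrite !ler_norml => /andP[a1 a2] /andP[b1 b2].
  by apply/andP; split; move: a1 a2 b1 b2; lra.
have D3 x : `|f x - D G x| <= 10 * dl * L.
  have [_] := T x (2 * dl); have [_] := T x dl.
  rewrite (gtr0_norm dl20) (gtr0_norm dl0) => t1 t2.
  rewrite -(ler_pM2r dl2) -[X in _ * X](gtr0_norm dl2) -normrM mulrBl /D divfK ?gt_eqF //.
  move: t1 t2; rewrite !ler_norml => /andP[a1 a2] /andP[b1 b2].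
  have e3 : 10 * dl * L * dl ^+ 2 = 10 * (L * dl ^+ 3) by ring.
  have e4 : L * (2 * dl) ^+ 3 = 8 * (L * dl ^+ 3) by ring.
  rewrite e3; rewrite e4 in b1 b2.
  have e5 : (2 * dl) ^+ 2 / 2 = 2 * dl ^+ 2 by field.
  rewrite e5 in b1 b2.
  by apply/andP; split; move: a1 a2 b1 b2; lra.
exists (D G) => //; split; last first.
  exists (D F), (D f); split=> // x h.
  have E : D G (x + h) - (D G x + h * D F x + h ^+ 2 / 2 * D f x) =
    ((G (x + 2 * dl + h) - (G (x + 2 * dl) + h * F (x + 2 * dl)
        + h ^+ 2 / 2 * f (x + 2 * dl)))
    - 2 * (G (x + dl + h) - (G (x + dl) + h * F (x + dl) + h ^+ 2 / 2 * f (x + dl)))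
    + (G (x + h) - (G x + h * F x + h ^+ 2 / 2 * f x))) / dl ^+ 2.
    by rewrite /D (addrAC x h) (addrAC x h dl); field; rewrite gt_eqF.
  rewrite E normrM [X in _ * X]gtr0_norm ?invr_gt0 //.
  rewrite ler_pdivrMr // [leRHS](_ : _ = 4 * (L * `|h| ^+ 3)); last by field; rewrite gt_eqF.
  have [_] := T (x + 2 * dl) h; have [_] := T (x + dl) h; have [_] := T x h.
  rewrite !ler_norml => /andP[a1 a2] /andP[b1 b2] /andP[c1 c2].
  by apply/andP; split; move: a1 a2 b1 b2 c1 c2; lra.
split=> [x|x y].
  rewrite -[D G x](subrK (f x)) addrC; apply: le_trans (ler_normD _ _) _.
  by apply: lerD => //; rewrite distrC.
have dD (z : R) : is_derive z 1 (D G) (D F z).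
  have d1 c : is_derive z 1 (fun z => G (z + c)) (F (z + c)).
    have d0 : is_derive z 1 (fun t => t + c) 1 by apply: is_derive_eq; rewrite addr0 ?mulr1.
    have := @is_derive1_comp _ G (fun t => t + c) z _ _ (dG _) d0.
    by rewrite mulr1.
  have d2 := d1 (2 * dl); have d3 := d1 dl.
  rewrite /D; apply: is_derive_eq; rewrite /GRing.scale /= /D; by field; rewrite gt_eqF.
have [t _] := mean_value dD y (x - y).
by rewrite subrKC => ->; rewrite normrM ler_wpM2r.
Qed.

End Smoothing.

(** * Convergence of the increments at a fixed dyadic level *)

Section NormalIterated.
Variable R : realType.
Implicit Types (M L e : R).
Local Notation N := (stdnormal R).
Local Notation m1 := (\int[N]_x `|x|).

Lemma ge0_lip L (f : R -> R) : (forall x y, `|f x - f y| <= L * `|x - y|) -> 0 <= L.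
Proof. by move=> /(_ 1 0); rewrite subr0 normr1 mulr1; exact: le_trans. Qed.

Lemma sbl_ge0 M L psi : sbl M L psi -> 0 <= L.
Proof. by case=> _ /(_ [::] [::]) h; exact: (@ge0_lip L (fun x => psi [:: x])). Qed.

Lemma bl_integral2 M L (f : R -> R) a b : bl M L f ->
  bl M (L * `|b|) (fun y => \int[N]_x f (a * x + b * y)).
Proof.
move=> fb; have B y : bl M (L * `|a|) (fun x => f (a * x + b * y)).
  have := bl_comp_affine (b * y) a fb; congr bl; apply/funext => x.
  by rewrite addrC.
split=> [y|y z]; first by apply: Rintegral_bound; [exact: bl_measurable (B y)|exact: (B y).1].
apply: Rintegral_dist_cst; [exact: bl_measurable (B y)|exact: (B y).1|
  exact: bl_measurable (B z)|exact: (B z).1|move=> x].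
 apply: le_trans (fb.2 _ _) _.
by rewrite opprD addrACA subrr add0r -mulrBr normrM mulrA.
Qed.

(** Changing the scale from [c] to [c'] moves each of the [n] variables by
    [`|c - c'|] times its absolute value. *)
Lemma IT_map_dist n M L psi c c' : sbl M L psi ->
  `|IT N n (fun s => psi (map ( *%R c) s)) - IT N n (fun s => psi (map ( *%R c') s))|
  <= L * `|c - c'| * n%:R * m1.
Proof.
move=> psiL; have L0 := sbl_ge0 psiL; set K := L * `|c - c'|.
elim: n psi psiL => [|n IH] psi psiL /=.
  by rewrite subrr normr0 mulr0 mul0r.
have b1 d : bl M (L * `|d|) (fun x => IT N n (fun s => psi (map ( *%R d) (x :: s)))).
  exact: bl_IT_cons (sbl_map d psiL).
have h x : `|IT N n (fun s => psi (c * x :: map ( *%R c) s)) -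
     IT N n (fun s => psi (c' * x :: map ( *%R c') s))| <= K * n%:R * m1 + K * `|x|.
  apply: le_trans (ler_distD (IT N n (fun s => psi (c' * x :: map ( *%R c) s))) _ _) _.
  rewrite addrC lerD //; first exact: IH (sbl_cons (c' * x) psiL).
  apply: IT_dist; [exact: sbl_map (sbl_cons (c * x) psiL)|
    exact: sbl_map (sbl_cons (c' * x) psiL)|move=> s].
  have [_ /(_ [::]) hp] := psiL; apply: le_trans (hp _ _ _) _.
  by rewrite -mulrBl normrM mulrA.
have ia := normal_abs R.
have -> : K * n.+1%:R * m1 = \int[N]_x (K * n%:R * m1 + K * `|x|).
  rewrite RintegralD //; [|exact: RintegrableC|exact: RintegrableZ].
  by rewrite Rintegral_cstT RintegralZl // -natr1 mulrDr mulr1 mulrDl.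
apply: (@Rintegral_dist _ _ _ N); last exact: h.
- exact: bl_integrable (b1 c).
- exact: bl_integrable (b1 c').
- by apply: RintegrableD; [exact: RintegrableC|exact: RintegrableZ].
Qed.

Lemma IT_sym n M L psi : sbl M L psi ->
  IT N n (fun s => psi (map ( *%R (-1)) s)) = IT N n psi.
Proof.
elim: n psi => [//|n IH] psi psiL /=.
under eq_Rintegral => x _ do rewrite (IH (fun s => psi (-1 * x :: s)) (sbl_cons _ psiL)) mulN1r.
exact: normal_sym (bl_IT_cons N n psiL).
Qed.

Lemma IT_sg n M L psi (a : bool) c : sbl M L psi ->
  IT N n (fun s => psi (map ( *%R (c * sg R a)) s)) = IT N n (fun s => psi (map ( *%R c) s)).
Proof.
move=> psiL; case: a; rewrite /sg ?mulr1 //.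
rewrite -(IT_sym n (sbl_map c psiL)); apply: eq_IT => s _; congr psi.
by rewrite -map_comp; apply: eq_map => x /=; rewrite mulrA.
Qed.

End NormalIterated.

Section CLT.
Variable R : realType.
Local Notation N := (stdnormal R).
Local Notation m1 := (\int[N]_x `|x|).
Let r : R := Num.sqrt 2^-1.

(** A standard normal variable is the normalized sum of two independent ones. *)
Hypothesis normal_stable : forall M L (f : R -> R), bl M L f ->
  \int[N]_y \int[N]_x f (r * x + r * y) = \int[N]_x f x.

Context {I : Type} {F : set_system I} {FF : Filter F}.
Variables th p ka : I -> R.
Hypothesis range : \forall i \near F, [/\ 2^-1 <= th i, th i ^+ 2 < 2^-1,
  th i * p i = 2^-1, 0 <= ka i & ka i ^+ 2 = 2 - 4 * th i ^+ 2].
Hypothesis th_cvg : th i @[i --> F] --> r.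
Hypothesis ka_cvg : ka i @[i --> F] --> (0 : R).

Let r_gt0 : 0 < r. Proof. by rewrite sqrtr_gt0 invr_gt0. Qed.

Let r2 : r ^+ 2 = 2^-1. Proof. by rewrite sqr_sqrtr // invr_ge0. Qed.

Let r_lt1 : r < 1.
Proof. by rewrite -(@ltr_pXn2r _ 2) ?nnegrE ?ltW // r2 expr1n invf_lt1 // ltr1n. Qed.

Let th_facts i : 2^-1 <= th i -> th i ^+ 2 < 2^-1 -> 0 < th i <= r.
Proof.
move=> h1 h2; have t0 : 0 < th i by apply: lt_le_trans h1; rewrite invr_gt0.
by rewrite t0 -(@ler_pXn2r _ 2) ?nnegrE ?ltW // r2.
Qed.

Let C : R := 10 + \int[N]_x `|x| ^+ 3.

Let C_ge0 : 0 <= C.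
Proof. by rewrite addr_ge0 //; apply: Rintegral_ge0 => x _; rewrite exprn_ge0. Qed.

Let m1_ge0 : 0 <= m1. Proof. exact: Rintegral_ge0. Qed.

Let near_small (u : I -> R) (l e : R) : u i @[i --> F] --> l -> 0 < e ->
  \forall i \near F, `|u i - l| <= e.
Proof. by move=> ul e0; under eq_near do rewrite distrC; exact: cvgr_dist_le. Qed.

(** The estimate before any averaging: only the moments up to order 2 agree in
    the limit, and the third-order term is merely bounded. *)
Let clt0 (e : R) : 0 < e -> \forall i \near F, \forall k \near \oo,
  forall M L K K2 f, smooth3 M L K K2 f -> 0 <= L -> 0 <= K -> 0 <= K2 ->
  `|ET (p i) (fun t : tree k => f (ka i * Y (th i) t)) - \int[N]_x f x|
  <= C * L + e * (K + K2).
Proof.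
move=> e0; have ka_e := near_small ka_cvg e0.
near=> i.
have [t1 t2 tp k0 k2] : [/\ 2^-1 <= th i, th i ^+ 2 < 2^-1,
  th i * p i = 2^-1, 0 <= ka i & ka i ^+ 2 = 2 - 4 * th i ^+ 2] by near: i.
have /andP[tg tr] := th_facts t1 t2.
have kae : ka i <= e.
  have : `|ka i - 0| <= e by near: i.
  by rewrite subr0 ger0_norm.
have pr1 := p_range t1 tp.
have q01 : 0 <= 2 * th i ^+ 2 < 1 by rewrite mulr_ge0 ?sqr_ge0 //=; lra.
have q_cvg : (2 * th i ^+ 2) ^+ k @[k --> \oo] --> (0 : R).
  by apply: cvg_expr; rewrite ger0_norm; case/andP: q01.
near=> k => M L K K2 f [fb [f1 [f2 [h1 h2 h3]]]] L0 K0 K20.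
have qk : (2 * th i ^+ 2) ^+ k <= e.
  have : `|0 - (2 * th i ^+ 2) ^+ k| <= e by near: k; exact: cvgr_dist_le.
  by rewrite sub0r normrN; exact: le_trans (ler_norm _).
pose g x := f 0 + x * f1 0 + x ^+ 2 / 2 * f2 0.
have fg x : `|f x - g x| <= L * `|x| ^+ 3.
  by have := h3 0 x; rewrite add0r.
set Z := fun t : tree k => ka i * Y (th i) t.
have e1 : `|ET (p i) (f \o Z) - ET (p i) (g \o Z)| <= L * 10.
  rewrite -ETB; apply: le_trans (ler_norm_ET pr1 _) _.
  apply: (@le_trans _ _ (ET (p i) (fun t => L * (1 + Z t ^+ 4)))).
    apply: (ET_le pr1) => t; apply: le_trans (fg _) _.
    by rewrite ler_wpM2l //; exact: cube_le.
  rewrite ETZ ETD ET_cst // ler_wpM2l //.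
  have := fourth_moment t1 (ltW t2) tp k0 k2 k.
  by rewrite -/Z; lra.
have e2 : ET (p i) (g \o Z) = f 0 + ka i * f1 0 +
    (1 - (2 * th i ^+ 2) ^+ k * (1 - ka i ^+ 2)) / 2 * f2 0.
  have -> : ET (p i) (g \o Z) = ET (p i) (fun _ : tree k => f 0) +
      (f1 0 * ET (p i) Z + f2 0 / 2 * ET (p i) (fun t => Z t ^+ 2)).
    by rewrite -!ETZ -!ETD; apply: eq_ET => t; rewrite /g /=; field.
  have -> : ET (p i) Z = ka i by rewrite ETZ (mean_Y t1 tp) mulr1.
  have := second_moment t1 tp k2 k; rewrite -/Z => /eqP.
  by rewrite subr_eq => /eqP ->; rewrite ET_cst; field.
have e3 : `|\int[N]_x f x - (f 0 + f2 0 / 2)| <= L * \int[N]_x `|x| ^+ 3.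
  have [i1 E1] := normal_mean R; have [i2 E2] := normal_second R.
  have i3 := normal_cube R.
  have gE : g = fun x => f 0 + (f1 0 * x + f2 0 / 2 * x ^+ 2).
    by apply/funext => x; rewrite /g; field.
  have ig : N.-integrable setT (EFin \o g).
    rewrite gE; apply: RintegrableD; first exact: RintegrableC.
    by apply: RintegrableD; exact: RintegrableZ.
  have -> : f 0 + f2 0 / 2 = \int[N]_x g x.
    rewrite gE RintegralD //; last first.
    - by apply: RintegrableD; exact: RintegrableZ.
    - exact: RintegrableC.
    rewrite RintegralD //; [|exact: RintegrableZ|exact: RintegrableZ].
    rewrite RintegralZl // RintegralZl // E1 E2 Rintegral_cstT.
    by rewrite mulr0 add0r mulr1.
  rewrite -RintegralZl //; apply: (@Rintegral_dist _ _ _ N); last exact: fg.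
  - exact: bl_integrable fb.
  - exact: ig.
  - exact: RintegrableZ.
have t4 : 4^-1 <= th i ^+ 2.
  rewrite [leLHS](_ : _ = 2^-1 ^+ 2); last by field.
  by rewrite ler_pXn2r ?nnegrE ?invr_ge0 // ltW.
have q0 : 0 <= (2 * th i ^+ 2) ^+ k by rewrite exprn_ge0 //; case/andP: q01.
have e4 : `|ka i * f1 0 - (2 * th i ^+ 2) ^+ k * (1 - ka i ^+ 2) / 2 * f2 0| <= e * (K + K2).
  apply: le_trans (ler_normB _ _) _; rewrite (mulrDr e) lerD //.
    by rewrite normrM ler_pM // ger0_norm.
  rewrite normrM ler_pM // ger0_norm; last first.
    by rewrite divr_ge0 // mulr_ge0 // k2; lra.
  apply: le_trans qk; rewrite -mulrA ler_piMr // k2.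
  by have := sqr_ge0 (th i); lra.
rewrite /C.
rewrite -[X in `|X|](_ : ET (p i) (f \o Z) - ET (p i) (g \o Z)
  + (ka i * f1 0 - (2 * th i ^+ 2) ^+ k * (1 - ka i ^+ 2) / 2 * f2 0)
  - (\int[N]_x f x - (f 0 + f2 0 / 2)) = _); last by rewrite e2; field.
apply: le_trans (ler_normB _ _) _; rewrite [leRHS](_ : _ =
  (L * 10 + e * (K + K2)) + L * \int[N]_x `|x| ^+ 3); last by ring.
by apply: lerD => //; apply: le_trans (ler_normD _ _) _; apply: lerD.
Unshelve. all: by end_near. Qed.

Let smooth3_ge0 (M L K K2 : R) f : smooth3 M L K K2 f -> [/\ 0 <= L, 0 <= K & 0 <= K2].
Proof.
case=> _ [f1 [f2 [h1 h2 h3]]]; split.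
- by have := h3 0 1; rewrite normr1 !expr1n mulr1; exact: le_trans.
- exact: le_trans (h1 0).
- exact: le_trans (h2 0).
Qed.

Let ET_swap n (q : R) (g : tree n -> R -> R) (M L : R) : -1 <= q <= 1 -> (forall t, bl M L (g t)) ->
  ET q (fun t => \int[N]_x g t x) = \int[N]_x ET q (fun t => g t x).
Proof.
move=> q1 gb.
have ig t := bl_integrable N (gb t).
have iz t := RintegrableZ (wt q t) (ig t).
rewrite /ET (Rintegral_big_sum _ measurableT iz).2; apply: eq_bigr => t _.
by rewrite RintegralZl.
Qed.

Let bl_ET n (q : R) (g : tree n -> R -> R) (M L : R) : -1 <= q <= 1 -> (forall t, bl M L (g t)) ->
  bl M L (fun x => ET q (fun t => g t x)).
Proof.
move=> q1 gb; split=> [x|x y].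
  have := @ET_dist _ q q1 n (fun t => g t x) (fun=> 0) M.
  by rewrite ET_cst // subr0; apply => t; rewrite subr0; exact: (gb t).1.
by apply: ET_dist => // t; exact: (gb t).2.
Qed.

(** Each level of the recursion replaces the two halves of the sum one after the
    other, which divides the weight of the third-order term by at least the
    square root of 2. *)
Let clt_smooth m (e : R) : 0 < e -> \forall i \near F, \forall k \near \oo,
  forall M L K K2 f, smooth3 M L K K2 f ->
  `|ET (p i) (fun t : tree (m + k) => f (ka i * Y (th i) t)) - \int[N]_x f x|
  <= C * r ^+ m * L + e * (K + K2).
Proof.
elim: m e => [|m IH] e e0.
  apply: filterS (clt0 e0) => i; apply: filterS => k h M L K K2 f fs.
  have [L0 K0 K20] := smooth3_ge0 fs; rewrite expr0 (mulr1 C); exact: h fs _ _ _.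
have e4 : 0 < e / 4 by rewrite divr_gt0.
have em : 0 < e / (4 * (m1 + 1)) by rewrite divr_gt0 // mulr_gt0 // ltr_wpDl.
have th_e := near_small th_cvg em.
have {}IH := IH _ e4.
near=> i.
have [t1 t2 tp k0 k2] : [/\ 2^-1 <= th i, th i ^+ 2 < 2^-1,
  th i * p i = 2^-1, 0 <= ka i & ka i ^+ 2 = 2 - 4 * th i ^+ 2] by near: i.
have /andP[tg tr] := th_facts t1 t2.
have pr1 := p_range t1 tp.
have the : `|th i - r| <= e / (4 * (m1 + 1)) by near: i.
have IHk : \forall k \near \oo,
  forall M L K K2 f, smooth3 M L K K2 f ->
  `|ET (p i) (fun t : tree (m + k) => f (ka i * Y (th i) t)) - \int[N]_x f x|
  <= C * r ^+ m * L + e / 4 * (K + K2) by near: i.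
apply: filterS IHk => k hk M L K K2 f fs.
have [L0 K0 K20] := smooth3_ge0 fs; have [fb _] := fs.
rewrite addSn ETS; apply: sum_pr_dist => // a b /=.
set c := th i * sg R a; set d := th i * sg R b.
have cd x y : ka i * (th i * (sg R a * x + sg R b * y)) =
  c * (ka i * x) + d * (ka i * y) by rewrite /c /d; ring.
have nc : `|c| = th i by rewrite normrM norm_bsign mulr1 gtr0_norm.
have nd : `|d| = th i by rewrite normrM norm_bsign mulr1 gtr0_norm.
set E' := C * r ^+ m * (L * th i ^+ 3) + e / 4 * (K + K2).
have one u v : `|v| = th i ->
    `|ET (p i) (fun t : tree (m + k) => f (u + v * (ka i * Y (th i) t))) -
      \int[N]_x f (u + v * x)| <= E'.
  move=> nv; have := hk _ _ _ _ _ (smooth3_comp_affine u v fs).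
  rewrite nv; move/le_trans; apply; rewrite /E' lerD2l ler_wpM2l ?(ltW e4) //.
  apply: lerD; first by rewrite ler_piMr // (le_trans tr) // ltW.
  rewrite ler_piMr // -real_normK ?num_real // nv.
  by rewrite (le_trans (ltW t2)) // invf_le1 // ler1n.
under eq_ET do under eq_ET do rewrite cd.
set Z := fun t : tree (m + k) => ka i * Y (th i) t.
have b0 t0 : bl M (K * th i) (fun x => f (c * Z t0 + d * x)).
  by have := bl_comp_affine (c * Z t0) d fb; rewrite nd.
have s1 : `|ET (p i) (fun t0 => ET (p i) (fun t1 => f (c * Z t0 + d * Z t1))) -
    ET (p i) (fun t0 => \int[N]_x f (c * Z t0 + d * x))| <= E'.
  by apply: ET_dist => // t0; exact: one.
have s3 : `|\int[N]_x ET (p i) (fun t0 => f (c * Z t0 + d * x)) -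
    \int[N]_y \int[N]_x f (c * x + d * y)| <= E'.
  have b1 := bl_ET pr1 b0; have b2 := bl_integral2 c d fb.
  apply: (@Rintegral_dist_cst _ _ _ N _ _ M M).
  - exact: bl_measurable b1.
  - exact: b1.1.
  - exact: bl_measurable b2.
  - exact: b2.1.
  move=> y; under eq_ET do rewrite addrC.
  by under eq_Rintegral do rewrite addrC; exact: one.
rewrite (ET_swap pr1 b0) in s1.
set c' := r * sg R a; set d' := r * sg R b.
set w := `|th i - r| in the *.
have wc : `|c - c'| = w by rewrite -mulrBl normrM norm_bsign mulr1.
have wd : `|d - d'| = w by rewrite -mulrBl normrM norm_bsign mulr1.
have ia := normal_abs R.
have s4 : `|\int[N]_y \int[N]_x f (c * x + d * y) -
    \int[N]_y \int[N]_x f (c' * x + d' * y)| <= K * w * m1 + K * w * m1.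
  have b2 := bl_integral2 c d fb; have b3 := bl_integral2 c' d' fb.
  have bx (u v y : R) : N.-integrable setT (EFin \o (fun x => f (u * x + v * y))).
    have := bl_integrable N (bl_comp_affine (v * y) u fb).
    by under [X in _ \o X]eq_fun do rewrite addrC.
  have hxy y : `|\int[N]_x f (c * x + d * y) - \int[N]_x f (c' * x + d' * y)|
      <= K * w * `|y| + K * w * m1.
    have -> : K * w * `|y| + K * w * m1 = \int[N]_x (K * w * `|y| + K * w * `|x|).
      rewrite RintegralD //; [|exact: RintegrableC|exact: RintegrableZ].
      by rewrite Rintegral_cstT RintegralZl.
    apply: (@Rintegral_dist _ _ _ N) => //.
      by apply: RintegrableD; [exact: RintegrableC|exact: RintegrableZ].
    move=> x; apply: le_trans (fb.2 _ _) _.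
    rewrite [leRHS](_ : _ = K * (w * `|x| + w * `|y|)); last by ring.
    rewrite ler_wpM2l // opprD addrACA -!mulrBl.
    by apply: le_trans (ler_normD _ _) _; rewrite !normrM !norm_bsign !mulr1.
  have -> : K * w * m1 + K * w * m1 = \int[N]_y (K * w * `|y| + K * w * m1).
    rewrite RintegralD //; [|exact: RintegrableZ|exact: RintegrableC].
    by rewrite Rintegral_cstT RintegralZl.
  apply: (@Rintegral_dist _ _ _ N); last exact: hxy.
  - exact: bl_integrable b2.
  - exact: bl_integrable b3.
  - by apply: RintegrableD; [exact: RintegrableZ|exact: RintegrableC].
have s5 : \int[N]_y \int[N]_x f (c' * x + d' * y) = \int[N]_x f x.
  rewrite -(normal_stable fb); transitivity (\int[N]_y \int[N]_x f (c' * x + r * y)).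
    rewrite /d'; case: (b); rewrite /sg ?mulr1 // mulrN1.
    rewrite -[RHS](normal_sym (bl_integral2 c' r fb)).
    by apply: eq_Rintegral => y _; apply: eq_Rintegral => x _; rewrite mulNr mulrN.
  apply: eq_Rintegral => y _; rewrite /c'; case: (a); rewrite /sg ?mulr1 // mulrN1.
  have := normal_sym (bl_comp_affine (r * y) r fb).
  under eq_Rintegral do rewrite addrC mulrN -mulNr.
  by move=> ->; apply: eq_Rintegral => x _; rewrite addrC.
rewrite -s5.
apply: le_trans (ler_distD (\int[N]_x ET (p i) (fun t0 => f (c * Z t0 + d * x))) _ _) _.
apply: (@le_trans _ _ (E' + (E' + (K * w * m1 + K * w * m1)))).
  apply: lerD s1 _.
  apply: le_trans (ler_distD (\int[N]_y \int[N]_x f (c * x + d * y)) _ _) _.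
  exact: lerD.
have wm : w * m1 <= e / 4.
  apply: (@le_trans _ _ (e / (4 * (m1 + 1)) * (m1 + 1))).
    by apply: ler_pM => //; [exact: normr_ge0|rewrite lerDl].
  by rewrite le_eqVlt; apply/orP; left; apply/eqP; field; rewrite gt_eqF // ltr_wpDl.
have t3 : th i ^+ 3 <= 2^-1 * r.
  rewrite exprSr; apply: ler_pM => //; [exact: sqr_ge0|exact: ltW|exact: ltW].
have CL : 0 <= C * r ^+ m * L by rewrite !mulr_ge0 // exprn_ge0 // ltW.
have h1 : C * r ^+ m * (L * th i ^+ 3) <= C * r ^+ m * L * (2^-1 * r).
  by rewrite mulrA ler_wpM2l.
have h2 : K * (w * m1) <= K * (e / 4) by rewrite ler_wpM2l.
have eK2 : 0 <= e * K2 by rewrite mulr_ge0 // ltW.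
rewrite /E' -(mulrA K) (exprSr r m); move: h1 h2 eK2.
set A := C * r ^+ m * (L * _); have -> : C * (r ^+ m * r) * L = C * r ^+ m * L * r by ring.
by set B := C * r ^+ m * L; set D := w * m1; lra.
Unshelve. all: by end_near. Qed.

(** Lipschitz test functions, by smoothing. *)
Let clt_lip (e : R) : 0 < e -> \forall i \near F, \forall k \near \oo,
  forall M L f, bl M L f ->
  `|ET (p i) (fun t : tree k => f (ka i * Y (th i) t)) - \int[N]_x f x| <= e * L.
Proof.
(* The width [dl] makes the smoothing error [10 * dl * L], which occurs twice, at
   most [e / 6 * L]; the depth [m] then beats the third derivative of the smoothed
   function, of order [L / dl ^+ 2]. *)
move=> e0; pose dl : R := e / 60; have dl0 : 0 < dl by rewrite divr_gt0.
have dl2 : 0 < dl ^+ 2 by rewrite exprn_gt0.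
have [m rm] : exists m, C * r ^+ m * (4 / dl ^+ 2) <= e / 3.
  have c0 : C * r ^+ m * (4 / dl ^+ 2) @[m --> \oo] --> C * 0 * (4 / dl ^+ 2).
    apply: cvgMl; apply: cvgMr; apply: cvg_expr.
    by rewrite ger0_norm // ltW.
  rewrite mulr0 mul0r in c0.
  have e3 : 0 < e / 3 by rewrite divr_gt0.
  have : \forall m \near \oo, `|0 - C * r ^+ m * (4 / dl ^+ 2)| <= e / 3.
    exact: cvgr_dist_le.
  move=> [m _ hm]; exists m.
  have := hm m (leqnn m); rewrite /= sub0r normrN; exact: le_trans (ler_norm _).
pose e' := e / 3 / (6 + 2 / dl).
have q0 : 0 < 6 + 2 / dl by rewrite addr_gt0 // divr_gt0.
have e'0 : 0 < e' by rewrite !divr_gt0.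
near=> i.
have : \forall k \near \oo, forall M L K K2 f, smooth3 M L K K2 f ->
  `|ET (p i) (fun t : tree (m + k) => f (ka i * Y (th i) t)) - \int[N]_x f x|
  <= C * r ^+ m * L + e' * (K + K2) by near: i; exact: clt_smooth.
have [t1 tp] : 2^-1 <= th i /\ th i * p i = 2^-1.
  by near: i; apply: filterS range => i [].
have pr1 := p_range t1 tp.
move=> [k0 _ hk]; exists (m + k0)%N => // k /= mk M L f fb.
have mk' : (m <= k)%N := leq_trans (leq_addr _ _) mk.
have k0k : (k0 <= k - m)%N by rewrite leq_subRL.
have km := subnKC mk'.
have := hk _ k0k; rewrite /= km => {}hk.
have L0 := ge0_lip fb.2.
have [g gs fg] := smoothing fb dl0; have [gb _] := gs.
have h1 := hk _ _ _ _ _ gs.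
have h2 : `|\int[N]_x f x - \int[N]_x g x| <= 10 * dl * L.
  apply: (@Rintegral_dist_cst _ _ _ N _ _ M (M + 10 * dl * L)) => //.
  - exact: bl_measurable fb.
  - exact: fb.1.
  - exact: bl_measurable gb.
  - exact: gb.1.
have h3 : `|ET (p i) (fun t : tree k => f (ka i * Y (th i) t)) -
  ET (p i) (fun t : tree k => g (ka i * Y (th i) t))| <= 10 * dl * L.
  by apply: ET_dist => // t.
have h4 : C * r ^+ m * (4 * L / dl ^+ 2) <= e / 3 * L.
  have -> : C * r ^+ m * (4 * L / dl ^+ 2) = C * r ^+ m * (4 / dl ^+ 2) * L.
    by field; rewrite gt_eqF.
  by rewrite ler_wpM2r.
have h5 : e' * (6 * L + 2 * L / dl) = e / 3 * L.
  by rewrite /e'; field; rewrite !gt_eqF //; rewrite addr_gt0 ?mulr_gt0.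
have h6 : 10 * dl * L = e / 6 * L by rewrite /dl; field.
rewrite h5 in h1; rewrite h6 in h2 h3.
move: h1 h2 h3; rewrite !ler_norml => /andP[a1 a2] /andP[b1 b2] /andP[c1 c2].
by apply/andP; split; lra.
Unshelve. all: by end_near. Qed.

(** The law of the increments at level [n] is close to the law of [2^n]
    independent centred normal variables of variance [2^-n]: the first two
    signs only change signs in the arguments of the test function, and the two
    halves of the increments are replaced one after the other. *)
Lemma lev_clt n (e : R) : 0 < e -> \forall i \near F, \forall k \near \oo,
  forall M L psi, sbl M L psi ->
  `|ET (p i) (fun t : tree k => psi (lev (ka i) (th i) n t)) -
    IT N (2 ^ n) (fun s => psi (map ( *%R (r ^+ n)) s))| <= e * L.
Proof.
elim: n e => [|n IH] e e0.
  apply: filterS (clt_lip e0) => i; apply: filterS => k h M L psi psiL.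
  have fb : bl M L (fun x => psi [:: x]).
    by case: psiL => pM pL; split=> // x y; exact: (pL [::] [::]).
  have -> : ET (p i) (fun t : tree k => psi (lev (ka i) (th i) 0 t)) =
      ET (p i) (fun t : tree k => psi [:: ka i * Y (th i) t]).
    by apply: eq_ET => t; case: k t {h} => [|k] t.
  have -> : IT N (2 ^ 0) (fun s => psi (map ( *%R (r ^+ 0)) s)) = \int[N]_x psi [:: x].
    by rewrite expn0 /= expr0; apply: eq_Rintegral => x _; rewrite mul1r.
  exact: h fb.
have e4 : 0 < e / 4 by rewrite divr_gt0.
pose em := e / 2 / ((2 ^ n.+1)%:R * (m1 + 1)).
have em0 : 0 < em.
  by rewrite !divr_gt0 // mulr_gt0 ?ltr0n ?expn_gt0 // ltr_wpDl.
have {}IH := IH _ e4; have th_e := near_small th_cvg em0.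
near=> i.
have [t1 t2 tp] : [/\ 2^-1 <= th i, th i ^+ 2 < 2^-1 & th i * p i = 2^-1].
  by near: i; apply: filterS range => i [].
have /andP[tg tr] := th_facts t1 t2.
have pr1 := p_range t1 tp.
have the : `|th i - r| <= em by near: i.
have : \forall k \near \oo, forall M L psi, sbl M L psi ->
  `|ET (p i) (fun t : tree k => psi (lev (ka i) (th i) n t)) -
    IT N (2 ^ n) (fun s => psi (map ( *%R (r ^+ n)) s))| <= e / 4 * L by near: i.
move=> [k0 _ hk]; exists k0.+1 => // -[//|k] /= kk M L psi psiL.
have {}hk := hk k kk; have L0 := sbl_ge0 psiL.
rewrite ETS; apply: sum_pr_dist => // a b /=.
set c := th i * sg R a; set d := th i * sg R b; set rho := r ^+ n.
have nc : `|c| <= 1.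
  by rewrite normrM norm_bsign mulr1 gtr0_norm // (le_trans tr) // ltW.
have nd : `|d| <= 1.
  by rewrite normrM norm_bsign mulr1 gtr0_norm // (le_trans tr) // ltW.
pose lv (t : tree k) := lev (ka i) (th i) n t.
have pd x : sbl M (L * `|d|) (fun y => psi (map ( *%R c) x ++ map ( *%R d) y)).
  exact: sbl_map d (sbl_cat (map ( *%R c) x) psiL).
pose chi x := IT N (2 ^ n) (fun y => psi (map ( *%R c) x ++ map ( *%R d) (map ( *%R rho) y))).
have pd' x : sbl M (L * `|d| * `|rho|)
    (fun y => psi (map ( *%R c) x ++ map ( *%R d) (map ( *%R rho) y))).
  exact: sbl_map rho (pd x).
have s1 : `|ET (p i) (fun t0 => ET (p i) (fun t1 => psi (map ( *%R c) (lv t0) ++ map ( *%R d) (lv t1))))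
    - ET (p i) (fun t0 => chi (lv t0))| <= e / 4 * L.
  apply: ET_dist => // t0; apply: le_trans (hk _ _ _ (pd _)) _.
  by rewrite ler_wpM2l ?(ltW e4) // ler_piMr.
have chiL : sbl M (L * `|c|) chi.
  split=> [x|s1' s2 x y]; first exact: IT_bound (pd' x).
  apply: IT_dist (pd' _) (pd' _) _ => s.
  have [_ hp] := psiL; rewrite !map_cat /= -!catA /=; apply: le_trans (hp _ _ _ _) _.
  by rewrite -mulrBr normrM mulrA.
have s2 : `|ET (p i) (fun t0 => chi (lv t0)) -
    IT N (2 ^ n) (fun x => chi (map ( *%R rho) x))| <= e / 4 * L.
  by apply: le_trans (hk _ _ _ chiL) _; rewrite ler_wpM2l ?(ltW e4) // ler_piMr.
have s3 : IT N (2 ^ n) (fun x => chi (map ( *%R rho) x)) =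
    IT N (2 ^ n.+1) (fun s => psi (map ( *%R (th i * rho)) s)).
  have mm (u v : R) (s : seq R) : map ( *%R u) (map ( *%R v) s) = map ( *%R (v * u)) s.
    by rewrite -map_comp; apply: eq_map => x /=; rewrite mulrA (mulrC u).
  have mg (a' : bool) : rho * (th i * sg R a') = th i * rho * sg R a' by ring.
  transitivity (IT N (2 ^ n) (fun x => IT N (2 ^ n) (fun y =>
      psi (map ( *%R (th i * rho * sg R a)) x ++ map ( *%R (th i * rho)) y)))).
    apply: eq_IT => x _; rewrite /chi mm mg.
    rewrite -(IT_sg (2 ^ n) b (th i * rho)
      (sbl_cat (map ( *%R (th i * rho * sg R a)) x) psiL)).
    by apply: eq_IT => y _; rewrite mm mg.
  have xiL : sbl M L (fun x => IT N (2 ^ n) (fun y =>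
      psi (x ++ map ( *%R (th i * rho)) y))).
    have px x : sbl M (L * `|th i * rho|) (fun y => psi (x ++ map ( *%R (th i * rho)) y)).
      exact: sbl_map (sbl_cat x psiL).
    split=> [x|s1' s2' x y]; first exact: IT_bound (px x).
    apply: IT_dist (px _) (px _) _ => s.
    by have [_ hp] := psiL; rewrite -!catA /=; exact: hp.
  rewrite (IT_sg (2 ^ n) a (th i * rho) xiL).
  rewrite expnS mul2n -addnn IT_add; apply: eq_IT => x _; apply: eq_IT => y _.
  by rewrite map_cat.
have s4 : `|IT N (2 ^ n.+1) (fun s => psi (map ( *%R (th i * rho)) s)) -
    IT N (2 ^ n.+1) (fun s => psi (map ( *%R (r ^+ n.+1)) s))| <= e / 2 * L.
  apply: le_trans (IT_map_dist (2 ^ n.+1) _ _ psiL) _.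
  rewrite (exprS r n) -/rho -mulrBl normrM.
  rewrite [leLHS](_ : _ = `|th i - r| * (`|rho| * ((2 ^ n.+1)%:R * m1)) * L);
    last by ring.
  rewrite ler_wpM2r //.
  have rho1 : `|rho| <= 1.
    by rewrite normrX (gtr0_norm r_gt0) exprn_ile1 ?(ltW r_gt0) ?(ltW r_lt1).
  apply: (@le_trans _ _ (em * ((2 ^ n.+1)%:R * (m1 + 1)))).
    apply: ler_pM => //; first by rewrite !mulr_ge0.
    rewrite -[leRHS]mul1r; apply: ler_pM => //; first by rewrite mulr_ge0.
    by rewrite ler_wpM2l // lerDl.
  rewrite /em divfK // gt_eqF // mulr_gt0 ?ltr0n ?expn_gt0 //.
  by rewrite ltr_wpDl.
apply: le_trans (ler_distD (ET (p i) (fun t0 => chi (lv t0))) _ _) _.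
apply: (@le_trans _ _ (e / 4 * L + (e / 4 * L + e / 2 * L))); last by lra.
apply: lerD s1 _; apply: le_trans (ler_distD (IT N (2 ^ n) (fun x => chi (map ( *%R rho) x))) _ _) _.
by apply: lerD s2 _; rewrite s3.
Unshelve. all: by end_near. Qed.

End CLT.

(** * Piecewise linear paths *)

Section Interpolation.
Variable R : realType.
Implicit Types (s t : R) (x y : seq R).

Definition clamp s : R := Num.min 1 (Num.max 0 s).

(** The broken line that starts at 0 and has increment [x_i] over [[i, i + 1]]. *)
Fixpoint ip x s : R := if x is a :: x' then a * clamp s + ip x' (s - 1) else 0.

Lemma clamp_le0 s : s <= 0 -> clamp s = 0.
Proof. by move=> s0; rewrite /clamp (max_idPl s0) (min_idPr ler01). Qed.

Lemma clamp_ge1 s : 1 <= s -> clamp s = 1.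
Proof.
by move=> s1; rewrite /clamp (max_idPr (le_trans ler01 s1)) (min_idPl s1).
Qed.

Lemma clamp_id s : 0 <= s <= 1 -> clamp s = s.
Proof. by case/andP=> s0 s1; rewrite /clamp (max_idPr s0) (min_idPr s1). Qed.

Lemma clamp_range s : 0 <= clamp s <= 1.
Proof.
have [s0|s0] := leP s 0; first by rewrite clamp_le0 // lexx ler01.
have [s1|s1] := leP 1 s; first by rewrite clamp_ge1 // lexx ler01.
by rewrite clamp_id !ltW.
Qed.

Lemma clamp_dist s t : `|clamp s - clamp t| <= `|s - t|.
Proof.
wlog st : s t / s <= t => [h|].
  by have [|/ltW] := leP s t => /h //; rewrite distrC [leRHS]distrC.
rewrite [leRHS]distrC [leRHS]ger0_norm ?subr_ge0 // distrC.
have [s0|s0] := leP s 0.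
  have /andP[h1 h2] := clamp_range t; rewrite (clamp_le0 s0) subr0 ger0_norm //.
  have [t0|t0] := leP t 0; first by rewrite clamp_le0 // subr_ge0.
  have [t1|t1] := leP 1 t; first by rewrite clamp_ge1 //; lra.
  by rewrite clamp_id; lra.
have [s1|s1] := leP 1 s.
  by rewrite !clamp_ge1 ?(le_trans s1) // subrr normr0 subr_ge0.
rewrite (@clamp_id s) ?(ltW s0) ?(ltW s1) //.
have [t1|t1] := leP 1 t; first by rewrite clamp_ge1 // ger0_norm; lra.
by rewrite clamp_id ?ger0_norm; lra.
Qed.

Lemma clamp_double s : clamp s = (clamp (2 * s) + clamp (2 * s - 1)) / 2.
Proof.
have [s0|s0] := leP s 0; first by rewrite !clamp_le0; lra.
have [s1|s1] := leP 1 s; first by rewrite !clamp_ge1; lra.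
have [h|h] := leP s 2^-1.
  by rewrite [clamp (2 * s - 1)]clamp_le0 ?clamp_id; lra.
by rewrite [clamp (2 * s)]clamp_ge1 ?clamp_id; lra.
Qed.

Lemma ip_le0 x s : s <= 0 -> ip x s = 0.
Proof.
elim: x s => [|a x IH] s s0 //=; rewrite clamp_le0 // mulr0 add0r IH //.
by rewrite subr_le0 (le_trans s0).
Qed.

Lemma ip_map c x s : ip (map ( *%R c) x) s = c * ip x s.
Proof.
by elim: x s => [|a x IH] s /=; rewrite ?mulr0 // IH mulrDr mulrA.
Qed.

Lemma ip_sum x s : ip x s = \sum_(i < size x) x`_i * clamp (s - i%:R).
Proof.
elim: x s => [|a x IH] s /=; first by rewrite big_ord0.
rewrite big_ord_recl /= subr0 IH; congr (_ + _); apply: eq_bigr => i _.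
by rewrite /bump /= add1n -natr1 opprD addrA addrAC.
Qed.

(** Because of this estimate, Lipschitz functionals of a broken line are Lipschitz
    in each of its increments. *)
Lemma ip_slip x y a b s :
  `|ip (x ++ a :: y) s - ip (x ++ b :: y) s| <= `|a - b|.
Proof.
elim: x s => [|c x IH] s /=.
  rewrite opprD addrACA subrr addr0 -mulrBl normrM ler_piMr //.
  by have /andP[h1 h2] := clamp_range s; rewrite ger0_norm.
by rewrite opprD addrACA subrr add0r.
Qed.

Lemma clamp_continuous : continuous clamp.
Proof.
move=> s; apply: (@continuous_min _ _ (cst 1) (fun s => Num.max 0 s)).
  exact: cst_continuous.
apply: (@continuous_max _ _ (cst 0) id); first exact: cst_continuous.
exact: cvg_id.
Qed.

Lemma ip_continuous x : continuous (ip x).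
Proof.
elim: x => [|a x IH] s /=; first exact: cst_continuous.
apply: cvgD; first by apply: cvgMr; exact: clamp_continuous.
apply: (@continuous_comp _ _ _ (fun s => s - 1) (ip x)); last exact: IH.
by apply: cvgB; [exact: cvg_id|exact: cvg_cst].
Qed.

Fixpoint pairsum x : seq R := if x is a :: b :: x' then a + b :: pairsum x' else [::].

Lemma pairsum_cat x y : ~~ odd (size x) -> pairsum (x ++ y) = pairsum x ++ pairsum y.
Proof.
have [n] := ubnP (size x); elim: n x => // n IH [|a [|b x]] //= nx ox.
rewrite IH //; first by move: nx; rewrite ltnS => /ltnW.
by move: ox; rewrite !negbK.
Qed.

Lemma pairsum_map c x : pairsum (map ( *%R c) x) = map ( *%R c) (pairsum x).
Proof.
have [n] := ubnP (size x); elim: n x => // n IH [|a [|b x]] //= nx.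
by rewrite IH ?mulrDr //; move: nx; rewrite ltnS => /ltnW.
Qed.

(** The difference of two consecutive interpolations of a path is, on each coarse
    interval, half the difference of two fine increments times a tent function;
    on different intervals these have disjoint supports. *)
Lemma ip_refine x s e : 0 <= e -> ~~ odd (size x) -> {in x, forall a, `|a| <= e} ->
  `|ip x (2 * s) - ip (pairsum x) s| <= e.
Proof.
move=> e0; have [n] := ubnP (size x).
elim: n x s => // n IH [|a [|b x]] s //= nx ox xe; first by rewrite subrr normr0.
have ae : `|a| <= e by apply: xe; rewrite inE eqxx.
have be : `|b| <= e by apply: xe; rewrite !inE eqxx orbT.
have [s1|s1] := leP 1 s.
  rewrite !clamp_ge1 //; [|lra|lra].
  rewrite [X in `|X|](_ : _ = ip x (2 * (s - 1)) - ip (pairsum x) (s - 1)).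
    apply: IH; first by move: nx; rewrite ltnS => /ltnW.
      by move: ox; rewrite !negbK.
    by move=> c cx; apply: xe; rewrite !inE cx !orbT.
  rewrite (_ : 2 * (s - 1) = 2 * s - 1 - 1); last by ring.
  by ring.
rewrite (ip_le0 x) ?(ip_le0 (pairsum x)); [|lra|lra].
rewrite !addr0 (clamp_double s).
set u := clamp (2 * s); set v := clamp (2 * s - 1).
have uv : 0 <= u - v <= 1.
  have [s0|s0] := leP s 0; first by rewrite /u /v !clamp_le0; lra.
  have [h|h] := leP s 2^-1.
    by rewrite /u /v [clamp (2 * s - 1)]clamp_le0 ?clamp_id; lra.
  by rewrite /u /v [clamp (2 * s)]clamp_ge1 ?clamp_id; lra.
rewrite [X in `|X|](_ : _ = (a - b) / 2 * (u - v)); last by field.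
case/andP: uv => uv0 uv1.
rewrite normrM (ger0_norm uv0); apply: (@le_trans _ _ (e * 1)); last by rewrite mulr1.
apply: ler_pM => //.
rewrite normrM (ger0_norm (_ : 0 <= 2^-1)) ?invr_ge0 // ler_pdivrMr //.
by apply: le_trans (ler_normB _ _) _; rewrite mulr_natr mulr2n lerD.
Qed.

(** A broken line takes, between two integers, values between those that it has
    at these integers. *)
Lemma ip_increments (u : nat -> R) m s v e : 0 <= s <= m%:R ->
  (forall i, `|s - i%:R| <= 1 -> `|u i - v| <= e) ->
  `|ip (mkseq (fun i => u i.+1 - u i) m) s - (v - u 0%N)| <= e.
Proof.
elim: m u s => [|m IH] u s /andP[s0 sm] h.
  have -> : s = 0 by apply: le_anti; rewrite s0 sm.
  rewrite /= sub0r opprB; apply: h; move: s0 sm => /= s0 sm.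
  by rewrite subr0 ger0_norm // (le_trans sm).
have mkS (c : nat -> R) : mkseq c m.+1 = c 0%N :: mkseq (fun i => c i.+1) m.
  by rewrite /mkseq /= (iotaDl 1 0) -map_comp.
rewrite mkS /=; have [s1|s1] := leP 1 s.
  rewrite clamp_ge1 // mulr1.
  have := IH (fun i => u i.+1) (s - 1).
  rewrite subr_ge0 s1 lerBlDr natr1 sm => /(_ isT) h'.
  rewrite [X in `|X|](_ : _ = ip (mkseq (fun i => u i.+2 - u i.+1) m) (s - 1) - (v - u 1%N)).
    apply: h' => i hi; apply: h; move: hi.
    by rewrite -natr1 opprD addrA addrAC.
  by ring.
rewrite ip_le0 ?subr_le0 ?(ltW s1) // addr0 clamp_id ?s0 ?(ltW s1) //.
have h0 : `|u 0%N - v| <= e by apply: h; rewrite subr0 ger0_norm // ltW.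
have h1 : `|u 1%N - v| <= e.
  by apply: h; rewrite ler_norml; apply/andP; split; lra.
rewrite [X in `|X|](_ : _ = s * (u 1%N - v) + (1 - s) * (u 0%N - v)); last by ring.
apply: le_trans (ler_normD _ _) _; rewrite !normrM (ger0_norm s0).
rewrite (ger0_norm (_ : 0 <= 1 - s)); last by rewrite subr_ge0 ltW.
apply: (@le_trans _ _ (s * e + (1 - s) * e)); last by rewrite -mulrDl subrKC mul1r.
by apply: lerD; rewrite ler_wpM2l // subr_ge0 ltW.
Qed.

End Interpolation.

(** * The increments at successive dyadic levels *)

Section Levels.
Variables (R : realType) (ka th : R).

Lemma size_lev n N (t : tree N) : (n <= N)%N -> size (lev ka th n t) = (2 ^ n)%N.
Proof.
elim: n N t => [|n IH] N t nN; first by case: N t nN.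
case: N t nN => [//|N] t nN /=.
by rewrite size_cat !size_map !IH // addnn -mul2n expnS.
Qed.

(** The recursion defining [Y]: an increment is the sum of those over the two
    halves of its interval. *)
Lemma pairsum_lev n N (t : tree N) : (n < N)%N ->
  pairsum (lev ka th n.+1 t) = lev ka th n t.
Proof.
elim: n N t => [|n IH] [//|N] t nN.
  have l0 (t' : tree N) : lev ka th 0 t' = [:: ka * Y th t'] by case: N {t nN} t'.
  have E : lev ka th 1 t = map ( *%R (th * sg R t.1.1)) (lev ka th 0 t.1.2) ++
    map ( *%R (th * sg R t.2.1)) (lev ka th 0 t.2.2) by [].
  by rewrite E !l0; congr [:: _]; rewrite /=; ring.
have E : lev ka th n.+2 t = map ( *%R (th * sg R t.1.1)) (lev ka th n.+1 t.1.2) ++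
  map ( *%R (th * sg R t.2.1)) (lev ka th n.+1 t.2.2) by [].
rewrite E pairsum_cat ?pairsum_map; last first.
  by rewrite size_map size_lev // expnS mul2n odd_double.
by rewrite !IH.
Qed.

(** The distance between the interpolations of levels [n] and [N]: at each level,
    the largest increment is at most [q ^+ j] plus the sum of the fourth powers of
    the increments divided by [q ^+ (3 * j)]. *)
Definition gap (q : R) n N (t : tree N) : R :=
  \sum_(n <= j < N) (q ^+ j + (\sum_(a <- lev ka th j.+1 t) a ^+ 4) / q ^+ (3 * j)).

Lemma ip_gap q n N (t : tree N) s : 0 < q -> (n <= N)%N ->
  `|ip (lev ka th N t) ((2 ^ N)%:R * s) - ip (lev ka th n t) ((2 ^ n)%:R * s)|
  <= gap q n t.
Proof.
move=> q0 nN; have [m mN] : {m | (N = n + m)%N} by exists (N - n)%N; rewrite subnKC.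
rewrite /gap.
have H k : (n + k <= N)%N ->
  `|ip (lev ka th (n + k) t) ((2 ^ (n + k))%:R * s) - ip (lev ka th n t) ((2 ^ n)%:R * s)|
  <= \sum_(n <= j < n + k) (q ^+ j + (\sum_(a <- lev ka th j.+1 t) a ^+ 4) / q ^+ (3 * j)).
  elim: k => [|k IH] kN; first by rewrite addn0 subrr normr0 big_geq.
  rewrite addnS big_nat_recr ?leq_addr //=.
  apply: le_trans (ler_distD (ip (lev ka th (n + k) t) ((2 ^ (n + k))%:R * s)) _ _) _.
  rewrite [leRHS]addrC; apply: lerD; last by apply: IH; apply: leq_trans kN; rewrite addnS.
  rewrite addnS in kN; set j := (n + k)%N in kN *.
  rewrite -(pairsum_lev t kN) expnS natrM -mulrA.
  set x := lev ka th j.+1 t.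
  have sx : size x = (2 ^ j.+1)%N by exact: size_lev.
  have qj : 0 < q ^+ j by rewrite exprn_gt0.
  have q3 : 0 < q ^+ (3 * j) by rewrite exprn_gt0.
  have p4 (a : R) : 0 <= a ^+ 4 by rewrite (exprM a 2 2) sqr_ge0.
  have S0 (y : seq R) : 0 <= \sum_(a <- y) a ^+ 4 by apply: sumr_ge0.
  apply: ip_refine.
  - by rewrite addr_ge0 ?divr_ge0 ?S0 // ltW.
  - by rewrite sx expnS mul2n odd_double.
  move=> a ax; have [aq|aq] := leP `|a| (q ^+ j).
    by apply: le_trans aq _; rewrite lerDl divr_ge0 ?S0 // ltW.
  apply: (@le_trans _ _ (a ^+ 4 / q ^+ (3 * j))).
    rewrite ler_pdivlMr // mulnC exprM.
    have -> : a ^+ 4 = `|a| * `|a| ^+ 3.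
      by rewrite -exprS -normrX ger0_norm.
    by rewrite ler_wpM2l // ler_pXn2r ?nnegrE ?(ltW qj) // ltW.
  rewrite -[leLHS]add0r lerD ?(ltW qj) // ler_wpM2r ?invr_ge0 ?(ltW q3) //.
  by rewrite (big_rem a ax) /= lerDl S0.
by have := H m; rewrite -mN; apply.
Qed.

Variable p : R.
Hypotheses (th_ge : 2^-1 <= th) (th2 : th ^+ 2 <= 2^-1) (pth : th * p = 2^-1).
Hypotheses (ka_ge0 : 0 <= ka) (ka2 : ka ^+ 2 = 2 - 4 * th ^+ 2).

(** As [q ^+ 4 = 2^-1], the fourth powers of the increments of level [j + 1], whose
    sum is at most [9 * 2^-1 ^+ j.+1] on average, contribute no more than
    [9 * q ^+ j] to the [j]-th term. *)
Lemma ET_gap q n N : 0 < q < 1 -> q ^+ 4 = 2^-1 -> (n <= N)%N ->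
  ET p (fun t : tree N => gap q n t) <= 10 / (1 - q) * q ^+ n.
Proof.
case/andP=> q0 q1 q4 nN; have pr1 := p_range th_ge pth.
have ETsum : ET p (fun t : tree N => gap q n t) = \sum_(n <= j < N)
    ET p (fun t : tree N => q ^+ j + (\sum_(a <- lev ka th j.+1 t) a ^+ 4) / q ^+ (3 * j)).
  by rewrite /ET /gap exchange_big; apply: eq_bigr => t _; rewrite mulr_sumr.
apply: (@le_trans _ _ (\sum_(n <= j < N) 10 * q ^+ j)).
  rewrite ETsum; apply: ler_sum_nat => j /andP[_ jN].
  rewrite ETD ET_cst (_ : 10 * q ^+ j = q ^+ j + 9 * q ^+ j); last by ring.
  rewrite lerD2l; under eq_ET do rewrite mulrC.
  rewrite ETZ mulrC ler_pdivrMr ?exprn_gt0 //.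
  apply: le_trans (ET_lev_pow4 th_ge th2 pth ka_ge0 ka2 jN) _.
  rewrite -mulrA -exprD (_ : (j + 3 * j = 4 * j)%N) ?(exprM q 4 j) ?q4; last by rewrite -mulSn.
  by rewrite ler_wpM2l // exprS ler_piMl ?exprn_ge0 ?invr_ge0 // invf_le1 // ler1n.
rewrite -mulr_sumr -!mulrA ler_wpM2l // mulrC ler_pdivlMr ?subr_gt0 //.
have H : (\sum_(n <= j < N) q ^+ j) * (1 - q) = q ^+ n - q ^+ N.
  elim: N nN {ETsum} => [|N IH] nN; first by move: nN; rewrite leqn0 => /eqP ->; rewrite big_geq // mul0r subrr.
  move: nN; rewrite leq_eqVlt => /predU1P[->|nN]; first by rewrite big_geq // mul0r subrr.
  by rewrite big_nat_recr //= mulrDl IH // exprS; ring.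
by rewrite H gerBl exprn_ge0 // ltW.
Qed.

End Levels.

(** * The tree of signs of a weight family *)

Section SignTree.
Variable R : realType.

Fixpoint sign_tree (e : seq bool -> bool) n : tree n :=
  if n is m.+1 return tree n then
    ((e [:: false], sign_tree (fun w => e (false :: w)) m),
     (e [:: true], sign_tree (fun w => e (true :: w)) m))
  else tt.

(** The root of the tree carries no sign: the empty word is left out. *)
Fixpoint short_words n : seq (seq bool) :=
  if n is m.+1 then
    [:: false] :: [:: true] :: map (cons false) (short_words m) ++ map (cons true) (short_words m)
  else [::].

Fixpoint sign_at n : tree n -> seq bool -> bool :=
  if n is m.+1 return tree n -> seq bool -> bool then fun t w =>
    if w is b :: v then
      let u := if b then t.2 else t.1 in if v is [::] then u.1 else sign_at u.2 v
    else true
  else fun _ _ => true.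

Lemma short_words_nil n : [::] \notin short_words n.
Proof.
elim: n => [//|n IH] /=; rewrite !inE /= mem_cat negb_or.
by apply/andP; split; apply/mapP => -[].
Qed.

Lemma short_words_uniq n : uniq (short_words n).
Proof.
elim: n => [//|n IH] /=.
have c1 b b' : ([:: b] \in map (cons b') (short_words n)) = false.
  by apply/negP => /mapP[w wn [_ w0]]; move: (short_words_nil n); rewrite w0 wn.
rewrite inE /= !mem_cat !c1 /= cat_uniq !map_inj_uniq ?IH //=; last 2 first.
- by move=> u v [].
- by move=> u v [].
by rewrite andbT; apply/hasPn => w /mapP[u _ ->]; apply/mapP => -[].
Qed.

Lemma sign_treeP e n (t : tree n) : sign_tree e n = t <-> {in short_words n, forall w, e w = sign_at t w}.
Proof.
elim: n e t => [|n IH] e t; first by case: t.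
case: t => [[a t0] [b t1]] /=; split.
  move=> [ea /IH e0 eb /IH e1] w; rewrite !inE mem_cat.
  case/or4P => [/eqP -> //|/eqP -> //|/mapP[v vn ->]|/mapP[v vn ->]] /=.
    by rewrite (e0 v vn); case: v vn => //; rewrite (negbTE (short_words_nil n)).
  by rewrite (e1 v vn); case: v vn => //; rewrite (negbTE (short_words_nil n)).
move=> h.
have inl (b' : bool) v : v \in short_words n -> b' :: v \in short_words n.+1.
  by move=> vn; rewrite /= !inE mem_cat; case: b'; rewrite map_f // !orbT.
congr ((_, _), (_, _)).
- by rewrite h // !inE eqxx.
- apply/IH => v vn; have := h _ (inl false v vn).
  by case: v vn => //=; rewrite (negbTE (short_words_nil n)).
- by rewrite h // !inE eqxx orbT.
- apply/IH => v vn; have := h _ (inl true v vn).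
  by case: v vn => //=; rewrite (negbTE (short_words_nil n)).
Qed.

Lemma wt_sign_at (p : R) n (t : tree n) :
  wt p t = \prod_(w <- short_words n) pr p (sign_at t w).
Proof.
elim: n t => [|n IH] t; first by rewrite big_nil.
rewrite /= !big_cons big_cat !big_map /= -mulrA; congr (_ * (_ * _)).
rewrite !IH; congr (_ * _); apply: eq_big_seq => w wn;
  by case: w wn => //; rewrite (negbTE (short_words_nil n)).
Qed.

Section probability_of_a_tree.
Variables (d : measure_display) (T : measurableType d) (P : probability T R).
Variables (H : R) (eps : seq bool -> {RV P >-> R}).
Hypothesis weps : is_weight_family H eps.

Definition signs (om : T) (w : seq bool) : bool := eps w om == 1.

Lemma epsE w om : eps w om = sg R (signs om w).
Proof.
rewrite /signs; have [/(_ w om) [] -> _ _ _] := weps; first by rewrite eqxx.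
by rewrite eqNr oner_eq0.
Qed.

(** The signs in the tree are those of finitely many words, each of which occurs
    once: this is where the independence of the weights applies. *)
Lemma tree_event n (t : tree n) : (fun om => sign_tree (signs om) n) @^-1` [set t] =
  \bigcap_(w in [set` [fset w in short_words n]%fset]) (eps w @^-1` [set sg R (sign_at t w)]).
Proof.
have sgI b b' : sg R b = sg R b' -> b = b'.
  case: b; case: b' => //= /eqP; rewrite /sg.
    by rewrite eq_sym eqNr oner_eq0.
  by rewrite eqNr oner_eq0.
apply/seteqP; split=> om /=.
  by move=> /sign_treeP h w /=; rewrite inE => wn; rewrite epsE (h w wn).
move=> h; apply/sign_treeP => w wn; apply: sgI; rewrite -epsE.
by apply: h; rewrite /= inE.
Qed.

Lemma measurable_tree n (t : tree n) :
  measurable ((fun om => sign_tree (signs om) n) @^-1` [set t]).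
Proof.
by rewrite tree_event; apply: fin_bigcap_measurable.
Qed.

Lemma prob_tree n (t : tree n) :
  P ((fun om => sign_tree (signs om) n) @^-1` [set t]) = (wt (2 `^ (H - 1)) t)%:E.
Proof.
have [_ p1 p2 ind] := weps.
rewrite tree_event ind; last by move=> w _; exact: measurable_set1.
rewrite (perm_big (short_words n)) /=; last first.
  by apply: uniq_perm; rewrite ?fset_uniq ?short_words_uniq // => w; rewrite inE.
rewrite wt_sign_at -prodEFin; apply: eq_bigr => w _.
rewrite /sg /pr; case: (sign_at t w); rewrite ?p1 ?p2; congr EFin; rewrite /sg; ring.
Qed.

Lemma expect_tree n (F : tree n -> R) :
  \int[P]_om F (sign_tree (signs om) n) = ET (2 `^ (H - 1)) F.
Proof.
rewrite (fin_expect P (@measurable_tree n)) /ET; apply: eq_bigr => t _.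
by rewrite prob_tree mulrC.
Qed.

End probability_of_a_tree.

(** * The approximations as broken lines *)

Fixpoint words n : seq (seq bool) :=
  if n is m.+1 then map (cons false) (words m) ++ map (cons true) (words m)
  else [:: [::]].

(** The product of the signs of the nonempty prefixes of a word. *)
Fixpoint leafval (e : seq bool -> bool) (w : seq bool) : R :=
  if w is b :: v then sg R (e [:: b]) * leafval (fun u => e (b :: u)) v else 1.

Lemma size_words n : size (words n) = (2 ^ n)%N.
Proof.
by elim: n => [//|n IH] /=; rewrite size_cat !size_map IH addnn -mul2n expnS.
Qed.

(** At the deepest level only one leaf is left below each interval. *)
Lemma lev_full ka th n e :
  lev ka th n (sign_tree e n) = [seq ka * th ^+ n * leafval e w | w <- words n].
Proof.
elim: n e => [|n IH] e; first by rewrite /= expr0 !mulr1.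
rewrite /= !IH map_cat -!map_comp; congr (_ ++ _);
  by apply: eq_map => w /=; rewrite exprS; ring.
Qed.

Lemma leafval_prod e w :
  leafval e w = \prod_(1 <= k < (size w).+1) sg R (e (take k w)).
Proof.
elim: w e => [|b w IH] e; first by rewrite big_geq.
by rewrite /= big_ltn // big_add1 /= take0 IH.
Qed.

(** The number with the binary digits [w]. *)
Fixpoint bval (w : seq bool) : nat :=
  if w is b :: v then (b * 2 ^ size v + bval v)%N else 0.

Lemma bval_rcons w b : bval (rcons w b) = ((bval w).*2 + b)%N.
Proof.
elim: w => [|a w IH] /=; first by rewrite expn0 muln1 addn0.
by rewrite IH size_rcons expnS mulnCA mul2n doubleD addnA.
Qed.

Lemma bval_lt w : (bval w < 2 ^ size w)%N.
Proof.
elim: w => [//|b w IH] /=; rewrite expnS mul2n -addnn.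
case: b; rewrite ?mul1n ?mul0n ?ltn_add2l //; exact: ltn_addl.
Qed.

Lemma nth_words w : nth [::] (words (size w)) (bval w) = w.
Proof.
elim: w => [//|b w IH] /=; rewrite nth_cat size_map size_words.
case: b; rewrite ?mul1n ?mul0n.
  by rewrite ltnNge leq_addr /= addKn (nth_map [::]) ?IH // size_words bval_lt.
by rewrite ?add0n bval_lt (nth_map [::]) ?IH // size_words bval_lt.
Qed.

Lemma truncn_half (x : R) : 0 <= x -> (Num.truncn (2 * x))./2 = Num.truncn x.
Proof.
move=> x0; set k := Num.truncn x; set n := Num.truncn (2 * x).
have x20 : 0 <= 2 * x by rewrite mulr_ge0.
have /andP[k1 k2] := truncn_itv x0.
have h1 : (k.*2 <= n)%N.
  by rewrite truncn_ge_nat // -mul2n natrM ler_wpM2l.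
have h2 : (n < k.+1.*2)%N.
  by rewrite truncn_lt_nat // -mul2n natrM ltr_pM2l.
apply/eqP; rewrite eqn_leq; apply/andP; split.
  by rewrite -ltnS -ltn_double (leq_ltn_trans _ h2) // -[leqRHS]odd_double_half leq_addl.
by rewrite -[k]doubleK half_leq.
Qed.

Lemma bval_bword (u : R) n : 0 <= u < 1 -> bval (bword u n) = Num.truncn (2 ^+ n * u).
Proof.
case/andP=> u0 u1; elim: n => [|n IH].
  by rewrite expr0 mul1r; apply/esym/eqP; rewrite -leqn0 real_truncn_le_nat ?num_real.
have -> : bword u n.+1 = rcons (bword u n) (bdigit u n.+1).
  by rewrite /bword -{1}[n.+1]addn1 iotaD map_cat /= cats1 add1n.
rewrite bval_rcons IH /bdigit exprS -mulrA -(truncn_half (x := 2 ^+ n * u)).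
  by rewrite addnC odd_double_half.
by rewrite mulr_ge0 // exprn_ge0.
Qed.

Lemma bword_take (u : R) k n : (k <= n)%N -> take k (bword u n) = bword u k.
Proof.
by move=> kn; rewrite /bword -map_take take_iota (minn_idPl kn).
Qed.

(** The first [n] digits of [u], read as a number, are the integer part of
    [2 ^+ n * u], and [words n] lists the words in the order of these numbers. *)
Lemma leafval_bword e (u : R) n : 0 <= u < 1 ->
  \prod_(1 <= k < n.+1) sg R (e (bword u k)) =
  nth 0 [seq leafval e w | w <- words n] (Num.truncn (2 ^+ n * u)).
Proof.
move=> u01; have su : size (bword u n) = n by rewrite size_map size_iota.
have bn : (bval (bword u n) < 2 ^ n)%N by rewrite -{2}su bval_lt.
rewrite -(bval_bword n u01) (nth_map [::]) ?size_words //.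
have -> : nth [::] (words n) (bval (bword u n)) = bword u n.
  by rewrite -{1}su nth_words.
rewrite leafval_prod su !big_nat; apply: eq_bigr => k /andP[_ kn].
by rewrite bword_take.
Qed.

Local Notation leb := (@lebesgue_measure R).

(** The part of the [i]-th interval below [t] grows linearly while [t] crosses this
    interval, as the [i]-th term of a broken line does. *)
Lemma clamp_measure (M : nat) (i : nat) (t : R) : (0 < M)%N -> 0 <= t ->
  fine (leb (`[i%:R / M%:R, i.+1%:R / M%:R[%classic `&` `[0, t]%classic)) =
  clamp (M%:R * t - i%:R) / M%:R.
Proof.
move=> M0 t0; have M0' : 0 < M%:R :> R by rewrite ltr0n.
have iM : 0 <= i%:R / M%:R :> R by rewrite divr_ge0.
have lt_i : i%:R / M%:R < i.+1%:R / M%:R :> R by rewrite ltr_pM2r ?invr_gt0 // ltr_nat.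
have [ti|ti] := ltP t (i%:R / M%:R).
  have -> : `[i%:R / M%:R, i.+1%:R / M%:R[%classic `&` `[0, t]%classic = set0 :> set R.
    apply/seteqP; split=> x //=; rewrite !in_itv /= => -[/andP[h1 _] /andP[_ h2]].
    by move: (le_lt_trans h2 ti); rewrite ltNge h1.
  rewrite measure0 clamp_le0 ?mul0r //.
  by rewrite subr_le0 mulrC -ler_pdivlMr // ltW.
have [t1|t1] := leP (i.+1%:R / M%:R) t.
  have -> : `[i%:R / M%:R, i.+1%:R / M%:R[%classic `&` `[0, t]%classic =
      `[i%:R / M%:R, i.+1%:R / M%:R[%classic :> set R.
    apply/seteqP; split=> x /=; rewrite !in_itv /=; first by case.
    move=> /andP[h1 h2]; rewrite h1 h2 (le_trans iM h1) /=; split=> //.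
    by rewrite (le_trans (ltW h2)).
  rewrite lebesgue_measure_itv /= lte_fin lt_i -EFinD /=.
  rewrite clamp_ge1; first by rewrite -mulrBl -natr1 addrAC subrr add0r.
  by rewrite lerBrDl natr1 mulrC -ler_pdivrMr.
have -> : `[i%:R / M%:R, i.+1%:R / M%:R[%classic `&` `[0, t]%classic =
    `[i%:R / M%:R, t]%classic :> set R.
  apply/seteqP; split=> x /=; rewrite !in_itv /=.
    by move=> [/andP[-> _] /andP[_ ->]].
  move=> /andP[h1 h2]; rewrite h1 h2 (le_trans iM h1) /=; split=> //.
  exact: le_lt_trans t1.
rewrite lebesgue_measure_itv /= lte_fin clamp_id; last first.
  rewrite subr_ge0 mulrC -ler_pdivrMr // ti /= lerBlDl natr1 -ler_pdivlMr //.
  exact: ltW.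
rewrite mulrBl mulrAC mulfV ?mul1r ?gt_eqF //.
move: ti; rewrite le_eqVlt => /predU1P[->|ti]; first by rewrite ltxx subrr.
by rewrite ti -EFinD.
Qed.

(** The values at [u = 1], where the digits of [u] are not those of a number
    below [1], do not contribute to the integral. *)
Lemma step_integral (L : seq R) (M : nat) (f : R -> R) (t : R) :
  size L = M -> (0 < M)%N ->
  (forall u, 0 <= u < 1 -> f u = nth 0 L (Num.truncn (M%:R * u))) ->
  0 <= t <= 1 ->
  M%:R * \int[leb]_(u in `[0, t]) f u = ip L (M%:R * t).
Proof.
move=> sL M0 fE /andP[t0 t1]; have M0' : 0 < M%:R :> R by rewrite ltr0n.
pose I (i : nat) : set R := `[i%:R / M%:R, i.+1%:R / M%:R[%classic.
have mI i : measurable (I i) by exact: measurable_itv.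
have mD s : measurable (`[0, s]%classic : set (measurableTypeR R)) by exact: measurable_itv.
have i1 i : leb.-integrable `[0, t]%classic (EFin \o (\1_(I i) : R -> R)).
  apply: (@integrableS _ _ _ leb setT) => //; exact: integrable_indic_itv.
have iz i : leb.-integrable `[0, t]%classic (EFin \o (fun u => nth 0 L i * \1_(I i) u)).
  apply: (@eq_integrable _ _ _ leb _ (mD t) (fun u => (nth 0 L i)%:E * (\1_(I i) u)%:E)%E) => //.
  exact: (@integrableZl _ _ _ leb _ (mD t) (nth 0 L i) _ (i1 i)).
pose g u := \sum_(i < M) nth 0 L i * \1_(I i) u.
have gi : leb.-integrable `[0, t]%classic (EFin \o g).
  exact: (Rintegral_big_sum (index_enum 'I_M) (mD t) iz).1.
have fg u : u \in `[0, t[%classic -> f u = g u.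
  rewrite inE /= in_itv /= => /andP[u0 ut].
  rewrite fE ?u0 ?(lt_le_trans ut) //.
  have Mu : 0 <= M%:R * u by rewrite mulr_ge0.
  have uI i : (u \in I i) = (i == Num.truncn (M%:R * u)).
    rewrite eq_sym truncn_eq //; apply/idP/idP.
      rewrite inE /I /= in_itv /= => /andP[h1 h2].
      by rewrite mulrC -ler_pdivrMr // h1 -ltr_pdivlMr.
    move=> /andP[h1 h2]; rewrite inE /I /= in_itv /=.
    by rewrite ler_pdivrMr // mulrC h1 ltr_pdivlMr // mulrC.
  rewrite /g; have [kM|kM] := ltnP (Num.truncn (M%:R * u)) M; last first.
    rewrite nth_default ?sL // big1 // => i _; rewrite indicE uI.
    have /ltn_eqF -> : (i < Num.truncn (M%:R * u))%N by apply: leq_trans kM.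
    by rewrite mulr0.
  rewrite (bigD1 (Ordinal kM)) //= big1 ?addr0.
    by rewrite indicE uI eqxx mulr1.
  move=> i; rewrite -val_eqE /= => ik; rewrite indicE uI (negbTE ik) mulr0 //.
have gi' : leb.-integrable `[0, t[%classic (EFin \o g).
  apply: integrableS gi => //.
  by move=> x /=; rewrite !in_itv /= => /andP[-> /ltW ->].
have fi : leb.-integrable `[0, t[%classic (EFin \o f).
  by apply: eq_integrable gi' => // u ut; rewrite /= fg.
rewrite -Rintegral_itv_bndo_bndc //.
rewrite (@eq_Rintegral _ _ _ leb _ g f fg) Rintegral_itv_bndo_bndc //.
rewrite /g (Rintegral_big_sum (index_enum 'I_M) (mD t) (fun i : 'I_M => iz i)).2 ip_sum sL mulr_sumr; apply: eq_bigr => i _.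
rewrite RintegralZl //.
rewrite {1}/Rintegral integral_indic //; last exact: mI.
have -> := clamp_measure i M0 t0.
by field; rewrite gt_eqF.
Qed.

(** On each dyadic interval of level [n] the integrand is constant, with the
    product of the signs along the corresponding branch of the tree as value. *)
Lemma Bn_path (T : Type) (H ka : R) (eps : seq bool -> T -> R) n om t
    (e : seq bool -> bool) : (forall w, eps w om = sg R (e w)) -> 0 <= t <= 1 ->
  ka * Bn H eps n om t = ip (lev ka (2 `^ (- H)) n (sign_tree e n)) ((2 ^ n)%:R * t).
Proof.
move=> epsE t01; rewrite /Bn lev_full (map_comp ( *%R (ka * (2 `^ (- H)) ^+ n)) (leafval e)) ip_map.
have -> : (2 `^ (- H)) ^+ n = 2 `^ (- (n%:R * H)) :> R.
  by rewrite -powR_mulrn ?powR_ge0 // -powRrM mulNr mulrC.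
rewrite -!mulrA; congr (_ * (_ * _)).
have n0 : (2 ^ n)%:R != 0 :> R by rewrite pnatr_eq0 expn_eq0.
apply: (mulfI n0).
rewrite (@step_integral [seq 2 ^+ n * x | x <- [seq leafval e w | w <- words n]]) //.
- by rewrite ip_map natrX.
- by rewrite !size_map size_words.
- by rewrite expn_gt0.
move=> u u01; under eq_bigr do rewrite epsE; rewrite leafval_bword // natrX.
have [h|h] := ltnP (Num.truncn (2 ^+ n * u)) (2 ^ n).
  by rewrite [RHS](nth_map 0) // size_map size_words.
by rewrite !nth_default ?mulr0 // !size_map size_words.
Qed.

End SignTree.

(** * Functionals of continuous functions on the unit interval *)

Section ContinuousFunctions.
Variable R : realType.
Implicit Types (f g : C01 R) (x : seq R).

Lemma set_val01 (t : I01 R) : 0 <= set_val t <= 1.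
Proof. by have := set_valP t; rewrite /= in_itv. Qed.

Lemma clamp_in01 (s : R) : clamp s \in `[0, 1]%classic.
Proof. by rewrite inE /= in_itv /= clamp_range. Qed.

Definition proj01 (s : R) : I01 R := SigSub (clamp_in01 s).

Lemma proj01K t : proj01 (set_val t) = t.
Proof.
by apply: val_inj; rewrite /= -set_valE; apply: clamp_id; exact: set_val01.
Qed.

Lemma set_val_proj01 s : 0 <= s <= 1 -> set_val (proj01 s) = s.
Proof. by move=> s01; rewrite set_valE /= clamp_id. Qed.

Lemma proj01_continuous : continuous proj01.
Proof. by apply: continuous_comp_initial; exact: clamp_continuous. Qed.

Lemma C01_continuous f : continuous (f : I01 R -> R).
Proof. exact: (@cts_fun _ _ (f : continuousType (I01 R) R)). Qed.

(** The dyadic modulus of continuity of [f] tends to 0. *)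
Lemma C01_unif_continuous f (e : R) : 0 < e -> \forall n \near \oo,
  forall s t : I01 R, `|set_val s - set_val t| <= 2^-1 ^+ n -> `|f s - f t| <= e.
Proof.
move=> e0; pose g s := f (proj01 s).
(* On the line, [g] extends [f] by its values at 0 and 1. *)
have gc : continuous g.
  by move=> s; apply: continuous_comp; [exact: proj01_continuous|exact: C01_continuous].
have FF : Filter (\oo : set_system nat) by typeclasses eauto.
have /compact_near_coveringP := @segment_compact R 0 1.
move=> /(_ nat \oo (fun n s => forall t, `|s - t| <= 2^-1 ^+ n -> `|g s - g t| <= e) FF) [].
  move=> s _; have /cvgrPdist_le /(_ _ (divr_gt0 e0 (ltr0Sn R 1))) := gc s.
  move=> /nbhs_ballP[r /= r0 rg].
  have r20 : 0 < r / 2 by rewrite divr_gt0.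
  exists (ball s (r / 2), [set n | 2^-1 ^+ n < r / 2]); first split => /=.
  - exact: nbhsx_ballx.
  - have : (fun n => (2^-1 : R) ^+ n) @ \oo --> (0 : R).
      by apply: cvg_expr; rewrite ger0_norm // invf_lt1 // ltr1n.
    by move=> /cvgr_lt; apply.
  move=> [s' n] /= [ss' nr] t st.
  have h1 : `|g s - g s'| <= e / 2.
    by apply: rg; apply: le_ball ss'; rewrite [leRHS](splitr r) lerDl ltW.
  have h2 : `|g s - g t| <= e / 2.
    apply: rg; rewrite /ball /= -(subrK s' s) -addrA (le_lt_trans (ler_normD _ _)) //.
    rewrite [ltRHS](splitr r) ltrD //.
    exact: le_lt_trans nr.
  rewrite -(subrK (g s) (g s')) -addrA (le_trans (ler_normD _ _)) //.
  by rewrite [leRHS](splitr e) lerD // distrC.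
move=> n _ ng; exists n => // m nm s t st.
rewrite -[s]proj01K -[t]proj01K; apply: (ng m nm); rewrite ?set_val_proj01 ?proj01K //.
by rewrite /= in_itv /= set_val01.
Qed.

Lemma pathC_subproof x : continuous (fun t : I01 R => ip x ((size x)%:R * set_val t)).
Proof.
move=> t; apply: (@continuous_comp _ _ _ (fun t : I01 R => (size x)%:R * set_val t) (ip x));
  last exact: ip_continuous.
have sv : {for t, continuous (set_val : I01 R -> R)}.
  exact: (@initial_continuous (I01 R) R set_val t).
have cs : {for t, continuous ((fun=> (size x)%:R) : I01 R -> R)} by exact: cst_continuous.
exact: (continuousM cs sv).
Qed.

(** The broken line with increments [x] over equal subintervals of [[0, 1]]. *)
Definition pathC x : C01 R := mkC01 (@pathC_subproof x).

Lemma pathCE x t : pathC x t = ip x ((size x)%:R * set_val t).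
Proof. by []. Qed.

(** Bounded functionals that are Lipschitz for the uniform norm. *)
Definition lipC (M L : R) (Phi : C01 R -> R) :=
  (forall f, `|Phi f| <= M) /\
  (forall f g e, (forall t, `|f t - g t| <= e) -> `|Phi f - Phi g| <= L * e).

Lemma lipC_ge0 M L Phi : lipC M L Phi -> 0 <= L.
Proof.
move=> [_ PL]; have f : C01 R := pathC [::].
have := PL f f 1; rewrite subrr normr0 mulr1; apply=> t.
by rewrite subrr normr0.
Qed.

Lemma sbl_pathC M L Phi : lipC M L Phi -> sbl M L (fun x => Phi (pathC x)).
Proof.
move=> [PM PL]; split=> [x|x y a b]; first exact: PM.
by apply: PL => t; rewrite !pathCE !size_cat /=; exact: ip_slip.
Qed.

Lemma lipC_continuous M L Phi : lipC M L Phi -> continuous Phi.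
Proof.
move=> [PM PL] f; have FF : Filter (nbhs f) := nbhs_filter f.
apply/cvgrPdist_le => e e0.
have L1 : 0 < `|L| + 1 by rewrite ltr_wpDl.
have : nbhs f (ball f (e / (`|L| + 1))) by apply: nbhsx_ballx; exact: divr_gt0.
apply: filterS => g; rewrite C01_ballE => fg.
apply: le_trans (PL _ _ (e / (`|L| + 1)) _) _; first by move=> t; exact: ltW.
rewrite mulrCA ler_piMr ?(ltW e0) // ler_pdivrMr // mul1r.
by rewrite (le_trans (ler_norm L)) // lerDl.
Qed.

Lemma C01_measurable (Phi : C01 R -> R) : continuous Phi -> measurable_fun setT Phi.
Proof.
move=> cP; apply: (measurability _ (RGenOpens.measurableE R)) => //.
move=> _ [_ [a [b ->]] <-]; rewrite setTI; apply: sub_sigma_algebra.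
by apply: open_comp => // f _; exact: cP.
Qed.

Lemma lipC_measurable M L Phi : lipC M L Phi -> measurable_fun setT Phi.
Proof. by move=> h; apply: C01_measurable; exact: lipC_continuous h. Qed.

(** The largest [k]-Lipschitz minorant of [Phi]. *)
Definition lip_env (Phi : C01 R -> R) (k : nat) f : R :=
  inf [set y | exists g r, [/\ 0 <= r, forall t, `|f t - g t| <= r &
    y = Phi g + k%:R * r]].

Section lipschitz_envelope.
Variables (Phi : C01 R -> R) (M : R).
Hypothesis PM : forall f, `|Phi f| <= M.

Lemma lip_env_has_inf k f : has_inf [set y | exists g r,
  [/\ 0 <= r, forall t, `|f t - g t| <= r & y = Phi g + k%:R * r]].
Proof.
split; first by exists (Phi f), f, 0; split=> //;
  [move=> t; rewrite subrr normr0|rewrite mulr0 addr0].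
exists (- M) => _ [g [r [r0 _ ->]]].
by rewrite -[leLHS]addr0 lerD ?mulr_ge0 //; have := PM g; rewrite ler_norml => /andP[].
Qed.

Lemma lip_env_le k f : lip_env Phi k f <= Phi f.
Proof.
apply: ge_inf; first exact: (lip_env_has_inf k f).2.
by exists f, 0; split=> //; [move=> t; rewrite subrr normr0|rewrite mulr0 addr0].
Qed.

Lemma le_lip_env k f b :
  (forall g r, 0 <= r -> (forall t, `|f t - g t| <= r) -> b <= Phi g + k%:R * r) ->
  b <= lip_env Phi k f.
Proof.
move=> h; apply: lb_le_inf; first exact: (lip_env_has_inf k f).1.
by move=> _ [g [r [r0 fg ->]]]; exact: h.
Qed.

Lemma lip_env_lipC k : lipC M k%:R (lip_env Phi k).
Proof.
split=> [f|f g e fg].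
  rewrite ler_norml; apply/andP; split; last first.
    by apply: le_trans (lip_env_le k f) _; have := PM f; rewrite ler_norml => /andP[].
  apply: le_lip_env => g r r0 _.
  by rewrite -[leLHS]addr0 lerD ?mulr_ge0 //; have := PM g; rewrite ler_norml => /andP[].
have h f' g' : (forall t, `|f' t - g' t| <= e) ->
    lip_env Phi k f' - k%:R * e <= lip_env Phi k g'.
  move=> fg'; apply: le_lip_env => u r r0 gu.
  have e0 : 0 <= e by apply: le_trans (fg' (proj01 0)).
  rewrite lerBlDr -addrA -mulrDr; apply: ge_inf; first exact: (lip_env_has_inf k f').2.
  exists u, (r + e); split=> // [|t]; first exact: addr_ge0.
  rewrite [X in `|X|](_ : _ = (g' t - u t) + (f' t - g' t)); last by ring.
  by rewrite (le_trans (ler_normD _ _)) // lerD.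
rewrite ler_distl; apply/andP; split; first by apply: h => t; rewrite distrC.
by rewrite -lerBlDr; exact: h.
Qed.

Lemma lip_env_cvg f : {for f, continuous Phi} -> lip_env Phi k f @[k --> \oo] --> Phi f.
Proof.
move=> cP; have FF : Filter (nbhs f) := nbhs_filter f.
apply/cvgrPdist_le => e e0.
have /cvgrPdist_le /(_ _ e0) /nbhs_ballP[r /= r0 rP] := cP.
have M0 : 0 <= M by apply: le_trans (PM f).
exists (Num.bound (2 * M / (r / 2))) => // k /= kr.
have r20 : 0 < r / 2 by rewrite divr_gt0.
have kr2 : 2 * M <= k%:R * (r / 2).
  have h0 : 0 <= 2 * M / (r / 2) by apply: divr_ge0; [exact: mulr_ge0|exact: ltW].
  by rewrite -ler_pdivrMr // (le_trans (ltW (archi_boundP h0))) ?ler_nat.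
rewrite ger0_norm ?subr_ge0 ?lip_env_le // lerBlDr -lerBlDl.
apply: le_lip_env => g s s0 fg; have [sr|sr] := leP s (r / 2).
  have : ball f r g.
    rewrite C01_ballE => t; apply: le_lt_trans (fg t) _; apply: le_lt_trans sr _.
    by rewrite [ltRHS](splitr r) ltrDl.
  move=> /rP; rewrite ler_distl => /andP[_ h].
  by rewrite lerBlDr (le_trans h) // addrAC lerDl mulr_ge0.
have h1 := PM f; have h2 := PM g.
have h3 : 2 * M <= k%:R * s by apply: le_trans kr2 _; rewrite ler_wpM2l // ltW.
move: h1 h2; rewrite !ler_norml; clear -h3 e0; lra.
Qed.

End lipschitz_envelope.

(** Bounded Lipschitz functionals determine convergence in law, as a bounded
    continuous functional is the increasing limit of its Lipschitz minorants, and
    so is its opposite. *)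
Lemma weak_cvg_lipC (I : Type) (F : set_system I) (FF : Filter F)
    (mu : I -> probability (C01 R) R) (nu : probability (C01 R) R) :
  (forall M L Phi, lipC M L Phi ->
    \int[mu i]_f Phi f @[i --> F] --> \int[nu]_f Phi f) ->
  weak_cvg F mu nu.
Proof.
move=> lipcvg Phi cP [N [Nr Nb]].
have [M PM] : exists M : R, forall f, `|Phi f| <= M.
  by exists (N + 1) => f; apply: Nb => //; rewrite ltrDl.
have low (Psi : C01 R -> R) e : continuous Psi -> (forall f, `|Psi f| <= M) -> 0 < e ->
    \forall i \near F, \int[nu]_f Psi f - e <= \int[mu i]_f Psi f.
  move=> cPsi PsiM e0.
  have int (m : probability (C01 R) R) (G : C01 R -> R) : measurable_fun setT G ->
      (forall f, `|G f| <= M) -> m.-integrable setT (EFin \o G).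
    by move=> mG GM; apply: (@bounded_integrable _ _ _ m G M); [exact: mG|exact: GM].
  have e20 : 0 < e / 2 by rewrite divr_gt0.
  have env k := lip_env_lipC PsiM k.
  have : \int[nu]_f lip_env Psi k f @[k --> \oo] --> \int[nu]_f Psi f.
    apply: (@bounded_cvg _ _ _ nu _ _ M).
    - by move=> k; exact: lipC_measurable (env k).
    - exact: C01_measurable.
    - by move=> k f; exact: (env k).1.
    - by apply: aeW => f; apply: lip_env_cvg => //; exact: cPsi.
  move=> /cvgrPdist_le /(_ _ e20)[k _ /(_ k (leqnn k)) kP].
  have /cvgrPdist_le /(_ _ e20) := lipcvg _ _ _ (env k).
  apply: filterS => i ik.
  have h : \int[mu i]_f lip_env Psi k f <= \int[mu i]_f Psi f.
    apply: le_Rintegral => //.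
    - by apply: int; [exact: lipC_measurable (env k)|exact: (env k).1].
    - by apply: int => //; exact: C01_measurable.
    - by move=> f _; exact: lip_env_le PsiM _ _.
  move: kP ik h; rewrite !ler_norml; clear; lra.
apply/cvgrPdist_le => e e0.
have PN f : `|- Phi f| <= M by rewrite normrN.
have cN : continuous (fun f => - Phi f) by move=> f; exact: continuousN (cP f).
have h1 := low _ _ cP PM e0; have h2 := low _ _ cN PN e0.
apply: filterS2 h1 h2 => i.
have RN (m : probability (C01 R) R) : \int[m]_f (- Phi f) = - \int[m]_f Phi f.
  have iP : m.-integrable setT (EFin \o Phi).
    by apply: (@bounded_integrable _ _ _ m Phi M) => //; exact: C01_measurable.
  under eq_Rintegral do rewrite -mulN1r.
  by rewrite RintegralZl // mulN1r.
rewrite !RN ler_norml; clear; lra.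
Qed.

End ContinuousFunctions.

(** * Brownian motion along a regular grid *)

Section Brownian.
Variable R : realType.
Local Notation N := (stdnormal R).

Lemma IT_scale (mu nu : probability (measurableTypeR R) R) (c : R) n M L psi :
  (forall M L f, bl M L f -> \int[mu]_x f x = \int[nu]_x f (c * x)) ->
  sbl M L psi -> IT mu n psi = IT nu n (fun x => psi (map ( *%R c) x)).
Proof.
move=> h; elim: n psi => [|n IH] psi psiL //=.
rewrite (h _ _ _ (bl_IT_cons _ n psiL)).
by apply: eq_Rintegral => x _; apply: IH; exact: sbl_cons psiL.
Qed.

Lemma sbl_sumr M L (f : R -> R) : bl M L f -> sbl M L (fun s => f (\sum_(x <- s) x)).
Proof.
move=> [fM fL]; split=> [s|s1 s2 x y]; first exact: fM.
apply: le_trans (fL _ _) _; rewrite !big_cat !big_cons /=.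
by rewrite opprD addrACA subrr add0r opprD addrACA subrr addr0.
Qed.

Context (d : measure_display) (T : measurableType d) (Q : probability T R).
Variable W : R -> {RV Q >-> R}.
Hypothesis hW : is_brownian_motion W.

Definition incr (h : R) (k : nat) (om : T) : R := W (k.+1%:R * h) om - W (k%:R * h) om.

(** The increments of [W] along a grid are independent normal variables of
    variance [h]. *)
Lemma brownian_IT h m M L psi : 0 < h -> sbl M L psi ->
  measurable_fun setT (fun om => psi (mkseq (incr h ^~ om) m)) /\
  \int[Q]_om psi (mkseq (incr h ^~ om) m) =
    IT N m (fun x => psi (map ( *%R (Num.sqrt h)) x)).
Proof.
move=> h0 psiL; have sh0 : 0 < Num.sqrt h by rewrite sqrtr_gt0.
have sc : forall M L f, bl M L f -> _ := fun M L f => @normal_scale R _ f M L sh0.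
rewrite -(IT_scale m sc psiL); apply: indep_expect psiL.
  by move=> i; exact: measurable_funB.
move=> A mA; have [_ ind law _] := hW.
have incr_law i : Q (incr h i @^-1` A i) = normal_prob 0 (Num.sqrt h) (A i).
  have i0 : 0 <= i%:R * h by rewrite mulr_ge0 // ltW.
  have i1 : i%:R * h < i.+1%:R * h by rewrite ltr_pM2r // ltr_nat.
  have ih : i.+1%:R * h - i%:R * h = h.
    by rewrite -mulrBl -natr1 addrAC subrr add0r mul1r.
  have := law _ _ i0 i1 (A i) (mA i); rewrite ih; exact: id.
have t0 : 0 <= (0%N%:R * h) by rewrite mul0r.
have tS k : k%:R * h <= k.+1%:R * h by rewrite ler_wpM2r ?(ltW h0) // ler_nat.
have := ind m (fun k => k%:R * h) t0 tS [fset i in enum 'I_m]%fset (fun i => A i)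
  (fun i _ => mA i).
rewrite (_ : \bigcap_(i in _) _ = \bigcap_(i in [set k | (k < m)%N]) incr h i @^-1` A i).
  move=> ->; rewrite (perm_big (index_enum 'I_m)) /=.
    by apply: eq_bigr => i _; exact: incr_law.
  apply: uniq_perm; rewrite ?fset_uniq ?index_enum_uniq // => i.
  by rewrite inE mem_enum mem_index_enum.
apply/seteqP; split=> om /= Aom i /= im.
  by apply: (Aom (Ordinal im)); rewrite /= inE mem_enum.
exact: (Aom i (ltn_ord i)).
Qed.

(** A standard normal variable is the normalized sum of two independent ones:
    [W 1 - W 0] is such a sum, of the increments of [W] over the two halves of
    [[0, 1]]. *)
Lemma normal_stable M L f : bl M L f ->
  \int[N]_y \int[N]_x f (Num.sqrt 2^-1 * x + Num.sqrt 2^-1 * y) = \int[N]_x f x.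
Proof.
move=> fL; have fs := sbl_sumr fL.
have h20 : 0 < 2^-1 :> R by rewrite invr_gt0.
have [_] := brownian_IT 2 h20 fs; have [_] := brownian_IT 1 ltr01 fs.
rewrite /= sqrtr1 => e1 e2.
transitivity (\int[N]_x \int[N]_y f (\sum_(x <- [:: Num.sqrt 2^-1 * x; Num.sqrt 2^-1 * y]) x)).
  apply: eq_Rintegral => x _; apply: eq_Rintegral => y _.
  by rewrite !big_cons big_nil addr0 addrC.
transitivity (\int[N]_x f (\sum_(x <- [:: 1 * x]) x)); last first.
  by apply: eq_Rintegral => x _; rewrite big_seq1 mul1r.
rewrite -e2 -e1; apply: eq_Rintegral => om _; rewrite /mkseq /= !big_cons !big_nil !addr0 /incr.
congr f; rewrite mulfV ?pnatr_eq0 // !mul0r mulr1 addrC; ring.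
Qed.

Variable W01 : {RV Q >-> C01 R}.
Hypothesis hW01 : {ae Q, forall om, forall t : I01 R, W01 om t = W (set_val t) om}.

(** Almost surely, [W] is uniformly continuous on [[0, 1]] and is the uniform limit
    of the broken lines inscribed in it; their increments are independent and
    normal. *)
Lemma brownian_path_cvg M L Phi : lipC M L Phi ->
  IT N (2 ^ n) (fun x => Phi (pathC (map ( *%R (Num.sqrt 2^-1 ^+ n)) x))) @[n --> \oo]
    --> \int[Q]_om Phi (W01 om).
Proof.
move=> PL; have h0 n : 0 < 2^-1 ^+ n :> R by rewrite exprn_gt0 ?invr_gt0.
have sq n : Num.sqrt 2^-1 ^+ n = Num.sqrt (2^-1 ^+ n) :> R.
  rewrite -[LHS]ger0_norm ?exprn_ge0 ?sqrtr_ge0 // -sqrtr_sqr; congr Num.sqrt.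
  by rewrite exprAC sqr_sqrtr // invr_ge0.
have E n := brownian_IT (2 ^ n) (h0 n) (sbl_pathC PL).
under eq_fun do rewrite sq -(E _).2.
have [W0 _ _ _] := hW.
apply: (@bounded_cvg _ _ _ Q _ _ M) => [n||n om|]; first exact: (E n).1.
- exact: measurableT_comp (lipC_measurable PL) _.
- exact: PL.1.
apply: filterS2 W0 hW01 => om W00 W1.
have L0 := lipC_ge0 PL.
apply/cvgrPdist_le => e e0.
have L1 : 0 < L + 1 by rewrite ltr_wpDl.
have el : 0 < e / (L + 1) by rewrite divr_gt0.
apply: filterS (C01_unif_continuous (W01 om) el) => n mod.
apply: (@le_trans _ _ (L * (e / (L + 1)))); last first.
  by rewrite mulrCA ler_piMr ?(ltW e0) // ler_pdivrMr // mul1r lerDl.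
apply: PL.2 => t; rewrite distrC pathCE size_mkseq.
(* Through [proj01], [u] is defined at all integers and constant from [2 ^ n] on. *)
pose u (i : nat) := W01 om (proj01 (i%:R * 2^-1 ^+ n)).
have n0 : (2 ^ n)%:R != 0 :> R by rewrite pnatr_eq0 expn_eq0.
have nE : (2 ^ n)%:R * 2^-1 ^+ n = 1 :> R by rewrite natrX exprVn mulfV // -natrX.
have uE i : (i <= 2 ^ n)%N -> u i = W (i%:R * 2^-1 ^+ n) om.
  move=> im; rewrite /u W1 set_val_proj01 // mulr_ge0 ?(ltW (h0 n)) //=.
  by rewrite -[leRHS]nE ler_wpM2r ?(ltW (h0 n)) // ler_nat.
have -> : mkseq (incr (2^-1 ^+ n) ^~ om) (2 ^ n) = mkseq (fun i => u i.+1 - u i) (2 ^ n).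
  apply/eq_in_map => i; rewrite mem_iota add0n => /= im.
  by rewrite /incr !uE // ltnW.
rewrite [X in _ - X](_ : _ = W01 om t - u 0%N); last by rewrite uE // mul0r W00 subr0.
have /andP[t0 t1] := set_val01 t.
apply: ip_increments => [|i it]; first by rewrite mulr_ge0 //= ler_piMr.
apply: mod; rewrite -(clamp_id (set_val01 t)).
apply: le_trans (clamp_dist _ _) _.
have -> : i%:R * 2^-1 ^+ n - set_val t =
    - (((2 ^ n)%:R * set_val t - i%:R) * 2^-1 ^+ n).
  by rewrite mulrBl mulrAC nE mul1r opprB.
by rewrite normrN normrM (gtr0_norm (h0 n)) ler_piMl ?(ltW (h0 n)).
Qed.

End Brownian.

(** * The constants near [H = 1/2] *)

Section NearOneHalf.
Variable R : realType.
Implicit Types H : R.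

Lemma powR2E (x : R) : 2 `^ x = expR (x * ln 2).
Proof. by rewrite /powR pnatr_eq0. Qed.

Lemma powR2_lt (x y : R) : x < y -> 2 `^ x < 2 `^ y :> R.
Proof. by move=> xy; rewrite !powR2E ltr_expR ltr_pM2r // ln_gt0 // ltr1n. Qed.

Lemma powR2_neg1 : 2 `^ (-1) = 2^-1 :> R.
Proof. exact: powR_inv1. Qed.

Lemma powR2_sqr H : (2 `^ (- H)) ^+ 2 = 2 `^ (- (2 * H)) :> R.
Proof. by rewrite -powR_mulrn ?powR_ge0 // -powRrM mulNr mulrC. Qed.

(** The reason why the mean [ka] of the endpoint value vanishes in the limit. *)
Lemma inv_sigmaH H : 2^-1 < H ->
  (sigmaH H)^-1 = Num.sqrt (2 - 4 * (2 `^ (- H)) ^+ 2).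
Proof.
move=> H2; have -> : 4 * (2 `^ (- H)) ^+ 2 = 2 `^ (2 - 2 * H) :> R.
  rewrite powR2_sqr powRD ?pnatr_eq0 ?implybT //; congr (_ * _).
  by rewrite -natr1 powRD ?pnatr_eq0 ?implybT // powRr1 //; ring.
rewrite /sigmaH powRN invrK powR12_sqrt // subr_ge0.
by rewrite -[leRHS]powRr1 // ler_powR ?ler1n //; lra.
Qed.

Lemma param_range H : 2^-1 < H < 1 ->
  [/\ 2^-1 <= 2 `^ (- H), (2 `^ (- H)) ^+ 2 < 2^-1, 2 `^ (- H) * 2 `^ (H - 1) = 2^-1,
      0 <= (sigmaH H)^-1 & (sigmaH H)^-1 ^+ 2 = 2 - 4 * (2 `^ (- H)) ^+ 2].
Proof.
case/andP=> H1 H2.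
have th2 : (2 `^ (- H)) ^+ 2 < 2^-1 :> R.
  by rewrite powR2_sqr -powR2_neg1 powR2_lt //; lra.
split=> //.
- by rewrite -powR2_neg1 ler_powR ?ler1n //; lra.
- by rewrite -powRD ?pnatr_eq0 ?implybT // addKr powR2_neg1.
- by rewrite inv_sigmaH ?sqrtr_ge0.
- by rewrite inv_sigmaH // sqr_sqrtr //; move: th2; lra.
Qed.

Lemma near_param : \forall H \near (2^-1 : R)^'+, 2^-1 < H < 1.
Proof.
have h : 2^-1 < 1 :> R by rewrite invf_lt1 ?ltr1n.
near=> H; apply/andP; split; near: H; [exact: nbhs_right_gt|exact: nbhs_right_lt].
Unshelve. all: end_near. Qed.

Lemma th_half_cvg : 2 `^ (- H) @[H --> (2^-1 : R)^'+] --> Num.sqrt (2^-1 : R).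
Proof.
have -> : Num.sqrt (2^-1 : R) = expR (- 2^-1 * ln 2).
  by rewrite -powR2E powRN powR12_sqrt // sqrtrV.
under eq_fun do rewrite powR2E.
apply: cvg_at_right_filter.
apply: (@continuous_comp _ _ _ (fun H : R => - H * ln 2) expR); last exact: continuous_expR.
by apply: cvgMl; apply: cvgN.
Qed.

Lemma inv_sigmaH_cvg : (sigmaH H)^-1 @[H --> (2^-1 : R)^'+] --> (0 : R).
Proof.
have -> : 0 = Num.sqrt (2 - 4 * Num.sqrt (2^-1 : R) ^+ 2) :> R.
  by rewrite sqr_sqrtr ?invr_ge0 // (_ : 2 - 4 * 2^-1 = 0) ?sqrtr0 //; lra.
have : Num.sqrt (2 - 4 * (2 `^ (- H)) ^+ 2) @[H --> (2^-1 : R)^'+] -->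
    Num.sqrt (2 - 4 * Num.sqrt (2^-1 : R) ^+ 2).
  apply: continuous_cvg; first exact: sqrt_continuous.
  have FF : Filter ((2^-1 : R)^'+) by typeclasses eauto.
  have t2 := cvgM (FF:=FF) th_half_cvg th_half_cvg.
  exact: (cvgB (FF:=FF) (cvg_cst _) (cvgM (FF:=FF) (cvg_cst _) t2)).
apply: cvg_trans; apply: near_eq_cvg.
near=> H; rewrite inv_sigmaH //; near: H; exact: nbhs_right_gt.
Unshelve. all: end_near. Qed.

End NearOneHalf.

(** * Approximation of the limit of a weight family *)

Section Approximation.
Variable R : realType.

Lemma uniform_cvgP (T : choiceType) (u : nat -> T -> R) (v : T -> R) :
  {uniform, u @ \oo --> v} -> forall e, 0 < e ->
  \forall n \near \oo, forall t, `|v t - u n t| <= e.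
Proof.
move=> uv e e0.
have nb : nbhs (v : {uniform T -> R}) [set g | forall t, `|v t - g t| < e].
  rewrite uniform_nbhsT; exact: (@nbhsx_ballx R (arrow_uniform_type T R) v e e0).
have h : \forall n \near \oo, forall t, `|v t - u n t| < e := uv _ nb.
by apply: filterS h => n un t; exact: ltW.
Qed.

Variables (H : R) (d : measure_display) (T : measurableType d) (P : probability T R).
Variables (eps : seq bool -> {RV P >-> R}) (B : {RV P >-> C01 R}).
Hypothesis H01 : 2^-1 < H < 1.
Hypothesis weps : is_weight_family H eps.
Hypothesis hB : {ae P, forall om,
  {uniform, (fun n (t : I01 R) => Bn H eps n om (set_val t))
              @ \oo --> (B om : I01 R -> R)}}.
Local Notation th := (2 `^ (- H)).
Local Notation p := (2 `^ (H - 1)).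
Local Notation ka := ((sigmaH H)^-1).

(** For almost every outcome, the approximations of [B] converge uniformly, and
    they are broken lines built from a finite tree of independent signs. *)
Lemma weight_path_cvg M L Phi : lipC M L Phi ->
  ET p (fun t : tree n => Phi (pathC (lev ka th n t))) @[n --> \oo] -->
  \int[P]_om Phi (scaleC01 ka (B om)).
Proof.
move=> PL.
under eq_fun do rewrite -(expect_tree weps).
apply: (@bounded_cvg _ _ _ P _ _ M) => [n||n om|].
- exact: (fin_measurable (@measurable_tree _ _ _ _ _ _ weps n)
    (fun t => Phi (pathC (lev ka th n t)))).
- apply: (measurableT_comp (lipC_measurable PL)).
  by apply: measurableT_comp => //; exact: measurable_scaleC01.
- exact: PL.1.
apply: filterS hB => om Bom; apply/cvgrPdist_le => e e0.
have L0 := lipC_ge0 PL.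
have k0 : 0 <= ka by have [] := param_range H01.
have LK : 0 < L * ka + 1 by rewrite ltr_wpDl ?mulr_ge0.
have el : 0 < e / (L * ka + 1) by rewrite divr_gt0.
apply: filterS (uniform_cvgP Bom el) => n nP.
apply: (@le_trans _ _ (L * (ka * (e / (L * ka + 1))))); last first.
  by rewrite mulrA mulrCA ler_piMr ?(ltW e0) // ler_pdivrMr // mul1r lerDl.
apply: PL.2 => t; rewrite pathCE size_lev //.
rewrite -(@Bn_path R T H ka (fun w => eps w) n om _ _ (epsE weps ^~ om)) ?set_val01 //.
by rewrite [X in `|X - _|](_ : _ = ka * B om t) // -mulrBr normrM (ger0_norm k0) ler_wpM2l.
Qed.

(** The fluctuations below scale [n] contribute little, uniformly in [H]. *)
Lemma path_tail M L Phi q n N : lipC M L Phi -> 0 < q < 1 -> q ^+ 4 = 2^-1 ->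
  (n <= N)%N ->
  `|ET p (fun t : tree N => Phi (pathC (lev ka th N t))) -
    ET p (fun t : tree N => Phi (pathC (lev ka th n t)))| <= L * (10 / (1 - q) * q ^+ n).
Proof.
move=> PL q01 q4 nN; have [th_ge th2 pth k0 k2] := param_range H01.
have p1 := p_range th_ge pth.
rewrite -ETB; apply: le_trans (ler_norm_ET p1 _) _.
apply: (@le_trans _ _ (L * ET p (fun t : tree N => gap ka th q n t))); last first.
  by rewrite ler_wpM2l ?(lipC_ge0 PL) // ET_gap // ltW.
rewrite -ETZ; apply: ET_le => // t; apply: PL.2 => s.
rewrite !pathCE !size_lev //; apply: ip_gap => //.
by case/andP: q01.
Qed.

End Approximation.

(** * Convergence in law *)

Lemma Rintegral_distribution (R : realType) (d d' : measure_display)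
    (T : measurableType d) (T' : measurableType d') (P : probability T R)
    (X : {mfun T >-> T'}) (f : T' -> R) (M : R) :
  measurable_fun setT f -> (forall x, `|f x| <= M) ->
  \int[distribution P X]_x f x = \int[P]_om f (X om).
Proof.
move=> mf fM; rewrite /Rintegral integral_distribution //.
  exact/measurable_EFinP.
apply: (@bounded_integrable _ _ _ P (f \o X) M) => // [|x]; last exact: fM.
exact: measurableT_comp.
Qed.

Theorem theorem1p2 (R : realType)
    (* for each H, a probability space carrying the weights and B_H *)
    (d : R -> measure_display) (Om : forall H : R, measurableType (d H))
    (P : forall H : R, probability (Om H) R)
    (eps : forall H : R, seq bool -> {RV (P H) >-> R})
    (B : forall H : R, {RV (P H) >-> C01 R})
    (* a Brownian motion and its restriction to [0,1] *)
    (d' : measure_display) (Om' : measurableType d') (Q : probability Om' R)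
    (W : R -> {RV Q >-> R}) (W01 : {RV Q >-> C01 R})
    (heps : forall H : R, 2^-1 < H < 1 -> is_weight_family H (eps H))
    (hB : forall H : R, 2^-1 < H < 1 ->
      {ae P H, forall om,
        {uniform, (fun n (t : I01 R) => Bn H (eps H) n om (set_val t))
                    @ \oo --> (B H om : I01 R -> R)}})
    (hW : is_brownian_motion W)
    (hW01 : {ae Q, forall om, forall t : I01 R, W01 om t = W (set_val t) om}) :
  weak_cvg ((2^-1 : R)^'+)
    (fun H => distribution (P H) (scaleC01 (sigmaH H)^-1 \o B H))
    (distribution Q W01).
Proof.
apply: weak_cvg_lipC => M L Phi PL; have L0 := lipC_ge0 PL.
have near_H := near_param R.
have mP := lipC_measurable PL.
have distE H : \int[distribution (P H) (scaleC01 (sigmaH H)^-1 \o B H)]_f Phi f =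
    \int[P H]_om Phi (scaleC01 (sigmaH H)^-1 (B H om)).
  exact: (Rintegral_distribution _ _ mP PL.1).
rewrite (Rintegral_distribution _ _ mP PL.1).
under eq_fun do rewrite distE.
(* With [q = 2^(-1/4)] the two terms of each summand of [gap] have the same order. *)
pose r : R := Num.sqrt 2^-1; pose q := Num.sqrt r.
have r0 : 0 < r by rewrite sqrtr_gt0 invr_gt0.
have r2 : r ^+ 2 = 2^-1 by rewrite sqr_sqrtr // invr_ge0.
have q0 : 0 < q by rewrite sqrtr_gt0.
have q2 : q ^+ 2 = r by rewrite sqr_sqrtr // ltW.
have q4 : q ^+ 4 = 2^-1 by rewrite (exprM q 2 2) q2.
have q1 : q < 1.
  by rewrite -(@ltr_pXn2r _ 4) ?nnegrE ?(ltW q0) // expr1n q4 invf_lt1 ?ltr1n.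
apply/cvgrPdist_le => e e0.
have e40 : 0 < e / 4 by rewrite divr_gt0.
have cvgW := brownian_path_cvg hW hW01 PL.
have tail0 : L * (10 / (1 - q) * q ^+ n) @[n --> \oo] --> (0 : R).
  have qn : q ^+ n @[n --> \oo] --> (0 : R) by apply: cvg_expr; rewrite gtr0_norm.
  have := cvgM (cvg_cst L) (cvgM (cvg_cst (10 / (1 - q))) qn).
  by rewrite !mulr0; apply.
have [n [nW ntail]] : exists n,
    `|\int[Q]_om Phi (W01 om) -
      IT (stdnormal R) (2 ^ n) (fun x => Phi (pathC (map ( *%R (r ^+ n)) x)))| <= e / 4 /\
    L * (10 / (1 - q) * q ^+ n) <= e / 4.
  have h1 : \forall n \near \oo, `|\int[Q]_om Phi (W01 om) -
      IT (stdnormal R) (2 ^ n) (fun x => Phi (pathC (map ( *%R (r ^+ n)) x)))| <= e / 4.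
    exact: cvgr_dist_le.
  have h2 : \forall n \near \oo, `|0 - L * (10 / (1 - q) * q ^+ n)| <= e / 4.
    exact: cvgr_dist_le.
  have [n _ /(_ n (leqnn n)) [g1 g2]] := filterI h1 h2; exists n; split=> //.
  by move: g2; rewrite sub0r normrN; apply: le_trans; exact: ler_norm.
have L1 : 0 < L + 1 by rewrite ltr_wpDl.
have d0 : 0 < e / 4 / (L + 1) by rewrite divr_gt0.
have dL : e / 4 / (L + 1) * L <= e / 4.
  by rewrite mulrAC ler_pdivrMr // ler_wpM2l ?(ltW e40) // lerDl.
have range : \forall H \near (2^-1 : R)^'+, [/\ 2^-1 <= 2 `^ (- H), (2 `^ (- H)) ^+ 2 < 2^-1,
    2 `^ (- H) * 2 `^ (H - 1) = 2^-1, 0 <= (sigmaH H)^-1 &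
    (sigmaH H)^-1 ^+ 2 = 2 - 4 * (2 `^ (- H)) ^+ 2].
  by apply: filterS near_H => H; exact: param_range.
have FF : Filter ((2^-1 : R)^'+) by typeclasses eauto.
(* The level [n] is fixed from here on, independently of [H]. *)
have clt := lev_clt (FF := FF) (fun M L f => @normal_stable _ _ _ _ _ hW M L f) range
  (@th_half_cvg R) (@inv_sigmaH_cvg R) n d0.
apply: (@filterS2 _ _ FF _ _ _ _ near_H clt) => H H01 HN.
have cvB := weight_path_cvg H01 (heps H H01) (hB H H01) PL.
have limB : \forall N \near \oo, `|\int[P H]_om Phi (scaleC01 (sigmaH H)^-1 (B H om)) -
    ET (2 `^ (H - 1)) (fun t : tree N =>
      Phi (pathC (lev (sigmaH H)^-1 (2 `^ (- H)) N t)))| <= e / 4.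
  exact: cvgr_dist_le.
have nN : \forall N \near \oo, (n <= N)%N by exact: nbhs_infty_ge.
have [N _ /(_ N (leqnn N)) [[g1 g2] g3]] := filterI (filterI limB nN) HN.
have g4 := path_tail H01 PL (introT andP (conj q0 q1)) q4 g2.
have {}g3 := le_trans (g3 _ _ _ (sbl_pathC PL)) dL.
have {}g4 := le_trans g4 ntail.
move: nW g1 g3 g4 => /=; rewrite -/r.
set a := \int[Q]_om _; set b := IT _ _ _; set c := ET _ _; set c' := ET _ _.
set l := \int[P H]_om _.
rewrite !ler_norml; clear; lra.
Qed.
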